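(* Let $\mathcal{X}=\bigotimes_{j\in[k]}\mathcal{X}_j\subseteq\mathbb{R}^{m\times k}_{\ge0}$ with each $\mathcal{X}_j$ a nonempty convex compact subset of $[0,R]^m$ (the allowed $j$-th columns), convex $\psi_j$ on $\mathcal{X}_j$, $\psi(\mathbf{X})=\sum_j\psi_j(\mathbf{X}_j)$ with $|\psi(\mathbf{X})|\in[0,B_\psi]$ on $\mathcal{X}$, $0<R,B_\psi\le\mathrm{poly}(m)$. Let $\bar{\mathbf{X}}\in\mathcal{X}$ and $\rho>0$ with $\rho\ge\frac32\|\bar{\mathbf{X}}\|_{1,\infty}$. Given $\varepsilon,\delta>1/\mathrm{poly}(m)$ and, for every $j$, a $(\mathcal{T}_j,\delta_{\mathrm{SCO}})$-SCO for $(\mathcal{X}_j,\psi_j)$ with $\delta_{\mathrm{SCO}}>1/\mathrm{poly}(m,k)$ small enough, there is an algorithm which, given $\rho$ (and $\varepsilon,\delta$ and the oracles), outputs in $\hat O(\sum_{j\in[k]}(\mathcal{T}_j+m)\varepsilon^{-1})$ time some $\hat{\mathbf{X}}\in\mathcal{X}$ with $$\psi(\hat{\mathbf{X}})+\|\hat{\mathbf{X}}\|_{1,\infty}\le\psi(\bar{\mathbf{X}})+\|\bar{\mathbf{X}}\|_{1,\infty}+\varepsilon\rho+\delta.$$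
   Context: $\|\mathbf{X}\|_{1,\infty}=\max_i\sum_j|\mathbf{X}_{ij}|$. A $(\mathcal{T},\delta)$-SCO for $(\mathcal{X}_j,\psi_j)$ is an oracle which, queried with $m$-decomposable functions $c_1,\dots,c_m$, outputs in $\mathcal{T}$ time $\hat{\mathbf{x}}\in\mathcal{X}_j$ with $\psi_j(\hat{\mathbf{x}})+\sum_ic_i(\hat{\mathbf{x}}_i)\le\min_{\mathbf{x}\in\mathcal{X}_j}\psi_j(\mathbf{x})+\sum_ic_i(\mathbf{x}_i)+\delta$. A convex $c$ is $(m,K)$-computable if its epigraph $\{(x,t):c(x)\le t\}$ admits a $\nu$-self-concordant barrier $\phi_c$ with $\nu\le K$, $|c(x)|=O(m^K+|x|^K)$, $\nabla^2\phi_c(x,t)\preceq\exp(\log^{O(1)}m)\mathbf{I}$ whenever $|x|,|t|\le m^K$ and $\phi_c(x,t)\le\tilde O(1)$, and $\nabla\phi_c,\nabla^2\phi_c$ computable in $\tilde O(1)$ time; $c$ is $m$-decomposable if it is a sum of $O(1)$ functions $x\mapsto\min_{a+b=x,a\in[\theta_\ell,\theta_u]}c_1(a)+c_2(b)$ with $0\le\theta_\ell\le\theta_u$ and $c_1,c_2$ $(m,O(\log^{O(1)}m))$-computable. $\hat O$ hides $m^{o(1)}$ factors.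
   Formalization: The factor ε^{-1} in the running time is read as max(1, ε^{-1}): for ε polynomially larger than 1 the literal bound is impossible, since querying each oracle once and writing the mk output entries already takes longer; for ε ≤ 1 the bound is as stated. *)

(* Defs.v *)
(* MathComp / MathComp-Analysis *)
From HB Require Import structures.
From mathcomp Require Import all_boot all_order all_algebra.
From mathcomp Require Import all_classical all_reals all_analysis.
Import Order.TTheory GRing.Theory Num.Theory.
Import numFieldNormedType.Exports.

Set Implicit Arguments.
Unset Strict Implicit.
Unset Printing Implicit Defensive.

Local Open Scope classical_set_scope.
Local Open Scope ring_scope.

(** * Machine model

    A real RAM given as a while language.  Memory consists of natural-number
    cells and real cells, each addressed by a static array name and two computed
    indices.  Real arithmetic is exact; there is no conversion from reals to
    naturals, and naturals have no multiplication, so that unit cost per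
    operation is the usual convention.  [exp] and [ln] are primitive because the
    gradients of the usual barriers for power functions need real powers.

    The type [Q] of query instructions is a parameter: the code of a cost
    function has none, the algorithm has oracle queries. *)

Inductive iexp :=
| INat of nat
| ICell of nat & iexp & iexp
| IAdd of iexp & iexp
| ISub of iexp & iexp.

Inductive rexp :=
| RNat of iexp
| RCell of nat & iexp & iexp
| RAdd of rexp & rexp
| RSub of rexp & rexp
| RMul of rexp & rexp
| RDiv of rexp & rexp
| RExp of rexp
| RLn of rexp.

Inductive bexp :=
| BLeI of iexp & iexp
| BLeR of rexp & rexp
| BNot of bexp
| BAnd of bexp & bexp.

Inductive cmd (Q : Type) :=
| Skip
| SetI of nat & iexp & iexp & iexp
| SetR of nat & iexp & iexp & rexp
| Seq of cmd Q & cmd Q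
| If of bexp & cmd Q & cmd Q
| While of bexp & cmd Q
| Query of Q.

Arguments Skip {Q}.
Arguments SetI {Q}.
Arguments SetR {Q}.

Record state (R : realType) := State {
  imem : nat -> nat -> nat -> nat;
  rmem : nat -> nat -> nat -> R }.

Definition upd (T : Type) (M : nat -> nat -> nat -> T) (a i j : nat) (v : T) :=
  fun a' i' j' => if [&& a' == a, i' == i & j' == j] then v else M a' i' j'.

Fixpoint ieval (R : realType) (s : state R) (e : iexp) : nat :=
  match e with
  | INat n => n
  | ICell a i j => imem s a (ieval s i) (ieval s j)
  | IAdd e1 e2 => (ieval s e1 + ieval s e2)%N
  | ISub e1 e2 => (ieval s e1 - ieval s e2)%N
  end.

Fixpoint reval (R : realType) (s : state R) (e : rexp) : R :=
  match e with
  | RNat e1 => (ieval s e1)%:R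
  | RCell a i j => rmem s a (ieval s i) (ieval s j)
  | RAdd e1 e2 => reval s e1 + reval s e2
  | RSub e1 e2 => reval s e1 - reval s e2
  | RMul e1 e2 => reval s e1 * reval s e2
  | RDiv e1 e2 => reval s e1 / reval s e2
  | RExp e1 => expR (reval s e1)
  | RLn e1 => ln (reval s e1)
  end.

Fixpoint beval (R : realType) (s : state R) (e : bexp) : bool :=
  match e with
  | BLeI e1 e2 => (ieval s e1 <= ieval s e2)%N
  | BLeR e1 e2 => reval s e1 <= reval s e2
  | BNot e1 => ~~ beval s e1
  | BAnd e1 e2 => beval s e1 && beval s e2
  end.

Fixpoint icost (e : iexp) : nat :=
  match e with
  | INat _ => 1
  | ICell _ e1 e2 | IAdd e1 e2 | ISub e1 e2 => (icost e1 + icost e2).+1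
  end.

Fixpoint rcost (e : rexp) : nat :=
  match e with
  | RNat e1 => (icost e1).+1
  | RCell _ e1 e2 => (icost e1 + icost e2).+1
  | RAdd e1 e2 | RSub e1 e2 | RMul e1 e2 | RDiv e1 e2 =>
      (rcost e1 + rcost e2).+1
  | RExp e1 | RLn e1 => (rcost e1).+1
  end.

Fixpoint bcost (e : bexp) : nat :=
  match e with
  | BLeI e1 e2 => (icost e1 + icost e2).+1
  | BLeR e1 e2 => (rcost e1 + rcost e2).+1
  | BNot e1 => (bcost e1).+1
  | BAnd e1 e2 => (bcost e1 + bcost e2).+1
  end.

(** [exec ask c s n s'] : from [s], [c] terminates in [s'] after time [n].
    [ask q s n s'] gives the effect and the time of the query [q]. *)
Inductive exec (R : realType) (Q : Type)
    (ask : Q -> state R -> nat -> state R -> Prop) :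
    cmd Q -> state R -> nat -> state R -> Prop :=
| ESkip s : exec ask Skip s 1 s
| ESetI a i j e s :
    exec ask (SetI a i j e) s (icost i + icost j + icost e).+1
      (State (upd (imem s) a (ieval s i) (ieval s j) (ieval s e)) (rmem s))
| ESetR a i j e s :
    exec ask (SetR a i j e) s (icost i + icost j + rcost e).+1
      (State (imem s) (upd (rmem s) a (ieval s i) (ieval s j) (reval s e)))
| ESeq c1 c2 s1 s2 s3 n1 n2 :
    exec ask c1 s1 n1 s2 -> exec ask c2 s2 n2 s3 ->
    exec ask (Seq c1 c2) s1 (n1 + n2).+1 s3
| EIf b c1 c2 s s' n :
    exec ask (if beval s b then c1 else c2) s n s' ->
    exec ask (If b c1 c2) s (bcost b + n).+1 s'
| EWhileF b c s :
    beval s b = false -> exec ask (While b c) s (bcost b).+1 s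
| EWhileT b c s1 s2 s3 n1 n2 :
    beval s1 b -> exec ask c s1 n1 s2 -> exec ask (While b c) s2 n2 s3 ->
    exec ask (While b c) s1 (bcost b + n1 + n2).+1 s3
| EQuery q s s' n :
    ask q s n s' -> exec ask (Query q) s n.+1 s'.

Definition fcode := cmd void.

Definition no_query (R : realType) (q : void) (s : state R) (n : nat)
  (s' : state R) : Prop := of_void Prop q.

(** * Asymptotics

    [polylog C m] and [polybd C m], for some [C], stand for [log^O(1) m]
    (also [Otilde(1)]) and [poly(m)]; the shifts only serve to keep them positive
    for all [m >= 1]. *)

Definition polylog (R : realType) (C m : nat) : R :=
  C%:R * (1 + ln (m%:R : R)) ^+ C.

Definition polybd (R : realType) (C m : nat) : R := m.+1%:R ^+ C.

(** [f m = m ^ o(1)] *)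
Definition subpoly (R : realType) (f : nat -> R) : Prop :=
  forall eta : R, 0 < eta ->
    exists M : nat, forall m, (M <= m)%N -> f m <= m%:R `^ eta.

(** * Self-concordant barriers *)

Definition D2 (R : realType) (V : normedModType R) (phi : V -> R) (z u v : V)
  : R := 'D_u ('D_v phi) z.

Definition D3 (R : realType) (V : normedModType R) (phi : V -> R)
  (z u v w : V) : R := 'D_u ('D_v ('D_w phi)) z.

(** [phi] is of class C^3 on the open set [U], in terms of directional
    derivatives. *)
Definition C3_on (R : realType) (V : normedModType R) (U : set V)
    (phi : V -> R) : Prop :=
  forall z, U z -> forall u v w : V,
    [/\ derivable phi z w, derivable ('D_w phi) z v,
        derivable ('D_v ('D_w phi)) z u &
        {for z, continuous (fun y => D3 phi y u v w)}].

(** [phi] is a [nu]-self-concordant barrier for the closed convex set [K]; its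
    values outside the interior of [K] are irrelevant. *)
Definition sc_barrier (R : realType) (V : normedModType R) (K : set V) (nu : R)
    (phi : V -> R) : Prop :=
  [/\ C3_on K° phi,
      forall z h, K° z -> 0 <= D2 phi z h h,
      forall z h, K° z -> `|D3 phi z h h h| <= 2 * Num.sqrt (D2 phi z h h) ^+ 3,
      forall z h, K° z -> ('D_h phi z) ^+ 2 <= nu * D2 phi z h h &
      forall z, (K `\` K°) z -> phi y @[y --> within K° (nbhs z)] --> +oo].

(** * Computable and decomposable functions *)

Definition epigraph (R : realType) (c : R -> R) : set (R * R) :=
  [set z | c z.1 <= z.2].

(** The code of a cost function finds [x] and [t] in cells [0,1] of row 0 of
    array 0 and its real parameters in row 0 of array 1. *)
Definition code_input (R : realType) (par : nat -> R) (x t : R) : state R :=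
  State (fun _ _ _ => 0%N)
    (fun a i l => match a, i, l with
                  | 0%N, 0%N, 0%N => x
                  | 0%N, 0%N, 1%N => t
                  | 1%N, 0%N, _ => par l
                  | _, _, _ => 0
                  end).

(** The gradient is returned in row 0 of array 2, the Hessian in rows 1 and 2. *)
Definition computes_derivatives (R : realType) (U : set (R * R))
    (phi : R * R -> R) (cd : fcode) (par : nat -> R) (time : R) : Prop :=
  let ex : R * R := (1, 0) in
  let et : R * R := (0, 1) in
  forall z, U z -> exists (n : nat) (s : state R),
    [/\ exec (@no_query R) cd (code_input par z.1 z.2) n s,
        n%:R <= time,
        rmem s 2 0 0 = 'D_ex phi z /\ rmem s 2 0 1 = 'D_et phi z,
        rmem s 2 1 0 = D2 phi z ex ex /\ rmem s 2 1 1 = D2 phi z ex et &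
        rmem s 2 2 0 = D2 phi z et ex /\ rmem s 2 2 1 = D2 phi z et et].

(** [c] is [(m, K)]-computable, by the code [cd] with real parameters [par]; [C]
    bounds all the constants hidden in the asymptotic notation. *)
Definition computable (R : realType) (C m : nat) (K : R) (c : R -> R)
    (cd : fcode) (par : nat -> R) : Prop :=
  [/\ convex_function [set: R] c,
      forall x, `|c x| <= C%:R * (m%:R `^ K + `|x| `^ K) &
      exists (nu : R) (phi : R * R -> R),
        [/\ sc_barrier (epigraph c) nu phi,
            nu <= K,
            forall z, (epigraph c)° z ->
              `|z.1| <= m%:R `^ K -> `|z.2| <= m%:R `^ K ->
              phi z <= polylog R C m ->
              forall h : R * R,
                D2 phi z h h <= expR (polylog R C m) * (h.1 ^+ 2 + h.2 ^+ 2) &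
            computes_derivatives (epigraph c)° phi cd par (polylog R C m)]].

(** Description of [x |-> min_(a + b = x, a in [lo, up]) c1 a + c2 b]; both codes
    use the same parameters. *)
Record piece (R : realType) := Piece {
  lo : R;
  up : R;
  code1 : fcode;
  code2 : fcode;
  par : nat -> R }.

Definition is_piece (R : realType) (C m : nat) (g : R -> R) (d : piece R)
  : Prop :=
  exists (c1 c2 : R -> R),
    [/\ exists2 K, K <= polylog R C m & computable C m K c1 (code1 d) (par d),
        exists2 K, K <= polylog R C m & computable C m K c2 (code2 d) (par d),
        0 <= lo d <= up d &
        forall x,
          (exists2 a, lo d <= a <= up d & g x = c1 a + c2 (x - a)) /\
          (forall a, lo d <= a <= up d -> g x <= c1 a + c2 (x - a))].

(** [c] is [m]-decomposable, with description [d]. *)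
Definition decomposable (R : realType) (C m : nat) (c : R -> R)
    (d : seq (piece R)) : Prop :=
  (size d <= C)%N /\
  exists g : 'I_(size d) -> R -> R,
    (forall l : 'I_(size d), is_piece C m (g l) (tnth (in_tuple d) l)) /\
    (forall x, c x = \sum_l g l x).

(** * Oracles *)

(** An oracle gets the descriptions of [m] functions and answers, in time
    [oracle_time], with a vector. *)
Record oracle (R : realType) (m : nat) := Oracle {
  oracle_time : nat;
  oracle_answer : ('I_m -> seq (piece R)) -> 'cV[R]_m }.

(** [O] is an [(oracle_time O, dsco)]-SCO for [(X, psi)].  A convex [psi] need not
    attain its minimum on [X]: the guarantee compares with every point of [X]. *)
Definition is_sco (R : realType) (m C : nat) (X : set 'cV[R]_m)
    (psi : 'cV[R]_m -> R) (dsco : R) (O : oracle R m) : Prop :=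
  forall (c : 'I_m -> R -> R) (d : 'I_m -> seq (piece R)),
    (forall i, decomposable C m (c i) (d i)) ->
    let xh := oracle_answer O d in
    X xh /\
    forall x, X x ->
      psi xh + \sum_i c i (xh i 0) <= psi x + \sum_i c i (x i 0) + dsco.

(** A query instruction fixes the codes; the column of the oracle and the
    numerical data are read in memory.  For the triple [(a, c1, c2)], row [i] of
    the real array [a] holds the data of the corresponding piece of the [i]-th
    function: the two thresholds, then the parameters.  The answer is stored in
    column 0 of the array [q_ans]. *)
Record query := MkQuery {
  q_col : iexp;
  q_pieces : seq (nat * fcode * fcode);
  q_ans : nat }.

Definition algorithm := cmd query.

Definition query_desc (R : realType) (m : nat) (s : state R) (q : query)
    (i : 'I_m) : seq (piece R) :=
  [seq Piece (rmem s t.1.1 i 0) (rmem s t.1.1 i 1) t.1.2 t.2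
         (fun l => rmem s t.1.1 i l.+2) | t <- q_pieces q].

Definition ask (R : realType) (m k : nat) (O : 'I_k -> oracle R m) (q : query)
    (s : state R) (n : nat) (s' : state R) : Prop :=
  exists j : 'I_k,
    let xh := oracle_answer (O j) (query_desc s q) in
    [/\ ieval s (q_col q) = j,
        n = (icost (q_col q) + oracle_time (O j))%N &
        s' = State (imem s)
               (fun a i l => match insub i : option 'I_m with
                             | Some i' => if (a == q_ans q) && (l == 0)%N
                                          then xh i' 0 else rmem s a i l
                             | None => rmem s a i l
                             end)].

Definition alg_input (R : realType) (m k : nat) (rho eps delta : R) : state R :=
  State (fun a i l => match a, i, l with
                      | 0, 0, 0 => m
                      | 0, 0, 1 => k
                      | _, _, _ => 0
                      end%N)
    (fun a i l => match a, i, l with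
                  | 0%N, 0%N, 0%N => rho
                  | 0%N, 0%N, 1%N => eps
                  | 0%N, 0%N, 2%N => delta
                  | _, _, _ => 0
                  end).

(** The result is read in array 1. *)
Definition alg_output (R : realType) (m k : nat) (s : state R) : 'M[R]_(m, k) :=
  \matrix_(i, j) rmem s 1 i j.

(** * The composite l_(1,oo) regression problem *)

Definition norm1oo (R : realType) (m k : nat) (X : 'M[R]_(m, k)) : R :=
  \big[Num.max/0]_(i < m) \sum_(j < k) `|X i j|.

Definition colprod (R : realType) (m k : nat) (X : 'I_k -> set 'cV[R]_m)
  : set 'M[R]_(m, k) := [set Y | forall j, X j (col j Y)].

Definition psisum (R : realType) (m k : nat) (psi : 'I_k -> 'cV[R]_m -> R)
  (Y : 'M[R]_(m, k)) : R := \sum_(j < k) psi j (col j Y).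

(* Main.v *)
(* The algorithm is optimistic follow-the-regularized-leader, run for the matrix player of the
   game min_X max_y psi(X) + <y, X 1>, y a probability vector on the rows. In round t the
   weights y_t are the soft maximum of the loads S_(t-1) + x_(t-1) - h(X_(t-1)), where S is
   the sum of the row sums x of the previous iterates, and each column of X_t is one oracle
   answer for the cost <Q_t, X> / t + <y_t, h(X)> / t + hinge(X), where Q_t cumulates the
   weights and the overload prices below.

   The regularizer h_j is the inverse of s |-> w_j ((1 + 24 s / w_j)^q - 1) + eta s, a
   smoothed multiple of (1 + x / w_j)^(1 + theta) - 1 with theta ~ 1 / log m. It is
   1/4-Lipschitz on the relevant range and its modulus of convexity at x is of order theta /
   (w_j + x); by Cauchy-Schwarz the squared l_1 movement of a row whose sum is at most rho
   polylog m is paid for by this convexity up to a factor rho polylog m. Hence a temperature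
   C of order rho polylog m absorbs the quadratic errors of the soft maximum, and the regret
   is O(C log m) independently of the number of rounds. Inverting the function makes the
   epigraph of h_j the hypograph of a concave increasing function g with s |g'''(s)| <= 2
   |g''(s)|, for which - ln (g(t) - x) - ln t is a 2-self-concordant barrier; linear and
   hinge costs belong to the same family.

   Two devices keep the iterates in the range where this holds. Within a round the price of
   row i grows by the factor 1 + X_ij / (4 rho) after each column, so that a row sum above 6
   rho ln (cap_price / base_price) would cost more than the target. The widths w_j come from
   a first query with a tiny linear price; a column of the target that is much larger than
   its width is replaced by the answer to that query. *)
Require Import Defs.
From mathcomp Require Import all_boot all_order all_algebra.
From mathcomp Require Import all_classical all_reals all_analysis.
From mathcomp Require Import ring lra zify.
Import Order.TTheory GRing.Theory Num.Theory.
Import numFieldNormedType.Exports.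

Local Open Scope classical_set_scope.
Local Open Scope ring_scope.

Set Implicit Arguments.
Unset Strict Implicit.
Unset Printing Implicit Defensive.

(** * Directional derivatives *)

(** The delicate point is the coupling of the two players. The regularizer [<y, h(X)>] moves with
    [y], so a change of weights costs [<y_(t+1) - y_t, h(X_(t+1))>]; keeping [- h(X)] in the
    argument of the soft maximum makes exactly this term telescope. What remains is quadratic in the
    movement of the row sums and weighted by [y], and the convexity of the regularizer carries the
    same weights. No error growing with the number of rounds is left, which is the source of the
    rate [1 / eps].

    The argument looks circular: stable weights need bounded row sums, and the bound on the row sums
    is read off an inequality that needs stable weights. [rowsum_bound] unties this by strong
    induction on the round; there the Lipschitz constant 1/4 of [h] and the weight ratio 4 are
    matched to each other.

    Since [rho] may be arbitrarily small, the program works at the scale [max rho delta], which is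
    at least an inverse polynomial; all polynomial slacks are powers of [m + 1]. *)

Section DirectionalDerivatives.
Variables (R : realType) (V : normedModType R).

(** Restriction to the line [s |-> s *: v + z] turns a directional derivative into a one-variable
    derivative at 0, to which the scalar chain rule applies. *)
Lemma is_derive_lineE (f : V -> R) (z v : V) (d : R) :
  is_derive z v f d <-> is_derive (0 : R) 1 (fun s : R => f (s *: v + z)) d.
Proof.
have E : (fun h : R => h^-1 *: (((fun s : R => f (s *: v + z)) \o shift 0) (h *: 1)
     - f (0 *: v + z))) = (fun h => h^-1 *: ((f \o shift z) (h *: v) - f z)).
  by apply/funext => h /=; rewrite scale0r add0r /shift /= addr0 [h *: 1]mulr1.
by split; case=> h1 h2; split; rewrite /derivable /derive ?E //; move: h1 h2;
   rewrite /derivable /derive E.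
Qed.

Lemma is_derive_comp1 (h : R -> R) (f : V -> R) (z v : V) (df dh : R) :
  is_derive z v f df -> is_derive (f z) 1 h dh ->
  is_derive z v (fun y => h (f y)) (dh * df).
Proof.
move=> /is_derive_lineE Df Dh; apply/is_derive_lineE.
set phi := fun s : R => f (s *: v + z).
have p0 : phi 0 = f z by rewrite /phi scale0r add0r.
have Dh' : is_derive (phi 0) 1 h dh by rewrite p0.
have [df1 df2] := Df; have [dh1 dh2] := Dh'.
split.
  apply/derivable1_diffP/differentiable_comp; exact/derivable1_diffP.
have := derive1_comp df1 dh1.
by rewrite !derive1E df2 dh2 => <-.
Qed.

Section Pointwise.
Variables (f g : V -> R) (z v : V) (df dg : R).
Hypotheses (Df : is_derive z v f df) (Dg : is_derive z v g dg).

Lemma is_derive_add : is_derive z v (fun y => f y + g y) (df + dg).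
Proof. exact: is_deriveD. Qed.

Lemma is_derive_sub : is_derive z v (fun y => f y - g y) (df - dg).
Proof. exact: is_deriveB. Qed.

Lemma is_derive_opp : is_derive z v (fun y => - f y) (- df).
Proof. exact: is_deriveN. Qed.

Lemma is_derive_mul : is_derive z v (fun y => f y * g y) (f z * dg + g z * df).
Proof. exact: is_deriveM. Qed.

Lemma is_derive_inv : f z != 0 -> is_derive z v (fun y => (f y)^-1) (- df / f z ^+ 2).
Proof.
move=> fz; have [df1 df2] := Df; split; first exact: derivableV.
by rewrite deriveV // df2 /GRing.scale /=; field.
Qed.

Lemma is_derive_ln : 0 < f z -> is_derive z v (fun y => ln (f y)) (df / f z).
Proof.
move=> fz; apply: is_derive_eq.
  by apply: (is_derive_comp1 Df); exact: is_derive1_ln.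
by rewrite mulrC.
Qed.

End Pointwise.

End DirectionalDerivatives.

Section Plane.
Variable R : realType.
Implicit Types (z v : R * R).

Lemma is_derive_affine (a b : R) : is_derive (0 : R) 1 (fun s : R => s * a + b) a.
Proof.
have Did : is_derive (0 : R) (1 : R) (fun s : R => s) 1 by exact: is_derive_id.
have Dcst (c : R) : is_derive (0 : R) (1 : R) (fun _ : R => c) 0.
  by exact: is_derive_cst.
have D := is_derive_add (is_derive_mul Did (Dcst a)) (Dcst b).
by apply: (is_derive_eq D); rewrite /=; ring.
Qed.

Lemma is_derive_fst z v : is_derive z v (fun y : R * R => y.1) v.1.
Proof. by apply/is_derive_lineE; exact: is_derive_affine. Qed.

Lemma is_derive_snd z v : is_derive z v (fun y : R * R => y.2) v.2.
Proof. by apply/is_derive_lineE; exact: is_derive_affine. Qed.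

End Plane.

(** * The cost family and its inverse *)

(** [gd > 0] bounds the slope of [gfun] from below, hence the growth of its inverse; [ge] is the
    point up to which the inverse vanishes. *)
Record gpar (R : realType) := GPar { ga : R; gb : R; gd : R; ge : R; gq : R }.

Definition gok (R : realType) (P : gpar R) :=
  [/\ 0 <= ga P, 0 <= gb P, 0 < gd P, 0 <= ge P & 0 <= gq P <= 1].

Section Family.
Variables (R : realType) (P : gpar R).
Implicit Types s t r : R.
Local Notation a := (ga P).
Local Notation b := (gb P).
Local Notation d := (gd P).
Local Notation e := (ge P).
Local Notation q := (gq P).

Definition gfun (s : R) : R := a * ((1 + b * s) `^ q - 1) + d * s + e.
Definition gfun1 (s : R) : R := a * b * q * (1 + b * s) `^ (q - 1) + d.
Definition gfun2 (s : R) : R := a * b ^+ 2 * (q * (q - 1)) * (1 + b * s) `^ (q - 2).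
Definition gfun3 (s : R) : R :=
  a * b ^+ 3 * (q * (q - 1) * (q - 2)) * (1 + b * s) `^ (q - 3).

Hypothesis ok : gok P.

Let a0 : 0 <= a. Proof. by case: ok. Qed.
Let b0 : 0 <= b. Proof. by case: ok. Qed.
Let q0 : 0 <= q. Proof. by case: ok => _ _ _ _ /andP[]. Qed.
Let q1 : q <= 1. Proof. by case: ok => _ _ _ _ /andP[]. Qed.

Lemma gbase_gt0 s : 0 <= s -> 0 < 1 + b * s.
Proof. by move=> s0; rewrite ltr_pwDl// mulr_ge0. Qed.

Lemma is_derive_gbase s : is_derive s (1 : R) (fun x : R => 1 + b * x) b.
Proof.
have Did : is_derive s (1 : R) (fun s : R => s) 1 by exact: is_derive_id.
have Dcst (c : R) : is_derive s (1 : R) (fun _ : R => c) 0.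
  by exact: is_derive_cst.
have D := is_derive_add (Dcst 1) (is_derive_mul (Dcst b) Did).
by apply: (is_derive_eq D); rewrite /=; ring.
Qed.

Lemma is_derive_gpow r s : 0 <= s ->
  is_derive s (1 : R) (fun x : R => (1 + b * x) `^ r) (r * b * (1 + b * s) `^ (r - 1)).
Proof.
move=> s0; have D := is_derive_comp1 (is_derive_gbase s) (is_derive1_powR r (gbase_gt0 s0)).
by apply: (is_derive_eq D); rewrite mulrAC.
Qed.

Lemma is_derive_cstmul (c df : R) s (f : R -> R) : is_derive s (1 : R) f df ->
  is_derive s (1 : R) (fun x => c * f x) (c * df).
Proof.
move=> Df; have Dcst : is_derive s (1 : R) (fun _ : R => c) 0 by exact: is_derive_cst.
have D := is_derive_mul Dcst Df.
by apply: (is_derive_eq D); rewrite mulr0 addr0.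
Qed.

Lemma is_derive_gfun s : 0 <= s -> is_derive s (1 : R) gfun (gfun1 s).
Proof.
move=> s0.
have Did : is_derive s (1 : R) (fun s : R => s) 1 by exact: is_derive_id.
have Dcst (c : R) : is_derive s (1 : R) (fun _ : R => c) 0 by exact: is_derive_cst.
have D := is_derive_add (is_derive_add (is_derive_cstmul a
  (is_derive_sub (is_derive_gpow q s0) (Dcst 1))) (is_derive_cstmul d Did)) (Dcst e).
by apply: (is_derive_eq D); rewrite /gfun1; ring.
Qed.

Lemma is_derive_gfun1 s : 0 <= s -> is_derive s (1 : R) gfun1 (gfun2 s).
Proof.
move=> s0.
have Dcst (c : R) : is_derive s (1 : R) (fun _ : R => c) 0 by exact: is_derive_cst.
have D := is_derive_add (is_derive_cstmul (a * b * q) (is_derive_gpow (q - 1) s0)) (Dcst d).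
apply: (is_derive_eq D); rewrite /gfun2.
have -> : q - 1 - 1 = q - 2 by ring.
by ring.
Qed.

Lemma is_derive_gfun2 s : 0 <= s -> is_derive s (1 : R) gfun2 (gfun3 s).
Proof.
move=> s0.
have D := is_derive_cstmul (a * b ^+ 2 * (q * (q - 1))) (is_derive_gpow (q - 2) s0).
apply: (is_derive_eq D); rewrite /gfun3.
have -> : q - 2 - 1 = q - 3 by ring.
by ring.
Qed.

Lemma gfun2_le0 s : gfun2 s <= 0.
Proof.
rewrite /gfun2 mulr_le0_ge0 ?powR_ge0// mulr_ge0_le0 ?mulr_ge0 ?exprn_ge0//.
by rewrite mulr_ge0_le0// subr_le0.
Qed.

(** Here [|gfun3 s| = |gfun2 s| * b (2 - q) / (1 + b s)], and [b s (2 - q) <= 2 (1 + b s)]. This is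
    the compatibility that self-concordance of the barrier asks of [g]. *)
Lemma gfun3_bound s : 0 <= s -> s * `|gfun3 s| <= 2 * - gfun2 s.
Proof.
move=> s0; set u := 1 + b * s; have u0 : 0 < u := gbase_gt0 s0.
have E : u `^ (q - 2) = u `^ (q - 3) * u.
  have -> : q - 2 = (q - 3) + 1 by ring.
  by rewrite powRD ?powRr1 ?(ltW u0)// (gt_eqF u0) implybT.
set c := a * b ^+ 2 * (q * (1 - q)) * u `^ (q - 3).
have c0 : 0 <= c.
  by rewrite /c !mulr_ge0 ?powR_ge0 ?exprn_ge0 ?subr_ge0.
have -> : gfun3 s = c * (b * (2 - q)) by rewrite /gfun3 -/u /c; ring.
have -> : - gfun2 s = c * u by rewrite /gfun2 -/u E /c; ring.
have b2 : 0 <= b * (2 - q) by rewrite mulr_ge0// subr_ge0 (le_trans q1) ?ler1n.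
rewrite (ger0_norm (mulr_ge0 c0 b2)).
have -> : s * (c * (b * (2 - q))) = c * (b * s * (2 - q)) by ring.
rewrite [leRHS]mulrCA ler_wpM2l// /u.
have : 0 <= b * s * q by rewrite !mulr_ge0.
move=> h; by nra.
Qed.

Lemma gfun_diff s t : 0 <= s -> s <= t ->
  exists2 c, s <= c <= t & gfun t - gfun s = gfun1 c * (t - s).
Proof.
move=> s0 st.
have [||c] := @MVT_segment R gfun gfun1 s t st.
- move=> x; rewrite in_itv/= => /andP[sx _].
  by apply: is_derive_gfun; rewrite (le_trans s0)// ltW.
- apply: derivable_within_continuous => x; rewrite in_itv/= => /andP[sx _].
  by have [] := is_derive_gfun (le_trans s0 sx).
by rewrite in_itv/=; exists c.
Qed.

Lemma gfun1_ge s : d <= gfun1 s.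
Proof. by rewrite /gfun1 lerDr !mulr_ge0 ?powR_ge0. Qed.

Lemma gfun_incr s t : 0 <= s -> s <= t -> gfun s + d * (t - s) <= gfun t.
Proof.
move=> s0 st; have [c _ E] := gfun_diff s0 st.
rewrite -lerBrDl E ler_wpM2r ?gfun1_ge// subr_ge0//.
Qed.

Lemma gfun0 : gfun 0 = e.
Proof. by rewrite /gfun mulr0 addr0 powR1 subrr mulr0 mulr0 !add0r. Qed.

End Family.

(** * The inverse of an increasing concave function *)

Section Inverse.
Variables (R : realType) (P : gpar R).
Implicit Types s t r x : R.
Hypothesis ok : gok P.
Local Notation a := (ga P).
Local Notation b := (gb P).
Local Notation d := (gd P).
Local Notation e := (ge P).
Local Notation q := (gq P).
Local Notation g := (gfun P).

Let d0 : 0 < d. Proof. by case: ok. Qed.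
Let e0 : 0 <= e. Proof. by case: ok. Qed.

(** For [x <= e] the set is all of [s >= 0], so the inverse is continued by 0; this continuation
    produces the hinge. *)
Definition ginv x : R := inf [set s | 0 <= s /\ x <= g s].

Lemma gfun_mono s t : 0 <= s -> s <= t -> g s <= g t.
Proof.
move=> s0 st; apply: le_trans (gfun_incr ok s0 st).
by rewrite lerDl mulr_ge0 ?subr_ge0// ltW.
Qed.

Lemma gfun_lt s t : 0 <= s -> s < t -> g s < g t.
Proof.
move=> s0 st; apply: lt_le_trans (gfun_incr ok s0 (ltW st)).
by rewrite ltrDl mulr_gt0// subr_gt0.
Qed.

Lemma gfun_ge t : 0 <= t -> d * t + e <= g t.
Proof.
move=> t0; have := gfun_incr ok (lexx 0) t0.
by rewrite gfun0 subr0 addrC.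
Qed.

Lemma gfun_surj x : e <= x -> exists2 t, 0 <= t & g t = x.
Proof.
move=> ex; have t0 : 0 <= (x - e) / d by rewrite divr_ge0 ?subr_ge0// ltW.
have gx : x <= g ((x - e) / d).
  by apply: le_trans (gfun_ge t0); rewrite mulrC divfK ?gt_eqF// subrK.
have [||t] := @IVT R g 0 ((x - e) / d) x t0.
- apply: derivable_within_continuous => y; rewrite in_itv/= => /andP[y0 _].
  by have [] := is_derive_gfun ok y0.
- have gg : g 0 <= g ((x - e) / d) by exact: gfun_mono.
  by rewrite (min_idPl gg) (max_idPr gg) gfun0 ex gx.
by rewrite in_itv/= => /andP[t0' _] gt; exists t.
Qed.

(** A Galois connection: through it convexity, monotonicity and growth of [ginv], and the shape of
    its epigraph, become statements about [g]. *)
Lemma ginvP x s : (ginv x <= s) <-> (0 <= s /\ x <= g s).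
Proof.
have [t t0 tP] : exists2 t, 0 <= t & forall s, (t <= s) <-> (0 <= s /\ x <= g s).
  have [xe|ex] := leP x e.
    exists 0 => // r; split=> [r0|[]//]; split=> //.
    by apply: le_trans xe _; rewrite -(gfun0 P) gfun_mono.
  have [t t0 tx] := gfun_surj (ltW ex); exists t => // r; split=> [tr|[r0 xr]].
    by split; [exact: le_trans tr|rewrite -tx gfun_mono].
  by rewrite leNgt; apply/negP => rt; move: xr; rewrite -tx leNgt gfun_lt.
suff -> : ginv x = t by [].
apply/eqP; rewrite eq_le; apply/andP; split.
  apply: ge_inf; last by apply/tP.
  by exists 0 => r [].
by apply: lb_le_inf; [exists t; apply/tP|move=> r /tP].
Qed.

Lemma ginv_ge0 x : 0 <= ginv x.
Proof. by have /ginvP[] := lexx (ginv x). Qed.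

Lemma ginv_gfun x : e <= x -> g (ginv x) = x.
Proof.
move=> /gfun_surj[t t0 tx].
suff -> : ginv x = t by [].
apply/eqP; rewrite eq_le; apply/andP; split; first by apply/ginvP; rewrite tx.
have /ginvP[i0 xi] := lexx (ginv x).
by rewrite leNgt; apply/negP => /(gfun_lt i0); rewrite tx ltNge xi.
Qed.

Lemma ginv_eq0 x : x <= e -> ginv x = 0.
Proof.
move=> xe; apply/eqP; rewrite eq_le ginv_ge0 andbT.
by apply/ginvP; rewrite gfun0.
Qed.

Lemma ginv_le x : ginv x <= `|x| / d.
Proof.
have x0 : 0 <= `|x| / d by rewrite divr_ge0// ltW.
apply/ginvP; split => //; apply: le_trans (ler_norm x) _.
by apply: le_trans (gfun_ge x0); rewrite mulrC divfK ?gt_eqF// lerDl.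
Qed.

Lemma gfun1_diff s t : 0 <= s -> s <= t ->
  exists2 c, s <= c <= t & gfun1 P t - gfun1 P s = gfun2 P c * (t - s).
Proof.
move=> s0 st.
have [||c] := @MVT_segment R (gfun1 P) (gfun2 P) s t st.
- move=> x; rewrite in_itv/= => /andP[sx _].
  by apply: (is_derive_gfun1 ok); rewrite (le_trans s0)// ltW.
- apply: derivable_within_continuous => x; rewrite in_itv/= => /andP[sx _].
  by have [] := is_derive_gfun1 ok (le_trans s0 sx).
by rewrite in_itv/=; exists c.
Qed.

(* [g + nu s^2 / 2] is concave on [0, B] because its derivative is nonincreasing. *)
Lemma gfun_strongly_concave nu B s t k :
  (forall r, 0 <= r -> r <= B -> gfun2 P r <= - nu) ->
  0 <= s -> s <= t -> t <= B -> 0 <= k -> k <= 1 ->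
  k * g s + (1 - k) * g t + nu / 2 * (k * (1 - k)) * (t - s) ^+ 2
  <= g (k * s + (1 - k) * t).
Proof.
move=> Hnu s0 st tB k0 k1; set m := k * s + (1 - k) * t.
have sm : s <= m by rewrite /m; nra.
have mt : m <= t by rewrite /m; nra.
pose f r := g r + nu / 2 * (r * r); pose f1 r := gfun1 P r + nu * r.
have b0 : 0 <= b by case: ok.
have Df r : 0 <= r -> is_derive r (1 : R) f (f1 r).
  move=> r0; have Did : is_derive r (1 : R) (fun s : R => s) 1 by exact: is_derive_id.
  have D := is_derive_add (is_derive_gfun ok r0)
    (is_derive_cstmul (nu / 2) (is_derive_mul Did Did)).
  by apply: (is_derive_eq D); rewrite /f1; field.
have H r r' : s <= r -> r <= r' -> r' <= t -> f1 r' <= f1 r.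
  move=> sr rr' rt; have [c /andP[rc cr]] := gfun1_diff (le_trans s0 sr) rr'.
  have c0 : 0 <= c by rewrite (le_trans s0)// (le_trans sr).
  have h := Hnu c c0 (le_trans cr (le_trans rt tB)) => E.
  have rr : 0 <= r' - r by rewrite subr_ge0.
  by rewrite /f1; nra.
have MV r r' : s <= r -> r <= r' -> r' <= t ->
    exists2 c, r <= c <= r' & f r' - f r = f1 c * (r' - r).
  move=> sr rr' rt; have [||c] := @MVT_segment R f f1 r r' rr'.
  - by move=> x; rewrite in_itv/= => /andP[sx _]; apply: Df; rewrite (le_trans s0)// (le_trans sr)// ltW.
  - apply: derivable_within_continuous => x; rewrite in_itv/= => /andP[sx _].
    by have [] := Df x (le_trans s0 (le_trans sr sx)).
  by rewrite in_itv/=; exists c.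
have [c1 /andP[sc1 c1m] e1] := MV s m (lexx _) sm mt.
have [c2 /andP[mc2 c2t] e2] := MV m t sm mt (lexx _).
have h1 := H c1 m sc1 c1m mt; have h2 := H m c2 sm mc2 c2t.
have E1 : m - s = (1 - k) * (t - s) by rewrite /m; ring.
have E2 : t - m = k * (t - s) by rewrite /m; ring.
have E3 : k * f s + (1 - k) * f t - f m = k * g s + (1 - k) * g t
    + nu / 2 * (k * (1 - k)) * (t - s) ^+ 2 - g m by rewrite /f /m; field.
rewrite -subr_le0 -E3.
have -> : k * f s + (1 - k) * f t - f m = (1 - k) * (f t - f m) - k * (f m - f s) by ring.
rewrite e1 e2 E1 E2.
have -> : (1 - k) * (f1 c2 * (k * (t - s))) - k * (f1 c1 * ((1 - k) * (t - s))) =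
  (k * (1 - k) * (t - s)) * (f1 c2 - f1 c1) by ring.
by rewrite mulr_ge0_le0 ?mulr_ge0 ?subr_ge0// subr_le0 (le_trans h2 h1).
Qed.

Lemma gfun_concave s t k : 0 <= s -> 0 <= t -> 0 <= k -> k <= 1 ->
  k * g s + (1 - k) * g t <= g (k * s + (1 - k) * t).
Proof.
move=> s0 t0 k0 k1.
have H u v l : 0 <= u -> u <= v -> 0 <= l -> l <= 1 ->
    l * g u + (1 - l) * g v <= g (l * u + (1 - l) * v).
  move=> u0 uv l0 l1.
  have := @gfun_strongly_concave 0 v u v l _ u0 uv (lexx v) l0 l1.
  rewrite mul0r !mul0r addr0; apply=> r _ _; rewrite oppr0; exact: gfun2_le0.
have [st|/ltW ts] := leP s t; first exact: H.
have := H t s (1 - k) t0 ts; rewrite subr_ge0 subKr.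
have k1' : 1 - k <= 1 by rewrite gerBl.
by move=> /(_ k1 k1'); rewrite [X in X <= _]addrC [(1 - k) * t + _]addrC.
Qed.

Lemma ginv_convex x y k : 0 <= k -> k <= 1 ->
  ginv (k * x + (1 - k) * y) <= k * ginv x + (1 - k) * ginv y.
Proof.
move=> k0 k1; have k1' : 0 <= 1 - k by rewrite subr_ge0.
have /ginvP[i0 xi] := lexx (ginv x); have /ginvP[j0 yj] := lexx (ginv y).
apply/ginvP; split; first by rewrite addr_ge0// mulr_ge0.
by apply: le_trans (gfun_concave i0 j0 k0 k1); rewrite lerD// ler_wpM2l.
Qed.

(* If [g] is [nu]-strongly concave and [G]-Lipschitz on [0, B], its inverse is strongly
   convex there, with a modulus proportional to [nu / G ^ 3]. *)
Lemma ginv_midpoint nu B G x y : 0 <= nu -> 0 < G ->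
  (forall r, 0 <= r -> r <= B -> gfun2 P r <= - nu) ->
  (forall r, 0 <= r -> r <= B -> gfun1 P r <= G) ->
  nu * B <= 4 * G ->
  e <= x -> e <= y -> ginv x <= B -> ginv y <= B ->
  ginv ((x + y) / 2) + nu / (8 * G ^+ 3) * (x - y) ^+ 2 <= (ginv x + ginv y) / 2.
Proof.
move=> nu0 G0 Hnu HG nuB.
wlog st : x y / ginv x <= ginv y => [H ex ey xB yB|ex ey _ tB].
  have [h|/ltW h] := leP (ginv x) (ginv y); first exact: H.
  have := H y x h ey ex yB xB; rewrite [y + x]addrC [ginv y + _]addrC.
  by rewrite -[y - x]opprB sqrrN.
set s := ginv x in st *; set t := ginv y in st tB *.
have s0 : 0 <= s by exact: ginv_ge0.
have k0 : 0 <= 2^-1 :> R by rewrite invr_ge0.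
have k1 : 2^-1 <= 1 :> R by rewrite invf_le1 ?ler1n.
have h1 := gfun_strongly_concave Hnu s0 st tB k0 k1.
have gs : g s = x by exact: ginv_gfun.
have gt : g t = y by exact: ginv_gfun.
rewrite gs gt in h1.
(* At the midpoint [m] of [s] and [t], strong concavity gives [g m] an excess of [G * Om] over
   [(x + y) / 2]; stepping back by [Om] loses at most [G * Om]. *)
set Om := nu / (8 * G) * (t - s) ^+ 2.
have G3 : (x - y) ^+ 2 <= G ^+ 2 * (t - s) ^+ 2.
  have [c /andP[sc ct] E] := gfun_diff ok s0 st.
  rewrite gs gt in E; rewrite -[x - y]opprB sqrrN E exprMn ler_wpM2r ?sqr_ge0//.
  have c0 := le_trans s0 sc.
  have := HG c c0 (le_trans ct tB) => h.
  have h' : 0 <= gfun1 P c by apply: le_trans (gfun1_ge ok c); rewrite ltW.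
  by rewrite !expr2 ler_pM.
apply: (@le_trans _ _ (ginv ((x + y) / 2) + Om)).
  rewrite lerD2l /Om.
  have -> : nu / (8 * G) * (t - s) ^+ 2 = nu / (8 * G ^+ 3) * (G ^+ 2 * (t - s) ^+ 2).
    by field; rewrite gt_eqF.
  by rewrite ler_wpM2l// divr_ge0// mulr_ge0// exprn_ge0// ltW.
have t0 : 0 <= t by exact: le_trans st.
have Om0 : 0 <= Om by rewrite /Om mulr_ge0 ?sqr_ge0// divr_ge0// mulr_ge0// ltW.
set m := (s + t) / 2.
have mE : m = 2^-1 * s + (1 - 2^-1) * t by rewrite /m; field.
(* The assumption [nu * B <= 4 * G] keeps [m - Om] in the domain of nonnegative arguments. *)
have OmS : Om <= m.
  have h : (t - s) ^+ 2 <= B * t.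
    have h1' : (t - s) ^+ 2 <= t ^+ 2.
      by rewrite !expr2 ler_pM ?subr_ge0 ?gerBl.
    by apply: le_trans h1' _; rewrite expr2 ler_wpM2r.
  have h2 : nu * (t - s) ^+ 2 <= 4 * G * t.
    apply: (@le_trans _ _ (nu * (B * t))); first by rewrite ler_wpM2l.
    by rewrite mulrA ler_wpM2r.
  rewrite /Om mulrAC ler_pdivrMr ?mulr_gt0// /m.
  have : 0 <= G * s by rewrite mulr_ge0// ltW.
  by move=> h3; nra.
rewrite -lerBrDr; apply/ginvP; split; first by rewrite subr_ge0.
have mt : m - Om <= m by rewrite gerBl.
have m0 : 0 <= m - Om by rewrite subr_ge0.
have mB : m <= B by apply: le_trans tB; rewrite /m; lra.
have [c /andP[mc cm] E] := gfun_diff ok m0 mt.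
have hG : gfun1 P c <= G by apply: HG; [exact: le_trans mc|exact: le_trans mB].
have hE : g m - g (m - Om) <= G * Om.
  by rewrite E subKr ler_wpM2r.
have hO : G * Om = nu / 2 * (2^-1 * (1 - 2^-1)) * (t - s) ^+ 2.
  by rewrite /Om; field; rewrite gt_eqF.
rewrite -hO -mE in h1.
have -> : (x + y) / 2 = 2^-1 * x + (1 - 2^-1) * y by field.
lra.
Qed.

Lemma ginv_incr x y : x <= y -> ginv x <= ginv y.
Proof.
move=> xy; have /ginvP[j0 yj] := lexx (ginv y).
by apply/ginvP; split=> //; exact: le_trans yj.
Qed.

End Inverse.

(** * The barrier *)

Section Barrier.
Variables (R : realType) (P : gpar R).
Implicit Types (s t r x : R) (z u v w : R * R).
Hypothesis ok : gok P.
Local Notation g := (gfun P).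
Local Notation g1 := (gfun1 P).
Local Notation g2 := (gfun2 P).
Local Notation g3 := (gfun3 P).

Let d0 : 0 < gd P. Proof. by case: ok. Qed.

Definition slack z : R := g z.2 - z.1.

Definition epi_int : set (R * R) := [set z | 0 < z.2 /\ 0 < slack z].

Lemma epigraphE z : epigraph (ginv P) z <-> 0 <= z.2 /\ 0 <= slack z.
Proof. by rewrite /slack subr_ge0; exact: ginvP. Qed.

Let cont_comp2 (f : R -> R) z df : is_derive z.2 (1 : R) f df ->
  {for z, continuous (fun y : R * R => f y.2)}.
Proof.
move=> [Df _]; apply: continuous_comp; first exact: cvg_snd.
by apply/differentiable_continuous/derivable1_diffP.
Qed.

Lemma slack_continuous z : 0 <= z.2 -> {for z, continuous slack}.
Proof.
move=> z0; apply: continuousB; last exact: cvg_fst.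
exact: cont_comp2 (is_derive_gfun ok z0).
Qed.

Lemma epi_int_near z : epi_int z -> \forall y \near z, epi_int y.
Proof.
move=> [z0 s0]; near=> y; split; near: y.
  exact: (cvgr_gt _ (@cvg_snd _ _ (nbhs z.1) (nbhs z.2) _)).
exact: (cvgr_gt _ (slack_continuous (ltW z0))).
Unshelve. all: by end_near. Qed.

Lemma interior_epigraph : (epigraph (ginv P))° = epi_int.
Proof.
apply/seteqP; split=> z.
  rewrite /interior => /nbhs_ballP[eps /= eps0 H].
  have e2 : 0 < eps / 2 by rewrite divr_gt0.
  (* Inside the ball, [x] is raised and [t] lowered: that this point is still in the epigraph makes
     both inequalities strict at [z]. *)
  have /epigraphE[/= h1 h2] : epigraph (ginv P) (z.1 + eps / 2, z.2 - eps / 2).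
    apply: H; split; rewrite /= -ball_normE /ball_ /=.
      by rewrite opprD addrA subrr sub0r normrN gtr0_norm// ltr_pdivrMr// ltr_pMr// ltr1n.
    by rewrite subKr gtr0_norm// ltr_pdivrMr// ltr_pMr// ltr1n.
  have z2 : z.2 - eps / 2 < z.2 by rewrite gtrBl.
  split; first exact: le_lt_trans h1 z2.
  have := gfun_lt ok h1 z2; rewrite /slack /= in h2 *; lra.
move=> /epi_int_near; apply: filterS => y [y0 s0].
by apply/epigraphE; rewrite !ltW.
Qed.

(** * Derivatives of the barrier up to order three *)

Section Jets.
Variable kap : R.

(** The constant [kap] changes no derivative; it sets the level of the barrier, which matters in
    [computable_ginv]. *)
Definition barrier z : R := kap - ln (slack z) - ln z.2.
(** [Fij] is the partial derivative of order [i] in [x] and order [j] in [t]. *)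
Definition F10 z : R := (slack z)^-1.
Definition F01 z : R := - g1 z.2 * (slack z)^-1 - z.2^-1.
Definition F20 z : R := (slack z)^-1 ^+ 2.
Definition F11 z : R := - g1 z.2 * (slack z)^-1 ^+ 2.
Definition F02 z : R :=
  - g2 z.2 * (slack z)^-1 + g1 z.2 ^+ 2 * (slack z)^-1 ^+ 2 + z.2^-1 ^+ 2.
Definition F30 z : R := 2 * (slack z)^-1 ^+ 3.
Definition F21 z : R := - (2 * g1 z.2) * (slack z)^-1 ^+ 3.
Definition F12 z : R :=
  - g2 z.2 * (slack z)^-1 ^+ 2 + 2 * g1 z.2 ^+ 2 * (slack z)^-1 ^+ 3.
Definition F03 z : R :=
  - g3 z.2 * (slack z)^-1 + 3 * g1 z.2 * g2 z.2 * (slack z)^-1 ^+ 2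
  - 2 * g1 z.2 ^+ 3 * (slack z)^-1 ^+ 3 - 2 * z.2^-1 ^+ 3.

Section At.
Variables (z v : R * R).
Hypothesis zU : epi_int z.

Let z0 : 0 < z.2. Proof. by case: zU. Qed.
Let s0 : 0 < slack z. Proof. by case: zU. Qed.
Let zn0 : z.2 != 0. Proof. by rewrite gt_eqF. Qed.
Let sn0 : slack z != 0. Proof. by rewrite gt_eqF. Qed.

Let Dcst (c : R) : is_derive z v (fun _ : R * R => c) 0.
Proof. exact: is_derive_cst. Qed.

Lemma is_derive_slack : is_derive z v slack (g1 z.2 * v.2 - v.1).
Proof.
apply: is_derive_sub; last exact: is_derive_fst.
exact: is_derive_comp1 (is_derive_snd z v) (is_derive_gfun ok (ltW z0)).
Qed.

Let Dg1 : is_derive z v (fun y : R * R => g1 y.2) (g2 z.2 * v.2).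
Proof. exact: is_derive_comp1 (is_derive_snd z v) (is_derive_gfun1 ok (ltW z0)). Qed.

Let Dg2 : is_derive z v (fun y : R * R => g2 y.2) (g3 z.2 * v.2).
Proof. exact: is_derive_comp1 (is_derive_snd z v) (is_derive_gfun2 ok (ltW z0)). Qed.

Let DiA := is_derive_inv is_derive_slack sn0.
Let Dit := is_derive_inv (is_derive_snd z v) zn0.

Lemma is_derive_F00 : is_derive z v barrier (v.1 * F10 z + v.2 * F01 z).
Proof.
have D := is_derive_sub (is_derive_sub (Dcst kap) (is_derive_ln is_derive_slack s0))
  (is_derive_ln (is_derive_snd z v) z0).
by apply: (is_derive_eq D); rewrite /F10 /F01; field; apply/andP.
Qed.

Lemma is_derive_F10 : is_derive z v F10 (v.1 * F20 z + v.2 * F11 z).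
Proof. by apply: (is_derive_eq DiA); rewrite /F20 /F11; field. Qed.

Lemma is_derive_F01 : is_derive z v F01 (v.1 * F11 z + v.2 * F02 z).
Proof.
have D := is_derive_sub (is_derive_mul (is_derive_opp Dg1) DiA) Dit.
by apply: (is_derive_eq D); rewrite /F11 /F02; field; apply/andP.
Qed.

Let DiA2 := is_derive_mul DiA DiA.
Let F20E : (fun y => (slack y)^-1 * (slack y)^-1) = F20.
Proof. by apply/funext => y; rewrite /F20 expr2. Qed.

Lemma is_derive_F20 : is_derive z v F20 (v.1 * F30 z + v.2 * F21 z).
Proof. by rewrite -F20E; apply: (is_derive_eq DiA2); rewrite /F30 /F21; field. Qed.

Lemma is_derive_F11 : is_derive z v F11 (v.1 * F21 z + v.2 * F12 z).
Proof.
have D := is_derive_mul (is_derive_opp Dg1) DiA2.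
rewrite (_ : F11 = fun y : R * R => - g1 y.2 * ((slack y)^-1 * (slack y)^-1)).
  by apply: (is_derive_eq D); rewrite /F21 /F12; field.
by apply/funext => y; rewrite /F11 expr2.
Qed.

Lemma is_derive_F02 : is_derive z v F02 (v.1 * F12 z + v.2 * F03 z).
Proof.
have D := is_derive_add (is_derive_add (is_derive_mul (is_derive_opp Dg2) DiA)
  (is_derive_mul (is_derive_mul Dg1 Dg1) DiA2)) (is_derive_mul Dit Dit).
rewrite (_ : F02 = fun y : R * R => - g2 y.2 * (slack y)^-1 +
    g1 y.2 * g1 y.2 * ((slack y)^-1 * (slack y)^-1) + y.2^-1 * y.2^-1).
  by apply: (is_derive_eq D); rewrite /F12 /F03; field; apply/andP.
by apply/funext => y; rewrite /F02 !expr2.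
Qed.

End At.

Definition Q1 z v : R := v.1 * F10 z + v.2 * F01 z.
Definition Q2 z u v : R := v.1 * (u.1 * F20 z + u.2 * F11 z) + v.2 * (u.1 * F11 z + u.2 * F02 z).
Definition Q3 z u v w : R :=
  w.1 * (v.1 * (u.1 * F30 z + u.2 * F21 z) + v.2 * (u.1 * F21 z + u.2 * F12 z)) +
  w.2 * (v.1 * (u.1 * F21 z + u.2 * F12 z) + v.2 * (u.1 * F12 z + u.2 * F03 z)).

Lemma deriv1 z v : epi_int z -> 'D_v barrier z = Q1 z v.
Proof. by move=> zU; have [_] := is_derive_F00 v zU. Qed.

(** The formula for the first derivative holds on the open set [epi_int], so near [z] it may replace
    the derivative before the next differentiation. *)
Lemma is_derive2 z u v : epi_int z -> is_derive z u ('D_v barrier) (Q2 z u v).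
Proof.
move=> zU.
have Dcst (c : R) : is_derive z u (fun _ : R * R => c) 0 by exact: is_derive_cst.
have D := is_derive_add (is_derive_mul (Dcst v.1) (is_derive_F10 u zU))
  (is_derive_mul (Dcst v.2) (is_derive_F01 u zU)).
apply: (@near_eq_is_derive _ _ _ (fun y => Q1 y v)).
  by near=> y; rewrite deriv1//; near: y; exact: epi_int_near.
by apply: (is_derive_eq D); rewrite /Q2; ring.
Unshelve. all: by end_near. Qed.

Lemma deriv2 z u v : epi_int z -> D2 barrier z u v = Q2 z u v.
Proof. by move=> zU; rewrite /D2; have [_] := is_derive2 u v zU. Qed.

Lemma is_derive3 z u v w : epi_int z -> is_derive z u ('D_v ('D_w barrier)) (Q3 z u v w).
Proof.
move=> zU.
have Dcst (c : R) : is_derive z u (fun _ : R * R => c) 0 by exact: is_derive_cst.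
have D := is_derive_add
  (is_derive_mul (Dcst w.1) (is_derive_add (is_derive_mul (Dcst v.1) (is_derive_F20 u zU))
    (is_derive_mul (Dcst v.2) (is_derive_F11 u zU))))
  (is_derive_mul (Dcst w.2) (is_derive_add (is_derive_mul (Dcst v.1) (is_derive_F11 u zU))
    (is_derive_mul (Dcst v.2) (is_derive_F02 u zU)))).
apply: (@near_eq_is_derive _ _ _ (fun y => Q2 y v w)).
  by near=> y; rewrite -deriv2//; near: y; exact: epi_int_near.
by apply: (is_derive_eq D); rewrite /Q3; ring.
Unshelve. all: by end_near. Qed.

Lemma deriv3 z u v w : epi_int z -> D3 barrier z u v w = Q3 z u v w.
Proof. by move=> zU; rewrite /D3; have [_] := is_derive3 u v w zU. Qed.

End Jets.
End Barrier.

(** * Self-concordance of the barrier *)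

Section SelfConcordance.
Variables (R : realType) (P : gpar R).
Implicit Types (s t r x : R) (z u v w : R * R).
Hypothesis ok : gok P.
Local Notation g := (gfun P).
Local Notation g1 := (gfun1 P).
Local Notation g2 := (gfun2 P).
Local Notation g3 := (gfun3 P).
Variable kap : R.
Local Notation phi := (barrier P kap).

Lemma continuous_D3 z u v w : epi_int P z ->
  {for z, continuous (fun y => D3 phi y u v w)}.
Proof.
move=> zU; have [z0 s0] := zU.
have C1 (c : R) : {for z, continuous (fun _ : R * R => c)} by exact: cst_continuous.
have cg (f : R -> R) df : is_derive z.2 (1 : R) f df ->
    {for z, continuous (fun y : R * R => f y.2)}.
  move=> [Df _]; apply: continuous_comp; first exact: cvg_snd.
  by apply/differentiable_continuous/derivable1_diffP.
have ci : {for z, continuous (fun y : R * R => (slack P y)^-1)}.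
  by apply: continuousV; [rewrite gt_eqF|exact: slack_continuous (ltW z0)].
have ct : {for z, continuous (fun y : R * R => y.2^-1)}.
  by apply: continuousV; [rewrite gt_eqF|exact: cvg_snd].
have c1 := cg _ _ (is_derive_gfun1 ok (ltW z0)).
have c2 := cg _ _ (is_derive_gfun2 ok (ltW z0)).
have c3 : {for z, continuous (fun y : R * R => g3 y.2)}.
  exact: cg _ _ (is_derive_cstmul _ (is_derive_gpow ok _ (ltW z0))).
have cM (f h : R * R -> R) : {for z, continuous f} -> {for z, continuous h} ->
  {for z, continuous (fun y => f y * h y)} by exact: continuousM.
have cD (f h : R * R -> R) : {for z, continuous f} -> {for z, continuous h} ->
  {for z, continuous (fun y => f y + h y)} by exact: continuousD.
have cN (f : R * R -> R) : {for z, continuous f} ->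
  {for z, continuous (fun y => - f y)} by exact: continuousN.
have cX (f : R * R -> R) n : {for z, continuous f} ->
  {for z, continuous (fun y => f y ^+ n)}.
  move=> cf; elim: n => [|n IH]; first exact: (C1 1).
  rewrite (_ : (fun y => f y ^+ n.+1) = fun y => f y * f y ^+ n); first exact: cM.
  by apply/funext => y; rewrite exprS.
have c30 : {for z, continuous (F30 P)} := cM _ _ (C1 2) (cX _ 3%N ci).
have c21 : {for z, continuous (F21 P)} :=
  cM _ _ (cN _ (cM _ _ (C1 2) c1)) (cX _ 3%N ci).
have c12 : {for z, continuous (F12 P)} :=
  cD _ _ (cM _ _ (cN _ c2) (cX _ 2%N ci))
    (cM _ _ (cM _ _ (C1 2) (cX _ 2%N c1)) (cX _ 3%N ci)).
have c03 : {for z, continuous (F03 P)} :=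
  cD _ _ (cD _ _ (cD _ _ (cM _ _ (cN _ c3) ci)
    (cM _ _ (cM _ _ (cM _ _ (C1 3) c1) c2) (cX _ 2%N ci)))
    (cN _ (cM _ _ (cM _ _ (C1 2) (cX _ 3%N c1)) (cX _ 3%N ci))))
    (cN _ (cM _ _ (C1 2) (cX _ 3%N ct))).
have lin (c c' : R) (f h : R * R -> R) : {for z, continuous f} -> {for z, continuous h} ->
    {for z, continuous (fun y => c * f y + c' * h y)}.
  by move=> cf ch; exact: (cD _ _ (cM _ _ (C1 c) cf) (cM _ _ (C1 c') ch)).
have cQ : {for z, continuous (fun y => Q3 P y u v w)} :=
  lin _ _ _ _ (lin _ _ _ _ (lin _ _ _ _ c30 c21) (lin _ _ _ _ c21 c12))
    (lin _ _ _ _ (lin _ _ _ _ c21 c12) (lin _ _ _ _ c12 c03)).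
rewrite /prop_for /continuous_at deriv3//.
apply: cvg_trans cQ; apply: near_eq_cvg; near=> y.
by rewrite deriv3//; near: y; exact: epi_int_near.
Unshelve. all: by end_near. Qed.

(* In terms of the normalized increments [al] of the slack, [de] of [t] and of the
   curvature [si], the self-concordance inequality is homogeneous of degree 3. *)
Lemma sc_ineq (u al de : R) : 0 <= al -> 0 <= de -> 0 <= u -> al ^+ 2 + de ^+ 2 <= u ^+ 2 ->
  2 * al ^+ 3 + 2 * de ^+ 3 + (3 * al + 2 * de) * (u ^+ 2 - al ^+ 2 - de ^+ 2) <= 2 * u ^+ 3.
Proof.
move=> a0 e0 u0 h.
have au : al <= u by rewrite -(@ler_pXn2r _ 2)// ?nnegrE//; nra.
have eu : de <= u by rewrite -(@ler_pXn2r _ 2)// ?nnegrE//; nra.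
(* For [4 * al < u] the factor [2 * u ^+ 2 - 3 * al * (u + de)] is nonnegative, because
   [de <= u]. *)
have [ua|ua] := leP u (4 * al); last first.
  have -> : 2 * u ^+ 3 = 2 * al ^+ 3 + 2 * de ^+ 3 + (3 * al + 2 * de) * (u ^+ 2 - al ^+ 2 - de ^+ 2)
    + ((u - de) * (2 * u ^+ 2 - 3 * al * (u + de)) + al ^+ 2 * (al + 2 * de)) by ring.
  rewrite lerDl addr_ge0 ?mulr_ge0 ?sqr_ge0 ?subr_ge0 ?addr_ge0 ?mulr_ge0//.
  have h1 : 0 <= al * (u - de) by rewrite mulr_ge0 ?subr_ge0.
  have h2 : 0 <= u * (u - 4 * al) by rewrite mulr_ge0 ?subr_ge0// ltW.
  have h3 : 0 <= u ^+ 2 by rewrite sqr_ge0.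
  lra.
have [a00|a00] := eqVneq al 0.
  have u00 : u = 0 by apply/eqP; rewrite eq_le u0 andbT; move: ua; rewrite a00; lra.
  have -> : de = 0 by apply/eqP; rewrite eq_le e0 andbT -u00.
  by rewrite a00 u00 !expr0n /= !mulr0 !subr0 !addr0 !mulr0.
have al0 : 0 < 3 * al by rewrite mulr_gt0// lt_neqAle eq_sym a00.
rewrite -subr_ge0 -(pmulr_rge0 _ al0).
(* The cubic terms in [de] cancel and leave a quadratic in [de] with leading coefficient [3 * al].
   After completion of the square the remainder is nonnegative because [u <= 4 * al]. *)
have -> : 3 * al * (2 * u ^+ 3 - (2 * al ^+ 3 + 2 * de ^+ 3 +
    (3 * al + 2 * de) * (u ^+ 2 - al ^+ 2 - de ^+ 2))) =
  (3 * al * de - (u - al) * (u + al)) ^+ 2 +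
  (u - al) ^+ 2 * (4 * u * al + 2 * al ^+ 2 - u ^+ 2) by ring.
apply: addr_ge0; first exact: sqr_ge0.
apply: mulr_ge0; first exact: sqr_ge0.
have h1 : 0 <= u * (4 * al - u) by rewrite mulr_ge0 ?subr_ge0.
have h2 : 0 <= al ^+ 2 by rewrite sqr_ge0.
nra.
Qed.

(** The Hessian as a sum of three nonnegative terms, due to the slack, to the curvature of [g] and
    to [ln t]; the inequalities of a barrier are read off this form. *)
Lemma Q2E z h : epi_int P z ->
  Q2 P z h h = ((g1 z.2 * h.2 - h.1) / slack P z) ^+ 2
    + - g2 z.2 * h.2 ^+ 2 / slack P z + (h.2 / z.2) ^+ 2.
Proof.
move=> [z0 s0]; rewrite /Q2 /F20 /F11 /F02; field.
by rewrite !gt_eqF.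
Qed.

Lemma sc_barrier_ginv : sc_barrier (epigraph (ginv P)) 2 phi.
Proof.
rewrite /sc_barrier (interior_epigraph ok).
have si0 z h : epi_int P z -> 0 <= - g2 z.2 * h ^+ 2 / slack P z.
  move=> [z0 s0]; apply: divr_ge0; last exact: ltW.
  by apply: mulr_ge0; [rewrite oppr_ge0 gfun2_le0|exact: sqr_ge0].
split.
- move=> z zU u v w; split.
  + by have [] := is_derive_F00 ok kap w zU.
  + by have [] := is_derive2 ok kap v w zU.
  + by have [] := is_derive3 ok kap u v w zU.
  + exact: continuous_D3.
- move=> z h zU; rewrite deriv2// Q2E//.
  by rewrite !addr_ge0 ?sqr_ge0 ?si0.
- move=> z h zU; rewrite deriv2// deriv3// Q2E//.
  have [z0 s0] := zU.
  set al := (g1 z.2 * h.2 - h.1) / slack P z; set de := h.2 / z.2.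
  set si := - g2 z.2 * h.2 ^+ 2 / slack P z.
  set u := Num.sqrt _.
  have si0' : 0 <= si by exact: si0.
  have u2 : u ^+ 2 = al ^+ 2 + si + de ^+ 2.
    by rewrite sqr_sqrtr// !addr_ge0 ?sqr_ge0.
  set th := - g3 z.2 * h.2 ^+ 3 / slack P z.
  have -> : Q3 P z h h h = th - 3 * al * si - 2 * al ^+ 3 - 2 * de ^+ 3.
    rewrite /Q3 /F30 /F21 /F12 /F03 /th /al /si /de; field.
    by rewrite !gt_eqF.
  (* Here [gfun3_bound] enters: the third derivative of [g] is paid for by the curvature term [si]
     times the relative change [de] of [t]. *)
  have th2 : `|th| <= 2 * si * `|de|.
    have -> : `|th| = `|g3 z.2| * `|h.2| ^+ 3 / slack P z.
      by rewrite /th normrM normfV (gtr0_norm s0) normrM normrN normrX.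
    have -> : `|de| = `|h.2| / z.2 by rewrite /de normrM normfV (gtr0_norm z0).
    rewrite /si.
    have -> : `|g3 z.2| * `|h.2| ^+ 3 / slack P z =
      (z.2 * `|g3 z.2|) * (`|h.2| ^+ 3 / slack P z / z.2) by field; rewrite !gt_eqF.
    have -> : 2 * (- g2 z.2 * h.2 ^+ 2 / slack P z) * (`|h.2| / z.2) =
      2 * - g2 z.2 * (`|h.2| ^+ 3 / slack P z / z.2).
      by rewrite -[h.2 ^+ 2]real_normK ?num_real//; field; rewrite !gt_eqF.
    apply: ler_wpM2r; last exact: (gfun3_bound ok (ltW z0)).
    by rewrite !divr_ge0 ?exprn_ge0// ltW.
  have := @sc_ineq u `|al| `|de| (normr_ge0 _) (normr_ge0 _) (sqrtr_ge0 _).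
  rewrite !real_normK ?num_real// u2 => /(_ _) H.
  apply: le_trans (H _); last by rewrite lerD2r lerDl.
  have -> : al ^+ 2 + si + de ^+ 2 - al ^+ 2 - de ^+ 2 = si by ring.
  have e1 (c : R) : `|2 * c ^+ 3| = 2 * `|c| ^+ 3 by rewrite normrM normrX ger0_norm.
  have e2 : `|3 * al * si| = 3 * `|al| * si.
    by rewrite normrM (ger0_norm si0') normrM ger0_norm.
  apply: le_trans (ler_normB _ _) _; rewrite e1.
  have t1 := ler_normB (th - 3 * al * si) (2 * al ^+ 3).
  have t2 := ler_normB th (3 * al * si).
  rewrite e1 in t1; rewrite e2 in t2.
  have p1 : 0 <= `|al| * si by rewrite mulr_ge0.
  nra.
(* The first derivative is [- (al + de)], and [(al + de) ^+ 2 <= 2 * (al ^+ 2 + de ^+ 2)]; hence the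
   parameter 2. *)
- move=> z h zU; rewrite deriv1// deriv2// Q2E//.
  have [z0 s0] := zU.
  have -> : Q1 P z h = - ((g1 z.2 * h.2 - h.1) / slack P z + h.2 / z.2).
    by rewrite /Q1 /F10 /F01; field; rewrite !gt_eqF.
  have := si0 z h.2 zU; set si := _ / slack P z.
  set al := (g1 z.2 * h.2 - h.1) / slack P z; set de := h.2 / z.2 => si0'.
  rewrite sqrrN; have := sqr_ge0 (al - de); nra.
(* At a boundary point [slack * t] vanishes. This product is continuous, and the barrier is [kap]
   minus its logarithm. *)
- move=> z [/(epigraphE ok)[z0 s0] zU].
  have pr0 : slack P z * z.2 = 0.
    have [->|zn] := eqVneq z.2 0; first by rewrite mulr0.
    have [->|sn] := eqVneq (slack P z) 0; first by rewrite mul0r.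
    by exfalso; apply: zU; split; rewrite lt_neqAle eq_sym ?zn ?sn.
  have cp : {for z, continuous (fun y : R * R => slack P y * y.2)}.
    by apply: continuousM; [exact: slack_continuous|exact: cvg_snd].
  apply/cvgryPge => A; near=> y.
  have yU : epi_int P y by near: y; apply: withinT.
  have [y0 t0] := yU.
  have : slack P y * y.2 < expR (kap - A).
    near: y; apply: cvg_within; apply: (cvgr_lt _ cp).
    by rewrite pr0 expR_gt0.
  rewrite /barrier -ltr_ln ?posrE ?mulr_gt0 ?expR_gt0// expRK.
  by rewrite lnM ?posrE//; lra.
Unshelve. all: by end_near. Qed.

End SelfConcordance.

(** * Straight-line code *)

Fixpoint straight (Q : Type) (c : cmd Q) : bool :=
  match c with
  | Skip | SetI _ _ _ _ | SetR _ _ _ _ => true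
  | Seq c1 c2 | If _ c1 c2 => straight c1 && straight c2
  | While _ _ | Query _ => false
  end.

(** An [If] is charged for both branches, which makes the bound independent of the state. *)
Fixpoint scost (Q : Type) (c : cmd Q) : nat :=
  match c with
  | SetI _ i j e => (icost i + icost j + icost e).+1
  | SetR _ i j e => (icost i + icost j + rcost e).+1
  | Seq c1 c2 => (scost c1 + scost c2).+1
  | If b c1 c2 => (bcost b + (scost c1 + scost c2)).+1
  | _ => 1
  end.

Fixpoint run (R : realType) (Q : Type) (c : cmd Q) (s : state R) : state R :=
  match c with
  | SetI a i j e =>
      State (upd (imem s) a (ieval s i) (ieval s j) (ieval s e)) (rmem s)
  | SetR a i j e =>
      State (imem s) (upd (rmem s) a (ieval s i) (ieval s j) (reval s e))
  | Seq c1 c2 => run c2 (run c1 s)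
  | If b c1 c2 => if beval s b then run c1 s else run c2 s
  | _ => s
  end.

Lemma exec_straight (R : realType) (Q : Type) (ask : Q -> state R -> nat -> state R -> Prop)
    (c : cmd Q) (s : state R) : straight c ->
  exists2 n, exec ask c s n (run c s) & (n <= scost c)%N.
Proof.
elim: c s => //=.
- by move=> s _; exists 1%N => //; constructor.
- by move=> a i j e s _; eexists; [exact: ESetI|].
- by move=> a i j e s _; eexists; [exact: ESetR|].
- move=> c1 IH1 c2 IH2 s /andP[/IH1 H1 /IH2 H2].
  have [n1 e1 l1] := H1 s; have [n2 e2 l2] := H2 (run c1 s).
  by eexists; [exact: ESeq e1 e2|rewrite ltnS leq_add].
- move=> b c1 IH1 c2 IH2 s /andP[/IH1 H1 /IH2 H2].
  have [n1 e1 l1] := H1 s; have [n2 e2 l2] := H2 s.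
  case E : (beval s b).
    exists (bcost b + n1).+1; first by apply: EIf; rewrite E.
    by rewrite ltnS leq_add2l (leq_trans l1)// leq_addr.
  exists (bcost b + n2).+1; first by apply: EIf; rewrite E.
  by rewrite ltnS leq_add2l (leq_trans l2)// leq_addl.
Qed.

Fixpoint block (Q : Type) (l : seq (cmd Q)) : cmd Q :=
  if l is c :: l' then Seq c (block l') else Skip.

Definition rc (a j : nat) : rexp := RCell a (INat 0) (INat j).
Definition setr (Q : Type) (a i j : nat) (e : rexp) : cmd Q := SetR a (INat i) (INat j) e.
Definition rnat (n : nat) : rexp := RNat (INat n).
Definition rpow (x r : rexp) : rexp := RExp (RMul r (RLn x)).

(* The parameters [a, b, d, e, q] are in row 0 of array 1; array 3 holds
   [1 + b t, g' t, g'' t, (g t - x)^-1, t^-1]. *)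
Definition gcode : fcode :=
  let a := rc 1 0 in let b := rc 1 1 in let d := rc 1 2 in let e := rc 1 3 in
  let q := rc 1 4 in let x := rc 0 0 in let t := rc 0 1 in
  let v := rc 3 0 in let g1 := rc 3 1 in let g2 := rc 3 2 in
  let iA := rc 3 3 in let it := rc 3 4 in
  block [::
    setr _ 3 0 0 (RAdd (rnat 1) (RMul b t));
    setr _ 3 0 1 (RAdd (RMul (RMul (RMul a b) q) (rpow v (RSub q (rnat 1)))) d);
    setr _ 3 0 2 (RMul (RMul (RMul a (RMul b b)) (RMul q (RSub q (rnat 1))))
      (rpow v (RSub q (rnat 2))));
    setr _ 3 0 3 (RDiv (rnat 1) (RSub (RAdd (RAdd (RMul a (RSub (rpow v q) (rnat 1)))
      (RMul d t)) e) x));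
    setr _ 3 0 4 (RDiv (rnat 1) t);
    setr _ 2 0 0 iA;
    setr _ 2 0 1 (RSub (RSub (rnat 0) (RMul g1 iA)) it);
    setr _ 2 1 0 (RMul iA iA);
    setr _ 2 1 1 (RSub (rnat 0) (RMul g1 (RMul iA iA)));
    setr _ 2 2 0 (RSub (rnat 0) (RMul g1 (RMul iA iA)));
    setr _ 2 2 1 (RAdd (RSub (RMul (RMul g1 g1) (RMul iA iA)) (RMul g2 iA)) (RMul it it))].

Definition gpar_of (R : realType) (par : nat -> R) : gpar R :=
  GPar (par 0%N) (par 1%N) (par 2%N) (par 3%N) (par 4%N).

(** The new state is generalized and known only through its reads, so symbolic execution rewrites
    with equations on cells and builds no nested updates. *)
Lemma run_setr (R : realType) (Q : Type) a i j e (l : seq (cmd Q)) (s : state R)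
    (Post : state R -> Prop) :
  (forall v s', v = reval s e -> imem s' = imem s ->
    (forall a' i' j', rmem s' a' i' j' =
       if [&& a' == a, i' == i & j' == j] then v else rmem s a' i' j') ->
    Post (run (block l) s')) ->
  Post (run (block (setr Q a i j e :: l)) s).
Proof. by move=> H; exact: (H (reval s e)). Qed.

(** * Computability of the inverse *)

Section Computable.
Variables (R : realType) (par : nat -> R).
Local Notation P := (gpar_of par).
Hypothesis ok : gok P.

Lemma gcode_correct (kap time : R) : (scost gcode)%:R <= time ->
  computes_derivatives (epigraph (ginv P))° (barrier P kap) gcode par time.
Proof.
move=> ht vx vt z; rewrite (interior_epigraph ok) => zU.
have [n exn nle] := exec_straight (@no_query R) (code_input par z.1 z.2) (isT : straight gcode).
exists n, (run gcode (code_input par z.1 z.2)).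
have [z0 s0] := zU.
have v0 : 0 < 1 + par 1%N * z.2 by apply: (gbase_gt0 ok); exact: ltW.
have pw r : expR (r * ln (1 + par 1%N * z.2)) = (1 + par 1%N * z.2) `^ r
  by rewrite /powR gt_eqF.
pose Post s := [/\ rmem s 2 0 0 = Q1 P z vx /\ rmem s 2 0 1 = Q1 P z vt,
    rmem s 2 1 0 = Q2 P z vx vx /\ rmem s 2 1 1 = Q2 P z vx vt &
    rmem s 2 2 0 = Q2 P z vt vx /\ rmem s 2 2 1 = Q2 P z vt vt].
suff [h1 h2 h3] : Post (run gcode (code_input par z.1 z.2)).
  by rewrite !(deriv1 ok)// !(deriv2 ok)//; split=> //; rewrite (le_trans _ ht)// ler_nat.
clear exn nle n.
have M0 a i l : rmem (code_input par z.1 z.2) a i l =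
  match a, i, l with 0%N, 0%N, 0%N => z.1 | 0%N, 0%N, 1%N => z.2
  | 1%N, 0%N, _ => par l | _, _, _ => 0 end by [].
move: (code_input par z.1 z.2) M0 => st M0.
rewrite /gcode.
apply: run_setr => w0 st0 E0 _ M1; rewrite /= !M0 in E0.
apply: run_setr => w1 st1 E1 _ M2; rewrite /= !(M1, M0) /= in E1.
apply: run_setr => w2 st2 E2 _ M3; rewrite /= !(M2, M1, M0) /= in E2.
apply: run_setr => w3 st3 E3 _ M4; rewrite /= !(M3, M2, M1, M0) /= in E3.
apply: run_setr => w4 st4 E4 _ M5; rewrite /= !(M4, M3, M2, M1, M0) /= in E4.
apply: run_setr => w5 st5 E5 _ M6; rewrite /= !(M5, M4, M3, M2, M1, M0) /= in E5.
apply: run_setr => w6 st6 E6 _ M7; rewrite /= !(M6, M5, M4, M3, M2, M1, M0) /= in E6.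
apply: run_setr => w7 st7 E7 _ M8; rewrite /= !(M7, M6, M5, M4, M3, M2, M1, M0) /= in E7.
apply: run_setr => w8 st8 E8 _ M9; rewrite /= !(M8, M7, M6, M5, M4, M3, M2, M1, M0) /= in E8.
apply: run_setr => w9 st9 E9 _ M10.
rewrite /= !(M9, M8, M7, M6, M5, M4, M3, M2, M1, M0) /= in E9.
apply: run_setr => w10 st10 E10 _ M11.
rewrite /= !(M10, M9, M8, M7, M6, M5, M4, M3, M2, M1, M0) /= in E10.
rewrite /Post /= !(M11, M10, M9, M8, M7, M6, M5, M4, M3, M2, M1, M0) /=.
rewrite E0 pw in E1; rewrite E0 pw in E2; rewrite E0 pw in E3.
rewrite /Q1 /Q2 /F10 /F01 /F20 /F11 /F02 /slack /gfun /gfun1 /gfun2 /=.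
rewrite E5 E6 E7 E8 E9 E10 E3 E4 E1 E2.
by split; split; ring.
Qed.

(** [E] is the degree of the bound on [D = 1 / gd]. The growth condition follows from
    [D * |x| <= D ^ 2 + x ^ 2], both terms being dominated with the exponent [2 E + 2]. *)
Lemma computable_ginv (C m E : nat) : (0 < m)%N -> (gd P)^-1 <= polybd R E m ->
  (4 ^ E <= C)%N -> (E.*2.+2 <= C)%N -> (scost gcode <= C)%N ->
  computable C m (E.*2.+2)%:R (ginv P) gcode par.
Proof.
move=> m0 hd hC1 hC2 hC3.
have d0 : 0 < gd P by case: ok.
have m1 : 1 <= m%:R :> R by rewrite ler1n.
have lm : 0 <= ln (m%:R : R) by exact: ln_ge0.
have C1 : 1 <= C%:R :> R by rewrite ler1n (leq_trans _ hC2).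
have pl : C%:R <= polylog R C m.
  by rewrite /polylog ler_peMr// exprn_ege1// lerDl.
split.
- move=> k x y _ _.
  have k0 : 0 <= k%:num by []. have k1 : k%:num <= 1 by [].
  exact: (ginv_convex ok x y k0 k1).
- move=> x; rewrite ger0_norm ?ginv_ge0//.
  rewrite !powR_mulrn ?normr_ge0//.
  apply: le_trans (ginv_le ok x) _.
  set D := (gd P)^-1 in hd *; have D0 : 0 <= D by rewrite invr_ge0 ltW.
  set K := E.*2.+2.
  (* [m + 1 <= 2 m] turns [(m + 1) ^ (2 E)] into [4 ^ E * m ^ (2 E)]; hence the condition
     [4 ^ E <= C]. *)
  have hD2 : D ^+ 2 <= C%:R * m%:R ^+ K.
    apply: (@le_trans _ _ ((2 * m%:R) ^+ (E * 2))).
      rewrite exprM !expr2; apply: ler_pM => //; apply: le_trans hd _;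
      by rewrite /polybd lerXn2r// ?nnegrE// -natrM ler_nat mul2n -addnn -addn1 leq_add2l.
    rewrite exprMn; apply: ler_pM; rewrite ?exprn_ge0//.
      by rewrite mulnC exprM -!natrX ler_nat.
    by apply: ler_weXn2l => //; rewrite muln2 /K -addn2 leq_addr.
  have [x1|x1] := leP 1 `|x|.
    apply: (@le_trans _ _ (D ^+ 2 + `|x| ^+ 2)); first by have := sqr_ge0 (D - `|x|); nra.
    rewrite mulrDr lerD//.
    apply: (@le_trans _ _ (`|x| ^+ K)); first by rewrite ler_weXn2l.
    by rewrite ler_peMl// exprn_ge0.
  have mK : 1 <= C%:R * m%:R ^+ K :> R by apply: mulr_ege1 => //; exact: exprn_ege1.
  have DD : D <= C%:R * m%:R ^+ K :> R.
    have [D1|/ltW D1] := leP D 1; first exact: le_trans mK.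
    by apply: le_trans hD2; rewrite expr2 ler_peMl.
  apply: (@le_trans _ _ D); first by rewrite ler_piMl// ltW.
  by apply: le_trans DD _; rewrite mulrDr lerDl mulr_ge0// exprn_ge0.
(* With [B = m ^ (2 E + 2)], on the box [|x|, |t| <= B] the slack is at most [gfun P B + B] and [t]
   at most [B]. This constant lifts the barrier above [polylog C m] on the whole box, so the
   premises of the Hessian bound contradict each other. *)
exists 2, (barrier P (polylog R C m + 1 + ln ((gfun P (m%:R `^ (E.*2.+2)%:R) + m%:R `^ (E.*2.+2)%:R)
  * m%:R `^ (E.*2.+2)%:R))).
split.
- exact: sc_barrier_ginv.
- by rewrite ler_nat.
- move=> z; rewrite (interior_epigraph ok) => -[z0 s0] h1 h2 h3; exfalso.
  set B := m%:R `^ _ in h1 h2 h3.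
  have zB : z.2 <= B by apply: le_trans (ler_norm _) h2.
  have sB : slack P z <= gfun P B + B.
    rewrite /slack; apply: lerD; first by apply: (gfun_mono ok) => //; exact: ltW.
    by apply: le_trans h1; rewrite -normrN ler_norm.
  move: h3; rewrite /barrier -addrA -opprD -lnM ?posrE//.
  have : ln (slack P z * z.2) <= ln ((gfun P B + B) * B).
    have p1 : 0 < slack P z * z.2 by exact: mulr_gt0.
    have p2 : slack P z * z.2 <= (gfun P B + B) * B by apply: ler_pM => //; exact: ltW.
    by rewrite ler_ln ?posrE// (lt_le_trans p1).
  lra.
- by apply: gcode_correct; apply: le_trans pl; rewrite ler_nat.
Qed.

End Computable.

(** * Soft maximum *)

Section Softmax.
Variables (R : realType) (m : nat) (C : R).
Hypotheses (m0 : (0 < m)%N) (C0 : 0 < C).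
Implicit Types a b u x z p : 'I_m -> R.

Definition expsum u : R := \sum_i expR (u i / C).
Definition softmax u (i : 'I_m) : R := expR (u i / C) / expsum u.
Definition lse u : R := C * ln (expsum u).

Lemma expsum_ge u i : expR (u i / C) <= expsum u.
Proof.
rewrite /expsum (bigD1 i)//= lerDl sumr_ge0// => j _; exact: expR_ge0.
Qed.

Lemma expsum_gt0 u : 0 < expsum u.
Proof. exact: lt_le_trans (expR_gt0 _) (expsum_ge u (Ordinal m0)). Qed.

Lemma softmax_gt0 u i : 0 < softmax u i.
Proof. by rewrite divr_gt0 ?expR_gt0 ?expsum_gt0. Qed.

Lemma softmax_sum1 u : \sum_i softmax u i = 1.
Proof. by rewrite -mulr_suml mulfV// gt_eqF// expsum_gt0. Qed.

Lemma lse_ge u i : u i <= lse u.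
Proof.
have -> : u i = C * ln (expR (u i / C)) by rewrite expRK; field; rewrite gt_eqF.
rewrite ler_wpM2l ?(ltW C0)// ler_ln ?posrE ?expR_gt0 ?expsum_gt0//.
exact: expsum_ge.
Qed.

Lemma lse0 : lse (fun _ => 0) = C * ln m%:R.
Proof.
by rewrite /lse /expsum; congr (_ * ln _); under eq_bigr do rewrite mul0r expR0;
  rewrite sumr_const card_ord.
Qed.

(** The change of [lse] is the logarithm of a mean under [softmax a]; convexity and smoothness
    thereby reduce to scalar inequalities for [exp]. *)
Lemma lse_shift a b :
  lse b = lse a + C * ln (\sum_i softmax a i * expR ((b i - a i) / C)).
Proof.
have E : expsum b = expsum a * \sum_i softmax a i * expR ((b i - a i) / C).
  rewrite mulr_sumr; apply: eq_bigr => i _.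
  rewrite /softmax mulrA mulrCA mulfV ?gt_eqF ?expsum_gt0// mulr1 -expRD.
  by congr expR; field; rewrite gt_eqF.
rewrite /lse E lnM ?posrE ?expsum_gt0 ?mulrDr//.
by rewrite -(pmulr_rgt0 _ (expsum_gt0 a)) -E expsum_gt0.
Qed.

(** Jensen's inequality for [exp], from its tangent at the mean [s / C]. *)
Lemma lse_convex a b : lse a + \sum_i softmax a i * (b i - a i) <= lse b.
Proof.
rewrite (lse_shift a b) lerD2l.
set s := \sum_i _; set e := \sum_i _.
have es : expR (s / C) <= e.
  have -> : expR (s / C) = \sum_i softmax a i * (expR (s / C) * (1 + ((b i - a i) / C - s / C))).
    under eq_bigr do rewrite mulrCA mulrDr mulr1 mulrBr.
    rewrite -mulr_sumr big_split/= softmax_sum1 sumrB -mulr_suml softmax_sum1 mul1r.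
    under [X in _ + (X - _)]eq_bigr do rewrite mulrA.
    by rewrite -mulr_suml -/s subrr addr0 mulr1.
  apply: ler_sum => i _; apply: ler_wpM2l; first exact/ltW/softmax_gt0.
  have -> : expR ((b i - a i) / C) = expR (s / C) * expR ((b i - a i) / C - s / C).
    by rewrite -expRD; congr expR; ring.
  by rewrite ler_wpM2l ?expR_ge0// expR_ge1Dx.
have -> : s = C * ln (expR (s / C)) by rewrite expRK; field; rewrite gt_eqF.
by rewrite ler_wpM2l ?(ltW C0)// ler_ln ?posrE ?expR_gt0// (lt_le_trans _ es)// expR_gt0.
Qed.

Lemma expR_le_quadratic (z : R) : `|z| <= 1 / 4 -> expR z <= 1 + z + z ^+ 2.
Proof.
rewrite ler_norml => /andP[z1 z2].
have H (x : R) : expR x * (1 - x) <= 1.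
  have := expR_ge1Dx (- x); rewrite expRN => h.
  by rewrite mulrC -ler_pdivlMr ?expR_gt0// mul1r.
have [z0|/ltW z0] := leP 0 z.
  have e2 := H (z / 2).
  have ez : expR z = expR (z / 2) ^+ 2.
    by rewrite expr2 -expRD; congr expR; field.
  set e := expR (z / 2) in e2 ez; have e0 : 0 <= e by exact: expR_ge0.
  have c0 : 0 < 1 - z / 2 by lra.
  have e3 : expR z * (1 - z / 2) ^+ 2 <= 1.
    rewrite ez -exprMn; apply: exprn_ile1 => //.
    by rewrite mulr_ge0 ?(ltW c0).
  apply: (@le_trans _ _ ((1 - z / 2) ^- 2)).
    by rewrite -[leRHS]mul1r ler_pdivlMr// exprn_gt0.
  rewrite -[leLHS]mul1r ler_pdivrMr ?exprn_gt0//.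
  have -> : (1 + z + z ^+ 2) * (1 - z / 2) ^+ 2 = 1 + z ^+ 2 * ((1 - 3 * z + z ^+ 2) / 4).
    by field.
  rewrite lerDl; apply: mulr_ge0; first exact: sqr_ge0.
  have := sqr_ge0 z; lra.
have h := H z; have c0 : 0 < 1 - z by lra.
apply: (@le_trans _ _ (1 - z)^-1).
  by rewrite -[leRHS]mul1r ler_pdivlMr.
rewrite -[leLHS]mul1r ler_pdivrMr//.
have -> : (1 + z + z ^+ 2) * (1 - z) = 1 + z ^+ 2 * - z by ring.
by rewrite lerDl; apply: mulr_ge0; [exact: sqr_ge0|rewrite oppr_ge0].
Qed.

Lemma lse_smooth a b : (forall i, `|b i - a i| <= C / 4) ->
  lse b <= lse a + \sum_i softmax a i * (b i - a i)
           + C^-1 * \sum_i softmax a i * (b i - a i) ^+ 2.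
Proof.
move=> ab; rewrite (lse_shift a b) -addrA lerD2l.
set e := \sum_i _ * expR _.
have eb : e <= 1 + (C^-1 * \sum_i softmax a i * (b i - a i)
    + C^-1 ^+ 2 * \sum_i softmax a i * (b i - a i) ^+ 2).
  rewrite -(softmax_sum1 a) !mulr_sumr -!big_split/=; apply: ler_sum => i _.
  have -> : softmax a i + (C^-1 * (softmax a i * (b i - a i)) +
      C^-1 ^+ 2 * (softmax a i * (b i - a i) ^+ 2)) =
    softmax a i * (1 + (b i - a i) / C + ((b i - a i) / C) ^+ 2) by ring.
  apply: ler_wpM2l; first exact/ltW/softmax_gt0.
  apply: expR_le_quadratic.
  by rewrite normrM normfV (gtr0_norm C0) ler_pdivrMr// mulrC mul1r mulrC; apply: le_trans (ab i) _; lra.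
have e0 : 0 < e.
  rewrite /e (bigD1 (Ordinal m0))//=; apply: ltr_pwDl.
    by apply: mulr_gt0; [exact: softmax_gt0|exact: expR_gt0].
  by apply: sumr_ge0 => i _; apply: mulr_ge0; [exact/ltW/softmax_gt0|exact: expR_ge0].
have le1 : ln e <= e - 1.
  by have := expR_ge1Dx (ln e); rewrite lnK ?posrE//; lra.
apply: (@le_trans _ _ (C * (e - 1))); first by rewrite ler_wpM2l ?(ltW C0).
set s := \sum_i _ in eb *; set s2 := \sum_i _ in eb *.
have -> : s + C^-1 * s2 = C * (C^-1 * s + C^-1 ^+ 2 * s2) by field; rewrite gt_eqF.
by rewrite ler_wpM2l ?(ltW C0)// lerBlDl.
Qed.

(* The quadratic errors are measured around the optimistic predictions [p0] and [p1]; the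
   comparison of [p1] with [a - z] rather than with [a] makes the [z]-terms pair with the
   old weights [softmax p0]. *)
Lemma lse_step a p0 p1 x z :
  (forall i, `|a i - z i - p0 i| <= C / 4) ->
  (forall i, `|a i + x i - z i - p1 i| <= C / 4) ->
  lse (fun i => a i + x i - z i) <= lse a + \sum_i softmax p1 i * x i
    - \sum_i softmax p0 i * z i
    + C^-1 * (\sum_i softmax p1 i * (a i + x i - z i - p1 i) ^+ 2
              + \sum_i softmax p0 i * (a i - z i - p0 i) ^+ 2).
Proof.
move=> h0 h1.
(* [s1] and [c1] lead from [a + x - z] to [a - z] with weights [softmax p1]; [s2] and [c2] lead from
   [a - z] to [a] with weights [softmax p0]. *)
have s1 := lse_smooth h1; have s2 := lse_smooth (h0 : forall i, `|(fun i => a i - z i) i - p0 i| <= C / 4).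
have c1 := lse_convex p1 (fun i => a i - z i); have c2 := lse_convex p0 a.
rewrite mulrDr.
have E1 : \sum_i softmax p1 i * (a i + x i - z i - p1 i) =
    \sum_i softmax p1 i * (a i - z i - p1 i) + \sum_i softmax p1 i * x i.
  by rewrite -big_split/=; apply: eq_bigr => i _; ring.
have E0 : \sum_i softmax p0 i * (a i - z i - p0 i) =
    \sum_i softmax p0 i * (a i - p0 i) - \sum_i softmax p0 i * z i.
  by rewrite -sumrB; apply: eq_bigr => i _; ring.
rewrite E1 in s1; rewrite E0 in s2; lra.
Qed.

(** Numerator and normalization each change by a factor at most [exp (1 / 4) <= 2]. *)
Lemma softmax_ratio a b i : (forall i, `|b i - a i| <= C / 4) ->
  softmax b i <= 4 * softmax a i.
Proof.
move=> ab.
have e4 : expR (1 / 4 : R) <= 2.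
  by have := @expR_le_quadratic (1 / 4); rewrite ger0_norm; lra.
have H a' b' : (forall i, `|b' i - a' i| <= C / 4) -> forall i,
    expR (b' i / C) <= 2 * expR (a' i / C).
  move=> h j; have -> : b' j / C = a' j / C + (b' j - a' j) / C by ring.
  rewrite expRD mulrC ler_wpM2r ?expR_ge0//; apply: le_trans e4.
  rewrite ler_expR ler_pdivrMr//; apply: le_trans (ler_norm _) _.
  by apply: le_trans (h j) _; rewrite mulrC mul1r.
have S : expsum a <= 2 * expsum b.
  rewrite /expsum mulr_sumr; apply: ler_sum => j _; apply: H => l.
  by rewrite distrC.
rewrite /softmax mulrA ler_pdivlMr ?expsum_gt0// mulrAC ler_pdivrMr ?expsum_gt0//.
apply: (@le_trans _ _ (2 * expR (a i / C) * (2 * expsum b))).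
  by apply: ler_pM; rewrite ?expR_ge0 ?(ltW (expsum_gt0 _))//; exact: H.
by rewrite le_eqVlt; apply/orP; left; apply/eqP; ring.
Qed.

End Softmax.

(** * Overload prices *)

Section Sums.
Variable R : realType.

Lemma cauchy_weighted (J : finType) (a u : J -> R) : (forall j, 0 < u j) ->
  (\sum_j a j) ^+ 2 <= (\sum_j u j) * \sum_j a j ^+ 2 / u j.
Proof.
move=> u0; set A := \sum_j a j; set U := \sum_j u j; set B := \sum_j _ / _.
have U0 : 0 <= U by apply: sumr_ge0 => j _; exact: ltW.
have H : 0 <= \sum_j (a j * U - A * u j) ^+ 2 / u j.
  by apply: sumr_ge0 => j _; apply: divr_ge0; [exact: sqr_ge0|exact: ltW].
have E : \sum_j (a j * U - A * u j) ^+ 2 / u j = U * (U * B - A ^+ 2).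
  rewrite (eq_bigr (fun j => U ^+ 2 * (a j ^+ 2 / u j) - 2 * U * A * a j + A ^+ 2 * u j)).
    by rewrite big_split/= sumrB -!mulr_sumr -/A -/U -/B; ring.
  by move=> j _; field; rewrite gt_eqF.
move: H; rewrite E => H.
have [|Up] := boolP (0 < U); first by move=> Up; rewrite -subr_ge0 -(pmulr_rge0 _ Up).
(* A total weight that is not positive means an empty index type, and then both sides vanish. *)
have no (j : J) : False.
  case/negP: Up; have uU : u j <= U.
    by rewrite /U (bigD1 j)//= lerDl sumr_ge0// => l _; exact: ltW.
  exact: lt_le_trans (u0 j) uU.
have big0 (f : J -> R) : \sum_j f j = 0 by apply: big1 => j _; case: (no j).
by rewrite /A /U /B !big0 expr0n /= mul0r.
Qed.

End Sums.

Section Overload.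
Variables (R : realType) (om M rho : R) (X tau : nat -> R).
Hypotheses (om0 : 0 < om) (omM : om <= M) (rho0 : 0 < rho) (X0 : forall j, 0 <= X j).
Hypotheses (tau0 : tau 0%N = om)
  (tauS : forall j, tau j.+1 = Num.min (tau j * (1 + X j / (4 * rho))) M).

Lemma tau_bounds j : om <= tau j <= M /\ tau j <= tau j.+1.
Proof.
have H t l : 0 <= t -> t <= t * (1 + X l / (4 * rho)).
  by move=> t0; rewrite ler_peMr// lerDl divr_ge0// mulr_ge0// ltW.
elim: j => [|j [/andP[h1 h2] h3]].
  by rewrite tauS tau0 le_min lexx omM H// ltW.
have b1 : om <= tau j.+1 <= M by rewrite (le_trans h1 h3) tauS ge_min lexx orbT.
split=> //; have /andP[c1 c2] := b1; rewrite [leRHS]tauS le_min c2 andbT H//.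
by rewrite (le_trans _ c1)// ltW.
Qed.

Lemma tau_mono i j : (i <= j)%N -> tau i <= tau j.
Proof.
move=> ij; rewrite -(subnKC ij); elim: (j - i)%N => [|n IH]; first by rewrite addn0.
by rewrite addnS (le_trans IH)//; have [] := tau_bounds (i + n).
Qed.

(** Each entry raises the price by at most [tau * X / (4 rho)], so the payments at current prices
    dominate [4 rho] times the total increase. *)
Lemma tau_sum k : 4 * rho * (tau k - om) <= \sum_(j < k) tau j * X j.
Proof.
elim: k => [|k IH]; first by rewrite big_ord0 tau0 subrr mulr0.
rewrite big_ord_recr/=.
have : tau k.+1 <= tau k * (1 + X k / (4 * rho)) by rewrite tauS ge_min lexx.
move=> h; have -> : 4 * rho * (tau k.+1 - om) =
  4 * rho * (tau k - om) + 4 * rho * (tau k.+1 - tau k) by ring.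
rewrite lerD//.
have -> : tau k * X k = 4 * rho * (tau k * (1 + X k / (4 * rho)) - tau k).
  by field; rewrite gt_eqF.
by rewrite ler_wpM2l ?lerD2r// mulr_ge0// ltW.
Qed.

(** Below the cap the price grows by the factor [1 + v] with [v = X / (4 rho) <= 1 / 2], and
    [exp (2 v / 3) <= 1 + v] in this range: the logarithm of the price measures the load in units of
    [6 rho]. *)
Lemma tau_load k : (forall j, (j < k)%N -> X j <= 2 * rho) -> tau k < M ->
  \sum_(j < k) X j <= 6 * rho * ln (M / om).
Proof.
move=> X2 tM.
have H : forall l, (l <= k)%N -> om * expR ((\sum_(j < l) X j) / (6 * rho)) <= tau l.
  elim=> [|l IH] lk; first by rewrite big_ord0 mul0r expR0 mulr1 tau0.
  have tl : tau l.+1 < M by apply: le_lt_trans tM; exact: tau_mono.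
  have -> : tau l.+1 = tau l * (1 + X l / (4 * rho)).
    by move: tl; rewrite tauS gt_min ltxx orbF => /ltW/min_idPl ->.
  rewrite big_ord_recr/= mulrDl expRD mulrA.
  apply: ler_pM; rewrite ?mulr_ge0 ?expR_ge0 ?(ltW om0)//; first by apply: IH; exact: ltnW.
  set v := X l / (4 * rho).
  have v0 : 0 <= v by rewrite divr_ge0// mulr_ge0// ltW.
  have v1 : v <= 1 / 2.
    by rewrite /v ler_pdivrMr ?mulr_gt0//; have := X2 l lk; lra.
  have -> : X l / (6 * rho) = 2 / 3 * v by rewrite /v; field; rewrite gt_eqF.
  have h : expR (2 / 3 * v) * (1 - 2 / 3 * v) <= 1.
    have := expR_ge1Dx (- (2 / 3 * v)); rewrite expRN => h.
    by rewrite mulrC -ler_pdivlMr ?expR_gt0// mul1r.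
  have e0 := expR_gt0 (2 / 3 * v).
  have c0 : 0 < 1 - 2 / 3 * v by lra.
  rewrite -(ler_pM2r c0); apply: le_trans h _.
  have : 0 <= v * (1 - 2 * v) by rewrite mulr_ge0//; lra.
  lra.
have h := H k (leqnn k).
have Mom : expR ((\sum_(j < k) X j) / (6 * rho)) <= M / om.
  by rewrite ler_pdivlMr// mulrC (le_trans h)// ltW.
have M0 : 0 < M by exact: lt_le_trans omM.
have /ltW Mo : 0 < M / om by rewrite divr_gt0.
have : ln (expR ((\sum_(j < k) X j) / (6 * rho))) <= ln (M / om).
  by rewrite ler_ln ?posrE ?expR_gt0// divr_gt0.
rewrite expRK ler_pdivrMr ?mulr_gt0//; lra.
Qed.

End Overload.

(** * Regret bound *)

(** Linear core of [rowsum_bound]: [ta] is the last price of a row, [SX] and [SB] are what the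
    iterates and the comparator pay at overload prices. *)
Lemma potential_arith (R : realType) (rho om Mt B T NN M SX SB Y er PB ta : R) :
  0 < rho -> 1 * (1 * (om * rho)) <= T * (M * (om * rho)) ->
  T * PB <= T * B ->
  T * (2 * B + rho + 5 * M * (om * rho)) <= NN * (2 * B + rho + 5 * M * (om * rho)) ->
  Y <= T * rho + SB ->
  3 * rho * ta - 4 * rho * om - T * (M * (rho * om)) <= SX - SB ->
  NN * (2 * B + rho + 5 * M * (om * rho)) + rho + er < 3 * rho * Mt ->
  T * - B + SX <= T * PB + Y + rho / 4 + er ->
  3 * rho * ta < 3 * rho * Mt.
Proof. move=> *; lra. Qed.

Section Core.
Variables (R : realType) (m k N : nat).
Variables (XX : 'I_k -> set 'cV[R]_m) (psi : 'I_k -> 'cV[R]_m -> R).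
Variables (rho C om Mt Mh PP K1 zc dsco B : R) (w : 'I_k -> R) (h hh : 'I_k -> R -> R).
Variable X : nat -> 'M[R]_(m, k).

Definition rowsum t i : R := \sum_j X t i j.
Definition hsum t i : R := \sum_j h j (X t i j).
Definition hhsum t i : R := \sum_j hh j (X t i j).
Definition load t i : R := \sum_(s < t.+1) rowsum s i.
(** The next row sums are predicted to equal the last ones. [hh] stands for [h] because the program
    has to evaluate it: [hh] will be an explicit power, whereas [h] is given only as an inverse.
    Index 0 is a fictitious round with [X 0 = 0]. *)
Definition pred_load t i : R := if t is s.+1 then load s i + rowsum s i - hhsum s i else 0.
Definition weight t : 'I_m -> R := softmax C (pred_load t).

Fixpoint tau_seq (u : nat -> R) (j : nat) : R :=
  if j is l.+1 then Num.min (tau_seq u l * (1 + u l / (4 * rho))) Mt else om.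

Definition entry t i (j : nat) : R := if insub j is Some j' then X t i j' else 0.
Definition tau t i (j : nat) : R := tau_seq (entry t i) j.
Definition price t i (j : 'I_k) : R := \sum_(s < t) (weight s.+1 i + tau s.+1 i j).

Definition hinge (z : R) : R := Num.max (z - rho) 0.
Definition colcost t j i z : R :=
  price t i j / t%:R * z + weight t i / t%:R * h j z + Mh * hinge z.

Definition modulus j (a b : R) : R := (a - b) ^+ 2 / (K1 * (w j + 6 * a + 6 * b)).

Definition penalized (Y : 'M[R]_(m, k)) : R := psisum psi Y + Mh * \sum_i \sum_j hinge (Y i j).
(** The column costs of round [t], summed and multiplied by [t]: in this scaling a round adds one
    summand and changes the weights of [h], and nothing else. *)
Definition objective t (Y : 'M[R]_(m, k)) : R := t%:R * penalized Y
  + \sum_i \sum_j price t i j * Y i j + \sum_i weight t i * \sum_j h j (Y i j).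

Hypotheses (m0 : (0 < m)%N) (rho0 : 0 < rho) (C0 : 0 < C) (om0 : 0 < om) (omM : om <= Mt).
Hypotheses (Mh0 : 0 <= Mh) (K10 : 0 < K1) (zc0 : 0 <= zc) (dsco0 : 0 <= dsco) (B0 : 0 <= B).
Hypothesis (w0 : forall j, 0 < w j).
Hypothesis mid_set : forall j x y, XX j x -> XX j y -> XX j (2^-1 *: (x + y)).
Hypothesis mid_psi : forall j x y, XX j x -> XX j y ->
  psi j (2^-1 *: (x + y)) <= (psi j x + psi j y) / 2.
Hypothesis XX_ge0 : forall j x, XX j x -> forall i, 0 <= x i 0.
Hypothesis psi_bound : forall Y, colprod XX Y -> `|psisum psi Y| <= B.

Hypothesis X_0 : X 0%N = 0.
Hypothesis X_in : forall t, (t < N)%N -> colprod XX (X t.+1).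
Hypothesis X_opt : forall t j x, (t < N)%N -> XX j x ->
  psi j (col j (X t.+1)) + \sum_i colcost t.+1 j i (X t.+1 i j)
  <= psi j x + \sum_i colcost t.+1 j i (x i 0) + dsco.
Hypothesis X_le : forall t i j, (t < N)%N -> X t.+1 i j <= PP * w j.
Hypothesis X_le2 : forall t i j, (t < N)%N -> X t.+1 i j <= 2 * rho.

Hypothesis h_0 : forall j, h j 0 = 0.
Hypothesis h_ge0 : forall j z, 0 <= z -> 0 <= h j z.
Hypothesis h_mid : forall j a b, 0 <= a -> a <= PP * w j -> 0 <= b -> b <= PP * w j ->
  h j ((a + b) / 2) + modulus j a b <= (h j a + h j b) / 2.
Hypothesis h_lip : forall j a b, 0 <= a -> a <= PP * w j -> 0 <= b -> b <= PP * w j ->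
  `|h j a - h j b| <= `|a - b| / 4.
Hypothesis hh_close : forall j a, 0 <= a -> a <= PP * w j -> `|hh j a - h j a| <= zc * a.

Variable Xb : 'M[R]_(m, k).
Hypothesis Xb_in : colprod XX Xb.
Hypothesis Xb_row : forall i, \sum_j Xb i j <= rho.
Hypothesis Xb_le : forall i j, Xb i j <= PP * w j.

Lemma colprod_ge0 Y i j : colprod XX Y -> 0 <= Y i j.
Proof. by move=> YX; have := XX_ge0 (YX j) i; rewrite mxE. Qed.

Lemma X_ge0 t i j : (t <= N)%N -> 0 <= X t i j.
Proof. by case: t => [|t] tN; [rewrite X_0 mxE|exact/colprod_ge0/X_in]. Qed.

Lemma X_leP t i j : (t <= N)%N -> X t i j <= PP * w j.
Proof.
case: t => [_|t]; last exact: X_le.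
rewrite X_0 mxE; have := Xb_le i j; apply: le_trans; exact: colprod_ge0.
Qed.

Lemma weight_gt0 t i : 0 < weight t i. Proof. exact: softmax_gt0. Qed.
Lemma weight_sum t : \sum_i weight t i = 1. Proof. exact: softmax_sum1. Qed.

Lemma hinge_ge0 z : 0 <= hinge z. Proof. by rewrite /hinge le_max lexx orbT. Qed.

Lemma hinge_mid a b : hinge (2^-1 * (a + b)) <= (hinge a + hinge b) / 2.
Proof.
have ha : a - rho <= hinge a by rewrite /hinge le_max lexx.
have hb : b - rho <= hinge b by rewrite /hinge le_max lexx.
have := hinge_ge0 a; have := hinge_ge0 b => h1 h2.
by rewrite {1}/hinge ge_max; apply/andP; split; lra.
Qed.

Lemma objective_opt t Y : (t < N)%N -> colprod XX Y ->
  objective t.+1 (X t.+1) <= objective t.+1 Y + t.+1%:R * (k%:R * dsco).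
Proof.
move=> tN YX.
have t0 : 0 < t.+1%:R :> R by rewrite ltr0n.
have E Z : objective t.+1 Z = t.+1%:R * \sum_j (psi j (col j Z) + \sum_i colcost t.+1 j i (Z i j)).
  have -> : \sum_j (psi j (col j Z) + \sum_i colcost t.+1 j i (Z i j)) =
    psisum psi Z + \sum_i \sum_j colcost t.+1 j i (Z i j).
    by rewrite big_split/= exchange_big.
  have -> : \sum_i \sum_j colcost t.+1 j i (Z i j) =
    t.+1%:R^-1 * (\sum_i \sum_j price t.+1 i j * Z i j)
    + t.+1%:R^-1 * (\sum_i weight t.+1 i * \sum_j h j (Z i j))
    + Mh * \sum_i \sum_j hinge (Z i j).
    rewrite !mulr_sumr -!big_split/=; apply: eq_bigr => i _.
    rewrite !mulr_sumr -!big_split/=; apply: eq_bigr => j _.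
    by rewrite /colcost; ring.
  by rewrite /objective /penalized; field; rewrite gt_eqF.
rewrite !E -mulrDr; apply: ler_wpM2l; first exact: ltW.
have -> : k%:R * dsco = \sum_(j < k) dsco by rewrite sumr_const card_ord mulr_natl.
rewrite -big_split/=; apply: ler_sum => j _.
have -> : \sum_i colcost t.+1 j i (Y i j) = \sum_i colcost t.+1 j i (col j Y i 0).
  by apply: eq_bigr => i _; rewrite mxE.
exact: X_opt.
Qed.

Lemma colprod_mid Y Z : colprod XX Y -> colprod XX Z -> colprod XX (2^-1 *: (Y + Z)).
Proof.
move=> YX ZX j; have -> : col j (2^-1 *: (Y + Z)) = 2^-1 *: (col j Y + col j Z).
  by apply/matrixP => a b; rewrite !mxE.
exact: mid_set.
Qed.

Lemma objective_mid t s : (t < N)%N -> (s < N)%N ->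
  objective t.+1 (2^-1 *: (X t.+1 + X s.+1)) + \sum_i weight t.+1 i * \sum_j modulus j (X t.+1 i j) (X s.+1 i j)
  <= (objective t.+1 (X t.+1) + objective t.+1 (X s.+1)) / 2.
Proof.
move=> tN sN; set Z := 2^-1 *: _.
have ZE i j : Z i j = (X t.+1 i j + X s.+1 i j) / 2 by rewrite !mxE mulrC.
have hp : psisum psi Z <= (psisum psi (X t.+1) + psisum psi (X s.+1)) / 2.
  rewrite /psisum -big_split/= mulr_suml; apply: ler_sum => j _.
  have -> : col j Z = 2^-1 *: (col j (X t.+1) + col j (X s.+1)).
    by apply/matrixP => a b; rewrite !mxE.
  by apply: mid_psi; exact: X_in.
have hhin : \sum_i \sum_j hinge (Z i j) <=
    (\sum_i \sum_j hinge (X t.+1 i j) + \sum_i \sum_j hinge (X s.+1 i j)) / 2.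
  rewrite -big_split/= mulr_suml; apply: ler_sum => i _.
  rewrite -big_split/= mulr_suml; apply: ler_sum => j _.
  by rewrite ZE mulrC hinge_mid.
have hpr : \sum_i \sum_j price t.+1 i j * Z i j =
    (\sum_i \sum_j price t.+1 i j * X t.+1 i j + \sum_i \sum_j price t.+1 i j * X s.+1 i j) / 2.
  rewrite -big_split/= mulr_suml; apply: eq_bigr => i _.
  rewrite -big_split/= mulr_suml; apply: eq_bigr => j _.
  by rewrite ZE; ring.
have hreg : \sum_i weight t.+1 i * \sum_j h j (Z i j)
    + \sum_i weight t.+1 i * \sum_j modulus j (X t.+1 i j) (X s.+1 i j) <=
    (\sum_i weight t.+1 i * \sum_j h j (X t.+1 i j)
     + \sum_i weight t.+1 i * \sum_j h j (X s.+1 i j)) / 2.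
  rewrite -!big_split/= mulr_suml; apply: ler_sum => i _.
  rewrite -!mulrDr -mulrA ler_wpM2l ?(ltW (weight_gt0 _ _))//.
  rewrite -!big_split/= mulr_suml; apply: ler_sum => j _.
  by rewrite ZE; apply: h_mid; rewrite ?X_ge0 ?X_le.
rewrite /objective /penalized hpr.
have t0 : 0 <= t.+1%:R :> R by [].
have := ler_wpM2l Mh0 hhin => hM.
have := ler_wpM2l t0 (lerD hp hM) => hT.
lra.
Qed.

(** The near-minimizer [X t.+1] is compared with its midpoint to [X t.+2]; what midpoint convexity
    gains there counts twice. *)
Lemma objective_strong t : (t.+1 < N)%N ->
  objective t.+1 (X t.+1) + 2 * \sum_i weight t.+1 i * \sum_j modulus j (X t.+2 i j) (X t.+1 i j)
  <= objective t.+1 (X t.+2) + 2 * (t.+1%:R * (k%:R * dsco)).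
Proof.
move=> tN; have tN' : (t < N)%N by exact: ltnW.
have := objective_mid tN' tN; have := objective_opt tN' (colprod_mid (X_in tN') (X_in tN)).
have -> : \sum_i weight t.+1 i * (\sum_j modulus j (X t.+2 i j) (X t.+1 i j)) =
  \sum_i weight t.+1 i * (\sum_j modulus j (X t.+1 i j) (X t.+2 i j)).
  apply: eq_bigr => i _; congr (_ * _); apply: eq_bigr => j _.
  rewrite /modulus -[X t.+2 i j - _]opprB sqrrN; congr (_ / (_ * _)); ring.
lra.
Qed.

Definition modsum t i : R := \sum_j modulus j (X t.+1 i j) (X t i j).

(** Up to oracle errors, a lower bound for the growth of the minimal objective in one round: the
    cost of the new iterate, the change of the regularizer, and the strong convexity collected by
    moving away from [X t]. *)
Definition gain t : R := penalized (X t.+1) + \sum_i weight t.+1 i * rowsum t.+1 i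
  + \sum_i \sum_(j < k) tau t.+1 i j * X t.+1 i j
  + \sum_i (weight t.+1 i - weight t i) * hsum t.+1 i
  + 2 * \sum_i weight t i * modsum t i.

Definition sco_error : R := 3 * N%:R * (N%:R * (k%:R * dsco)).

Lemma objective_step t Y : objective t.+1 Y = objective t Y + penalized Y
  + \sum_i weight t.+1 i * (\sum_j Y i j) + \sum_i \sum_(j < k) tau t.+1 i j * Y i j
  + \sum_i (weight t.+1 i - weight t i) * \sum_j h j (Y i j).
Proof.
have -> : \sum_i (weight t.+1 i - weight t i) * (\sum_j h j (Y i j)) =
    \sum_i weight t.+1 i * (\sum_j h j (Y i j)) - \sum_i weight t i * (\sum_j h j (Y i j)).
  by rewrite -sumrB; apply: eq_bigr => i _; ring.
rewrite /objective -natr1.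
have -> : \sum_i \sum_j price t.+1 i j * Y i j = \sum_i \sum_j price t i j * Y i j
    + \sum_i weight t.+1 i * (\sum_j Y i j) + \sum_i \sum_(j < k) tau t.+1 i j * Y i j.
  rewrite -!big_split/=; apply: eq_bigr => i _; rewrite mulr_sumr -!big_split/=.
  by apply: eq_bigr => j _; rewrite /price big_ord_recr/=; ring.
by ring.
Qed.

(** At [t = 0] the objective is the regularizer alone, minimized by the fictitious iterate 0, so the
    first round also collects its strong convexity. *)
Lemma objective_opt0 t : (t < N)%N ->
  objective t (X t) + 2 * \sum_i weight t i * modsum t i
  <= objective t (X t.+1) + 2 * (N%:R * (k%:R * dsco)).
Proof.
case: t => [|t] tN.
  have kd : 0 <= 2 * (N%:R * (k%:R * dsco)) by rewrite !mulr_ge0.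
  apply: (@le_trans _ _ (objective 0 (X 1%N))); last by rewrite lerDl.
  rewrite /objective !mul0r !add0r.
  have p0 Y : \sum_i \sum_j price 0 i j * Y i j = 0.
    by apply: big1 => i _; apply: big1 => j _; rewrite /price big_ord0 mul0r.
  rewrite !p0 !add0r X_0.
  rewrite (_ : \sum_i weight 0 i * _ = 0) ?add0r; last first.
    by apply: big1 => i _; rewrite (big1 _ _ (fun j => h j _)) ?mulr0// => j _; rewrite mxE h_0.
  rewrite mulr_sumr; apply: ler_sum => i _; rewrite mulrCA.
  apply: ler_wpM2l; first exact/ltW/weight_gt0.
  rewrite mulr_sumr; apply: ler_sum => j _; rewrite X_0 mxE.
  have a0 : 0 <= X 1%N i j by exact: X_ge0.
  have aP : X 1%N i j <= PP * w j by exact: X_le.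
  have := h_mid a0 aP (lexx 0) (le_trans a0 aP).
  have : 0 <= h j ((X 1%N i j + 0) / 2) by apply: h_ge0; rewrite addr0 divr_ge0.
  rewrite h_0; lra.
apply: le_trans (objective_strong tN) _; rewrite lerD2l ler_wpM2l//.
by rewrite ler_wpM2r ?mulr_ge0// ler_nat ltnW.
Qed.

(** Telescoping of follow-the-leader: each leader is compared with the next iterate under the old
    objective. *)
Lemma objective_lower T : (T <= N)%N ->
  \sum_(t < T) gain t - T%:R * (2 * (N%:R * (k%:R * dsco))) <= objective T (X T).
Proof.
elim: T => [|T IH] TN.
  rewrite big_ord0 mul0r subr0 /objective mul0r add0r X_0.
  rewrite (_ : \sum_i \sum_j _ = 0); last first.
    by apply: big1 => i _; apply: big1 => j _; rewrite /price big_ord0 mul0r.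
  rewrite add0r sumr_ge0// => i _; rewrite mulr_ge0 ?(ltW (weight_gt0 _ _))// sumr_ge0// => j _.
  by rewrite mxE h_0.
have E : objective T.+1 (X T.+1) = objective T (X T.+1) + penalized (X T.+1)
    + \sum_i weight T.+1 i * rowsum T.+1 i + \sum_i \sum_(j < k) tau T.+1 i j * X T.+1 i j
    + \sum_i (weight T.+1 i - weight T i) * hsum T.+1 i by exact: objective_step.
have := IH (ltnW TN); have := objective_opt0 TN.
by rewrite big_ord_recr/= E -natr1 [X in _ + X - _]/gain; lra.
Qed.

Definition rb i : R := \sum_j Xb i j.

Lemma Xb_hinge i j : hinge (Xb i j) = 0.
Proof.
rewrite /hinge; apply/max_idPr; rewrite subr_le0; apply: le_trans (Xb_row i).
rewrite (bigD1 j)//= lerDl sumr_ge0// => l _; exact: colprod_ge0.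
Qed.

Lemma Xb_ge0 i j : 0 <= Xb i j. Proof. exact: colprod_ge0. Qed.

Lemma PPw_ge0 (i : 'I_m) j : 0 <= PP * w j.
Proof. exact: le_trans (Xb_ge0 i j) (Xb_le i j). Qed.

Lemma h_quarter (i : 'I_m) j z : 0 <= z -> z <= PP * w j -> h j z <= z / 4.
Proof.
move=> z0 zP; have := h_lip z0 zP (lexx 0) (PPw_ge0 i j).
by rewrite h_0 !subr0 (ger0_norm z0) ger0_norm// h_ge0.
Qed.

Lemma objective_Xb T : objective T Xb <= T%:R * psisum psi Xb
  + \sum_(s < T) (\sum_i weight s.+1 i * rb i + \sum_i \sum_(j < k) tau s.+1 i j * Xb i j)
  + rho / 4.
Proof.
have E : objective T Xb = T%:R * psisum psi Xb
    + \sum_(s < T) (\sum_i weight s.+1 i * rb i + \sum_i \sum_(j < k) tau s.+1 i j * Xb i j)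
    + \sum_i weight T i * \sum_j h j (Xb i j).
  have PX : penalized Xb = psisum psi Xb.
    rewrite /penalized (_ : \sum_i _ = 0) ?mulr0 ?addr0//.
    by apply: big1 => i _; apply: big1 => j _; exact: Xb_hinge.
  elim: T => [|T IH].
    rewrite /objective !mul0r big_ord0 !add0r (_ : \sum_i \sum_j _ = 0) ?add0r//.
    by apply: big1 => i _; apply: big1 => j _; rewrite /price big_ord0 mul0r.
  rewrite objective_step IH big_ord_recr/= PX -natr1.
  have -> : \sum_i (weight T.+1 i - weight T i) * (\sum_j h j (Xb i j)) =
    \sum_i weight T.+1 i * (\sum_j h j (Xb i j)) - \sum_i weight T i * (\sum_j h j (Xb i j)).
    by rewrite -sumrB; apply: eq_bigr => i _; ring.
  by rewrite /rb; ring.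
rewrite E lerD2l.
apply: (@le_trans _ _ (\sum_i weight T i * (rho / 4))); last by rewrite -mulr_suml weight_sum mul1r.
apply: ler_sum => i _; apply: ler_wpM2l; first exact/ltW/weight_gt0.
apply: (@le_trans _ _ (\sum_j Xb i j / 4)).
  by apply: ler_sum => j _; apply: (h_quarter i); [exact: Xb_ge0|exact: Xb_le].
by rewrite -mulr_suml ler_wpM2r.
Qed.

Lemma gain_le T : (T <= N)%N -> \sum_(t < T) gain t <= T%:R * psisum psi Xb
  + \sum_(s < T) (\sum_i weight s.+1 i * rb i + \sum_i \sum_(j < k) tau s.+1 i j * Xb i j)
  + rho / 4 + sco_error.
Proof.
move=> TN; have h1 := objective_lower TN; have h2 := objective_Xb T.
have kd : 0 <= N%:R * (k%:R * dsco) by rewrite !mulr_ge0.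
have h3 : objective T (X T) <= objective T Xb + N%:R * (k%:R * dsco).
  case: T TN {h1 h2} => [|T] TN.
    apply: (@le_trans _ _ (objective 0 Xb)); last by rewrite lerDl.
    rewrite /objective !mul0r !add0r X_0.
    have p0 Y : \sum_i \sum_j price 0 i j * Y i j = 0.
      by apply: big1 => i _; apply: big1 => j _; rewrite /price big_ord0 mul0r.
    rewrite !p0 !add0r; apply: ler_sum => i _; apply: ler_wpM2l; first exact/ltW/weight_gt0.
    by apply: ler_sum => j _; rewrite mxE h_0 h_ge0// Xb_ge0.
  apply: le_trans (objective_opt TN Xb_in) _; rewrite lerD2l ler_wpM2r ?mulr_ge0//.
  by rewrite ler_nat.
have h4 : T%:R * (2 * (N%:R * (k%:R * dsco))) <= N%:R * (2 * (N%:R * (k%:R * dsco))).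
  by rewrite ler_wpM2r ?mulr_ge0// ler_nat.
have h5 : N%:R * (k%:R * dsco) <= N%:R * (N%:R * (k%:R * dsco)).
  have [->|N0] := posnP N; first by rewrite !mul0r.
  by rewrite ler_peMl// ler1n.
rewrite /sco_error; lra.
Qed.

Lemma entry_ge0 t i j : (t < N)%N -> 0 <= entry t.+1 i j.
Proof. by move=> tN; rewrite /entry; case: insubP => // j' _ _; exact: X_ge0. Qed.

Lemma entryE t i (j : 'I_k) : entry t i j = X t i j.
Proof. by rewrite /entry valK. Qed.

Lemma tau_ge t i j : (t < N)%N -> om <= tau t.+1 i j.
Proof.
move=> tN; have [/andP[]//] := @tau_bounds _ om Mt rho (entry t.+1 i) (tau_seq (entry t.+1 i))
  om0 omM rho0 (fun j => entry_ge0 i j tN) erefl (fun=> erefl) j.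
Qed.

(** A row of the iterate pays at least [4 rho (tau k - om)]. Prices increase along the row and the
    comparator has row sum at most [rho], so it pays at most [rho tau k]. The surplus is what rules
    out a price at the cap. *)
Lemma tau_gap t i : (t < N)%N -> 3 * rho * tau t.+1 i k - 4 * rho * om <=
  \sum_(j < k) tau t.+1 i j * X t.+1 i j - \sum_(j < k) tau t.+1 i j * Xb i j.
Proof.
move=> tN; have e0 j := entry_ge0 i j tN.
have h1 := @tau_sum _ om Mt rho (entry t.+1 i) (tau_seq (entry t.+1 i)) rho0 erefl (fun=> erefl) k.
have h2 : \sum_(j < k) tau t.+1 i j * Xb i j <= tau t.+1 i k * rho.
  apply: (@le_trans _ _ (\sum_(j < k) tau t.+1 i k * Xb i j)); last first.
    rewrite -mulr_sumr ler_wpM2l ?Xb_row// (le_trans _ (tau_ge i k tN))//; exact: ltW.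
  apply: ler_sum => j _; apply: ler_wpM2r; first exact: Xb_ge0.
  by apply: (tau_mono om0 omM rho0 e0 erefl (fun=> erefl)); exact: ltnW.
have h3 : \sum_(j < k) tau_seq (entry t.+1 i) j * entry t.+1 i j =
    \sum_(j < k) tau t.+1 i j * X t.+1 i j by apply: eq_bigr => j _; rewrite entryE.
by rewrite h3 -/(tau _ _ _) in h1; lra.
Qed.

(* Row sums of the iterates are at most [overload * rho]. *)
Definition overload : R := 6 * ln (Mt / om).

Hypothesis Mt_big : N%:R * (2 * B + rho + 5 * m%:R * (om * rho)) + rho + sco_error < 3 * rho * Mt.
Hypothesis w_sum : \sum_j w j <= rho.
Hypothesis zc_le : zc <= 3 / 4.
Hypothesis C_ge_load : 40 * (overload * rho) <= C.

Lemma overload_ge0 : 0 <= overload.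
Proof. by rewrite /overload mulr_ge0// ln_ge0// ler_pdivlMr// mul1r. Qed.

Lemma overload_rho_ge0 : 0 <= overload * rho.
Proof. by apply: mulr_ge0; [exact: overload_ge0|exact: ltW]. Qed.

Lemma rowsum_ge0 t i : (t <= N)%N -> 0 <= rowsum t i.
Proof. by move=> tN; rewrite sumr_ge0// => j _; exact: X_ge0. Qed.

Lemma rowsum0 i : rowsum 0 i = 0.
Proof. by rewrite /rowsum big1// => j _; rewrite X_0 mxE. Qed.

Lemma hsum0 i : hsum 0 i = 0.
Proof. by rewrite /hsum big1// => j _; rewrite X_0 mxE h_0. Qed.

Lemma hsum_le t i : (t <= N)%N -> 0 <= hsum t i <= rowsum t i / 4.
Proof.
move=> tN; rewrite sumr_ge0 => [|j _]; last by rewrite h_ge0// X_ge0.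
rewrite /rowsum mulr_suml; apply: ler_sum => j _.
by apply: (h_quarter i); [exact: X_ge0|exact: X_leP].
Qed.

Lemma hhsum_close t i : (t <= N)%N -> `|hhsum t i - hsum t i| <= zc * rowsum t i.
Proof.
move=> tN; rewrite /hhsum /hsum -sumrB; apply: le_trans (ler_norm_sum _ _ _) _.
rewrite /rowsum mulr_sumr; apply: ler_sum => j _.
by apply: hh_close; [exact: X_ge0|exact: X_leP].
Qed.

Lemma pred_load_diff t i : (t <= N)%N -> rowsum t i <= overload * rho ->
  rowsum t.-1 i <= overload * rho -> `|pred_load t.+1 i - pred_load t i| <= C / 4.
Proof.
move=> tN h1 h2; have := C_ge_load => hC.
have /andP[a1 a2] := hsum_le i tN; have := hhsum_close i tN; rewrite ler_norml => /andP[b1 b2].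
have r0 := rowsum_ge0 i tN; have zr : zc * rowsum t i <= 3 / 4 * rowsum t i by rewrite ler_wpM2r.
have G0 := mulr_ge0 overload_ge0 (ltW rho0).
case: t tN h1 h2 a1 a2 b1 b2 r0 zr => [|t] tN h1 h2 a1 a2 b1 b2 r0 zr.
  rewrite /= /load big_ord_recr big_ord0 /= rowsum0 in a2 zr b1 b2 *.
  rewrite ler_norml; lra.
have tN' : (t <= N)%N by exact: ltnW.
have /andP[c1 c2] := hsum_le i tN'; have := hhsum_close i tN'; rewrite ler_norml => /andP[d1 d2].
have r0' := rowsum_ge0 i tN'; have zr' : zc * rowsum t i <= 3 / 4 * rowsum t i by rewrite ler_wpM2r.
rewrite /= /load (big_ord_recr t.+1)/= in h2 *.
by rewrite ler_norml; lra.
Qed.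

Lemma weight_ratio t i : (t <= N)%N -> (forall i, rowsum t i <= overload * rho) ->
  (forall i, rowsum t.-1 i <= overload * rho) ->
  weight t.+1 i <= 4 * weight t i /\ weight t i <= 4 * weight t.+1 i.
Proof.
move=> tN h1 h2; have H j := pred_load_diff tN (h1 j) (h2 j).
by split; apply: softmax_ratio => // j; rewrite distrC.
Qed.

Lemma penalized_ge Y : psisum psi Y <= penalized Y.
Proof.
rewrite /penalized lerDl mulr_ge0// sumr_ge0// => i _; rewrite sumr_ge0// => j _; exact: hinge_ge0.
Qed.

Lemma weight_rb s : \sum_i weight s i * rb i <= rho.
Proof.
apply: (@le_trans _ _ (\sum_i weight s i * rho)); last by rewrite -mulr_suml weight_sum mul1r.
by apply: ler_sum => i _; apply: ler_wpM2l; [exact/ltW/weight_gt0|exact: Xb_row].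
Qed.

Lemma modsum_ge0 t i : (t < N)%N -> 0 <= modsum t i.
Proof.
move=> tN; rewrite sumr_ge0// => j _; rewrite /modulus divr_ge0 ?sqr_ge0//.
by rewrite mulr_ge0 ?(ltW K10)// !addr_ge0 ?(ltW (w0 j)) ?mulr_ge0 ?X_ge0// ltnW.
Qed.

(** Strong induction on the round. Bounded earlier rows give weight ratios at most 4, hence a lower
    bound for every gain; [gain_le] then bounds the surplus at overload prices, and by [Mt_big] a
    price at the cap would exceed this bound. Below the cap, [tau_load] applies. *)
Lemma rowsum_bound t : (t < N)%N -> forall i, rowsum t.+1 i <= overload * rho.
Proof.
elim/ltn_ind: t => t IH tN i.
have rat s : (s <= t)%N -> forall i, weight s i <= 4 * weight s.+1 i.
  move=> st l; have sN : (s <= N)%N by rewrite (leq_trans st)// ltnW.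
  have H u : (u <= t)%N -> forall i, rowsum u i <= overload * rho.
    case: u => [|u] ut l'; first by rewrite rowsum0 mulr_ge0 ?overload_ge0 ?ltW.
    by apply: IH => //; exact: ltn_trans tN.
  have [_] := weight_ratio l sN (H s st) (H s.-1 (leq_trans (leq_pred _) st)).
  by [].
have g s : (s <= t)%N -> - B + \sum_i \sum_(j < k) tau s.+1 i j * X s.+1 i j <= gain s.
  move=> st; have sN : (s < N)%N by exact: leq_ltn_trans tN.
  have h1 := penalized_ge (X s.+1).
  have := psi_bound (X_in sN); rewrite ler_norml => /andP[h2 _].
  have h3 : 0 <= \sum_i weight s i * modsum s i.
    by rewrite sumr_ge0// => l _; rewrite mulr_ge0 ?modsum_ge0// ltW// weight_gt0.
  (* [hsum <= rowsum / 4] against [weight s <= 4 * weight s.+1]: the loss [weight s * hsum] never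
     exceeds [weight s.+1 * rowsum]. *)
  have h4 : 0 <= \sum_i weight s.+1 i * rowsum s.+1 i
      + \sum_i (weight s.+1 i - weight s i) * hsum s.+1 i.
    rewrite -big_split/= sumr_ge0// => l _.
    have /andP[a1 a2] := hsum_le l (sN : (s.+1 <= N)%N).
    have := rat s st l; have := weight_gt0 s.+1 l; have := weight_gt0 s l => p1 p2 p3.
    have q1 : weight s l * hsum s.+1 l <= 4 * weight s.+1 l * (rowsum s.+1 l / 4).
      by apply: ler_pM => //; exact: ltW.
    have q2 : 0 <= weight s.+1 l * hsum s.+1 l by rewrite mulr_ge0// ltW.
    nra.
  rewrite /gain; lra.
have h1 := gain_le tN.
have h2 : \sum_(s < t.+1) (- B + \sum_i \sum_(j < k) tau s.+1 i j * X s.+1 i j)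
    <= \sum_(s < t.+1) gain s.
  by apply: ler_sum => s _; apply: g; rewrite -ltnS.
have h3 : \sum_(s < t.+1) (\sum_i weight s.+1 i * rb i + \sum_i \sum_(j < k) tau s.+1 i j * Xb i j)
    <= \sum_(s < t.+1) (rho + \sum_i \sum_(j < k) tau s.+1 i j * Xb i j).
  by apply: ler_sum => s _; rewrite lerD2r weight_rb.
have := psi_bound Xb_in; rewrite ler_norml => /andP[_ hB].
have h4 : t.+1%:R * psisum psi Xb <= t.+1%:R * B by rewrite ler_wpM2l.
have gp s l : (s <= t)%N -> - (rho * om) <= \sum_(j < k) tau s.+1 l j * X s.+1 l j
    - \sum_(j < k) tau s.+1 l j * Xb l j.
  move=> st; have sN : (s < N)%N by exact: leq_ltn_trans tN.
  apply: le_trans (tau_gap l sN); have := tau_ge l k sN => q.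
  have : 3 * rho * om <= 3 * rho * tau s.+1 l k by rewrite ler_wpM2l// mulr_ge0// ltW.
  lra.
(* The full gap is used for row [i] of the last round only; any other row of any round loses at most
   [rho * om]. *)
have h5 : 3 * rho * tau t.+1 i k - 4 * rho * om - t.+1%:R * (m%:R * (rho * om)) <=
    \sum_(s < t.+1) (\sum_i \sum_(j < k) tau s.+1 i j * X s.+1 i j
      - \sum_i \sum_(j < k) tau s.+1 i j * Xb i j).
  have ro : 0 <= rho * om by rewrite mulr_ge0// ltW.
  have gs s : (s <= t)%N -> - (m%:R * (rho * om)) <= \sum_i \sum_(j < k) tau s.+1 i j * X s.+1 i j
      - \sum_i \sum_(j < k) tau s.+1 i j * Xb i j.
    move=> st; rewrite -sumrB -mulrN -[X in X%:R * _]card_ord mulr_natl -sumr_const.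
    by apply: ler_sum => l _; exact: gp.
  have gt : 3 * rho * tau t.+1 i k - 4 * rho * om - m%:R * (rho * om) <=
      \sum_i \sum_(j < k) tau t.+1 i j * X t.+1 i j - \sum_i \sum_(j < k) tau t.+1 i j * Xb i j.
    rewrite -sumrB (bigD1 i)//=; apply: lerD; first exact: tau_gap.
    apply: (@le_trans _ _ (\sum_(l < m | l != i) - (rho * om))); last first.
      by apply: ler_sum => l _; exact: gp.
    rewrite -mulrN -[X in X%:R * _]card_ord mulr_natl -[X in X <= _]sumr_const.
    by rewrite [X in X <= _](bigD1 i)//= gerDr oppr_le0.
  rewrite big_ord_recr/= -natr1.
  have : \sum_(s < t) - (m%:R * (rho * om)) <= \sum_(s < t) (\sum_i \sum_(j < k) tau s.+1 i j * X s.+1 i j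
      - \sum_i \sum_(j < k) tau s.+1 i j * Xb i j).
    by apply: ler_sum => s _; apply: gs; exact: ltnW.
  rewrite sumr_const card_ord -mulr_natl; lra.
have tN1 : t.+1%:R <= N%:R :> R by rewrite ler_nat.
have m1 : 1 <= m%:R :> R by rewrite ler1n.
have tlt : tau t.+1 i k < Mt.
  have e0 : 0 <= sco_error by rewrite /sco_error !mulr_ge0.
  have q : t.+1%:R * (2 * B + rho + 5 * m%:R * (om * rho))
      <= N%:R * (2 * B + rho + 5 * m%:R * (om * rho)).
    have or : 0 <= om * rho by rewrite mulr_ge0// ltW.
    by apply: ler_wpM2r => //; rewrite !addr_ge0 ?mulr_ge0// ltW.
  have q2 : 1 * (1 * (om * rho)) <= t.+1%:R * (m%:R * (om * rho)).
    have or : 0 <= om * rho by rewrite mulr_ge0// ltW.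
    by apply: ler_pM => //; [rewrite mul1r|rewrite ler1n|exact: ler_wpM2r].
  pose SX : R := \sum_(s < t.+1) \sum_i \sum_(j < k) tau s.+1 i j * X s.+1 i j.
  pose SB : R := \sum_(s < t.+1) \sum_i \sum_(j < k) tau s.+1 i j * Xb i j.
  have h2' : t.+1%:R * (- B) + SX <= \sum_(s < t.+1) gain s.
    apply: le_trans h2; rewrite big_split/= sumr_const card_ord.
    by rewrite mulr_natl.
  have h3' : \sum_(s < t.+1) (\sum_i weight s.+1 i * rb i + \sum_i \sum_(j < k) tau s.+1 i j * Xb i j)
      <= t.+1%:R * rho + SB.
    apply: le_trans h3 _; rewrite big_split/= sumr_const card_ord.
    by rewrite mulr_natl.
  have h5' : 3 * rho * tau t.+1 i k - 4 * rho * om - t.+1%:R * (m%:R * (rho * om)) <= SX - SB.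
    by rewrite /SX /SB -sumrB.
  have := le_trans h2' h1; have := Mt_big.
  clear h1 h2 h3 h5 h2' gp g; move: SX SB h3' h5' => SX SB.
  move: (\sum_(s < t.+1) _) => Y h3' h5'.
  move: sco_error (psisum psi Xb) (tau t.+1 i k) h4 q e0 h3' h5' hB => er PB ta h4 q e0 h3' h5' hB b1 b2.
  rewrite -(ltr_pM2l (_ : 0 < 3 * rho)) ?mulr_gt0//.
  exact: potential_arith rho0 q2  h4 q h3' h5' b1 b2.
apply: le_trans (_ : 6 * rho * ln (Mt / om) <= _); last by rewrite /overload; lra.
have -> : rowsum t.+1 i = \sum_(j < k) entry t.+1 i j by apply: eq_bigr => j _; rewrite entryE.
apply: (@tau_load _ om Mt rho (entry t.+1 i) (tau_seq (entry t.+1 i))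
  om0 omM rho0 (fun j => entry_ge0 i j tN) erefl (fun=> erefl)) => //.
by move=> j _; rewrite /entry; case: insubP => [j' _ _|_]; [exact: X_le2|rewrite mulr_ge0// ltW].
Qed.

Definition travel t i : R := \sum_j `|X t.+1 i j - X t i j|.
Definition vari t : R := \sum_i weight t i * modsum t i.
(** Bound for the denominators of [modulus] summed along a row: the widths sum to at most [rho], and
    the two row sums are at most [overload * rho] each. *)
Definition scale : R := K1 * (rho * (1 + 12 * overload)).
Definition zbar : R := zc * (overload * rho).

Hypothesis C_ge_scale : 16 * scale <= C.

Lemma rowsum_bound0 t i : (t <= N)%N -> rowsum t i <= overload * rho.
Proof.
case: t => [_|t tN]; last exact: rowsum_bound.
by rewrite rowsum0 overload_rho_ge0.
Qed.

Lemma travel_ge0 t i : 0 <= travel t i.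
Proof. by rewrite sumr_ge0. Qed.

Lemma travel_le t i : (t < N)%N -> travel t i <= 2 * (overload * rho).
Proof.
move=> tN; have h1 := rowsum_bound0 i tN; have h2 := rowsum_bound0 i (ltnW tN).
apply: (@le_trans _ _ (rowsum t.+1 i + rowsum t i)); last by lra.
rewrite /rowsum -big_split/=; apply: ler_sum => j _; rewrite ler_norml.
have x1 : 0 <= X t.+1 i j by exact: X_ge0.
have x2 : 0 <= X t i j by apply: X_ge0; exact: ltnW.
by apply/andP; split; lra.
Qed.

Lemma rowsum_diff t i : `|rowsum t.+1 i - rowsum t i| <= travel t i.
Proof. by rewrite /rowsum -sumrB; exact: ler_norm_sum. Qed.

Lemma hsum_diff t i : (t < N)%N -> `|hsum t.+1 i - hsum t i| <= travel t i / 4.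
Proof.
move=> tN; rewrite /hsum -sumrB; apply: le_trans (ler_norm_sum _ _ _) _.
rewrite /travel mulr_suml; apply: ler_sum => j _.
have tN' := ltnW tN.
by apply: h_lip; [exact: X_ge0|exact: X_leP|exact: X_ge0|exact: X_leP].
Qed.

Lemma travel_sqr t i : (t < N)%N -> travel t i ^+ 2 <= scale * modsum t i.
Proof.
move=> tN; have tN' := ltnW tN.
pose u j := K1 * (w j + 6 * X t.+1 i j + 6 * X t i j).
have u0 j : 0 < u j.
  by rewrite mulr_gt0// -addrA ltr_wpDr// addr_ge0 ?mulr_ge0 ?X_ge0.
have := cauchy_weighted (fun j => `|X t.+1 i j - X t i j|) u0.
have -> : \sum_j `|X t.+1 i j - X t i j| ^+ 2 / u j = modsum t i.
  by apply: eq_bigr => j _; rewrite -normrX ger0_norm ?sqr_ge0.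
move/le_trans; apply; apply: ler_wpM2r; first exact: modsum_ge0.
rewrite /u -mulr_sumr; apply: ler_wpM2l; first exact: ltW.
rewrite !big_split/= -!mulr_sumr.
have := rowsum_bound0 i tN; have := rowsum_bound0 i tN'; rewrite /rowsum.
by have := w_sum; lra.
Qed.

Lemma zbar_ge0 : 0 <= zbar.
Proof. by apply: mulr_ge0 => //; exact: overload_rho_ge0. Qed.

Lemma hhsum_zbar t i : (t <= N)%N -> `|hhsum t i - hsum t i| <= zbar.
Proof.
move=> tN; apply: le_trans (hhsum_close i tN) _; apply: ler_wpM2l => //.
exact: rowsum_bound0.
Qed.

(** What [pred_load] tries to anticipate: the actual row sums instead of the repeated ones, and the
    exact [h] of the same round. *)
Definition lag t i : R := load t i - hsum t i.

Lemma load_step t i : load t.+1 i = load t i + rowsum t.+1 i.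
Proof. by rewrite /load big_ord_recr. Qed.

Lemma lag_pred t i : (t < N)%N -> `|lag t.+1 i - pred_load t.+1 i| <= 5 / 4 * travel t i + zbar.
Proof.
move=> tN; have := rowsum_diff t i; have := hsum_diff i tN; have := hhsum_zbar i (ltnW tN).
rewrite /lag load_step /= !ler_norml => /andP[a1 a2] /andP[b1 b2] /andP[c1 c2].
by apply/andP; split; lra.
Qed.

Definition past_travel t i : R := if t is s.+1 then travel s i else 0.
Definition past_vari t : R := if t is s.+1 then vari s else 0.

Lemma lag_pred0 t i : (t <= N)%N -> `|lag t i - pred_load t i| <= 5 / 4 * past_travel t i + zbar.
Proof.
case: t => [_|t]; last exact: lag_pred.
by rewrite /lag /load big_ord_recr big_ord0 /= rowsum0 hsum0 !subr0 addr0 normr0 mulr0 add0r zbar_ge0.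
Qed.

Lemma past_travel_le t i : (t < N)%N -> 0 <= past_travel t i <= 2 * (overload * rho).
Proof.
case: t => [_|t tN] /=; first by rewrite lexx/= mulr_ge0// overload_rho_ge0.
by rewrite travel_ge0 travel_le// ltnW.
Qed.

Lemma zbar_le : zbar <= 3 / 4 * (overload * rho).
Proof. by apply: ler_wpM2r => //; exact: overload_rho_ge0. Qed.

Lemma scale_ge0 : 0 <= scale.
Proof.
rewrite /scale; apply: mulr_ge0; first exact: ltW.
apply: mulr_ge0; first exact: ltW.
by have := overload_ge0; lra.
Qed.

Lemma vari_ge0 t : (t < N)%N -> 0 <= vari t.
Proof.
move=> tN; rewrite sumr_ge0// => l _.
by apply: mulr_ge0; [exact/ltW/weight_gt0|exact: modsum_ge0].
Qed.

Lemma past_vari_ge0 t : (t <= N)%N -> 0 <= past_vari t.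
Proof. by case: t => [|t] tN //=; exact: vari_ge0. Qed.

Lemma weighted_travel t : (t < N)%N ->
  \sum_i weight t i * travel t i ^+ 2 <= scale * vari t.
Proof.
move=> tN; rewrite /vari mulr_sumr; apply: ler_sum => i _.
rewrite [leRHS]mulrCA; apply: ler_wpM2l; first exact/ltW/weight_gt0.
exact: travel_sqr.
Qed.

Lemma weighted_past t : (t < N)%N ->
  \sum_i weight t i * past_travel t i ^+ 2 <= 4 * (scale * past_vari t).
Proof.
case: t => [_|t tN] /=.
  by rewrite big1 => [|i _]; rewrite ?expr0n /= ?mulr0.
apply: (@le_trans _ _ (4 * \sum_i weight t i * travel t i ^+ 2)).
  rewrite mulr_sumr; apply: ler_sum => i _; rewrite mulrA.
  apply: ler_wpM2r; first exact: sqr_ge0.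
  have tN' : (t <= N)%N by rewrite ltnW// ltnW.
  have [] // := @weight_ratio t i tN' (fun l => rowsum_bound0 l tN').
  by move=> l; apply: rowsum_bound0; rewrite (leq_trans (leq_pred _)).
by apply: ler_wpM2l => //; apply: weighted_travel; exact: ltnW.
Qed.

(** [lse_step] with [x] the new row sums and [z] the increment of [hsum]. The constants 13 and 19
    round up [4 * 25 / 8 + 3 / 16] and [4 * 75 / 16]; the factors 4 come from comparing weights of
    consecutive rounds. *)
Lemma potential_step t : (t < N)%N ->
  lse C (lag t.+1) <= lse C (lag t) + \sum_i weight t.+1 i * rowsum t.+1 i
    - \sum_i weight t i * (hsum t.+1 i - hsum t i)
    + C^-1 * (scale * (13 * vari t + 19 * past_vari t) + 5 * zbar ^+ 2).
Proof.
move=> tN; have tN' := ltnW tN.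
have GR := overload_rho_ge0.
have hC := C_ge_load; have hz := zbar_le.
have E i : lag t i + rowsum t.+1 i - (hsum t.+1 i - hsum t i) = lag t.+1 i.
  by rewrite /lag load_step; ring.
have d0 i : `|lag t i - (hsum t.+1 i - hsum t i) - pred_load t i|
    <= 5 / 4 * past_travel t i + zbar + travel t i / 4.
  have := lag_pred0 i tN'; have := hsum_diff i tN.
  rewrite !ler_norml => /andP[a1 a2] /andP[b1 b2].
  by apply/andP; split; lra.
have d1 i : `|lag t i + rowsum t.+1 i - (hsum t.+1 i - hsum t i) - pred_load t.+1 i|
    <= 5 / 4 * travel t i + zbar by rewrite E; exact: lag_pred.
have sq (x y : R) : `|x| <= y -> x ^+ 2 <= y ^+ 2.
  by move=> xy; rewrite -real_normK ?num_real// ler_pXn2r ?nnegrE// (le_trans _ xy).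
have D0 i : `|lag t i - (hsum t.+1 i - hsum t i) - pred_load t i| <= C / 4.
  apply: le_trans (d0 i) _; have := travel_le i tN.
  have /andP[_] := past_travel_le i tN; lra.
have D1 i : `|lag t i + rowsum t.+1 i - (hsum t.+1 i - hsum t i) - pred_load t.+1 i| <= C / 4.
  by apply: le_trans (d1 i) _; have := travel_le i tN; lra.
have := lse_step m0 C0 D0 D1.
rewrite (_ : (fun i => _) = lag t.+1); last by apply/funext => i; exact: E.
move/le_trans; apply; rewrite lerD2l; apply: ler_wpM2l; first by rewrite invr_ge0 ltW.
have wt := weighted_travel tN; have wp := weighted_past tN.
have q1 : \sum_i weight t.+1 i * (lag t i + rowsum t.+1 i - (hsum t.+1 i - hsum t i) - pred_load t.+1 i) ^+ 2
    <= 4 * (25 / 8 * \sum_i weight t i * travel t i ^+ 2) + 2 * zbar ^+ 2.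
  apply: (@le_trans _ _ (\sum_i (4 * (25 / 8 * (weight t i * travel t i ^+ 2))
      + weight t.+1 i * (2 * zbar ^+ 2)))).
    apply: ler_sum => i _.
    have [w4 _] := @weight_ratio t i tN' (fun l => rowsum_bound0 l tN')
      (fun l => rowsum_bound0 l (leq_trans (leq_pred _) tN')).
    have w1 := weight_gt0 t.+1 i.
    have s1 : (lag t i + rowsum t.+1 i - (hsum t.+1 i - hsum t i) - pred_load t.+1 i) ^+ 2
        <= 25 / 8 * travel t i ^+ 2 + 2 * zbar ^+ 2.
      apply: le_trans (sq _ _ (d1 i)) _; have := sqr_ge0 (5 / 4 * travel t i - zbar); lra.
    apply: le_trans (ler_wpM2l (ltW w1) s1) _; rewrite mulrDr lerD2r.
    have := ler_wpM2r (sqr_ge0 (travel t i)) w4; lra.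
  by rewrite big_split/= -!mulr_sumr -mulr_suml weight_sum mul1r.
have q0 : \sum_i weight t i * (lag t i - (hsum t.+1 i - hsum t i) - pred_load t i) ^+ 2
    <= 75 / 16 * \sum_i weight t i * past_travel t i ^+ 2
       + 3 / 16 * \sum_i weight t i * travel t i ^+ 2 + 3 * zbar ^+ 2.
  apply: (@le_trans _ _ (\sum_i (75 / 16 * (weight t i * past_travel t i ^+ 2)
      + 3 / 16 * (weight t i * travel t i ^+ 2) + weight t i * (3 * zbar ^+ 2)))).
    apply: ler_sum => i _; have w1 := weight_gt0 t i.
    have s1 : (lag t i - (hsum t.+1 i - hsum t i) - pred_load t i) ^+ 2
        <= 75 / 16 * past_travel t i ^+ 2 + 3 / 16 * travel t i ^+ 2 + 3 * zbar ^+ 2.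
      apply: le_trans (sq _ _ (d0 i)) _.
      have := sqr_ge0 (5 / 4 * past_travel t i - zbar).
      have := sqr_ge0 (5 / 4 * past_travel t i - travel t i / 4).
      have := sqr_ge0 (zbar - travel t i / 4); lra.
    by apply: le_trans (ler_wpM2l (ltW w1) s1) _; lra.
  by rewrite !big_split/= -!mulr_sumr -mulr_suml weight_sum mul1r.
have V0 : 0 <= scale * vari t by rewrite mulr_ge0 ?scale_ge0 ?vari_ge0.
have V1 : 0 <= scale * past_vari t by rewrite mulr_ge0 ?scale_ge0 ?past_vari_ge0.
lra.
Qed.

(** A gain contains [2 * vari]: the share [13 / 16] pays the error of its own round, and [19 / 16]
    is kept for the next round, where it returns as [past_vari]. *)
Lemma potential_sum T : (T <= N)%N ->
  lse C (lag T) + \sum_i weight T i * hsum T i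
    + \sum_(t < T) (penalized (X t.+1) + \sum_i \sum_(j < k) tau t.+1 i j * X t.+1 i j)
  <= C * ln m%:R + \sum_(t < T) gain t - 19 / 16 * past_vari T
     + C^-1 * (T%:R * (5 * zbar ^+ 2)).
Proof.
elim: T => [|T IH] TN.
  rewrite !big_ord0 !addr0 mul0r mulr0 /= mulr0 subr0 !addr0.
  rewrite (_ : lag 0 = fun=> 0); last first.
    apply/funext => i; rewrite /lag /load big_ord_recr big_ord0 /= rowsum0 hsum0; ring.
  by rewrite lse0// (big1 _ _ (fun i => _ * hsum 0 i)) ?addr0// => i _; rewrite hsum0 mulr0.
have h1 := IH (ltnW TN); have h2 := potential_step TN.
have eg : gain T = penalized (X T.+1) + \sum_i weight T.+1 i * rowsum T.+1 i
  + \sum_i \sum_(j < k) tau T.+1 i j * X T.+1 i j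
  + (\sum_i weight T.+1 i * hsum T.+1 i - \sum_i weight T i * hsum T.+1 i)
  + 2 * vari T.
  by rewrite /gain -sumrB; congr (_ + _ + _); apply: eq_bigr => i _; ring.
have e2 : \sum_i weight T i * (hsum T.+1 i - hsum T i) =
    \sum_i weight T i * hsum T.+1 i - \sum_i weight T i * hsum T i.
  by rewrite -sumrB; apply: eq_bigr => i _; ring.
rewrite !big_ord_recr/= eg -natr1 mulrDl mul1r.
rewrite e2 in h2.
have vT := vari_ge0 TN; have pT := past_vari_ge0 (ltnW TN).
have q : C^-1 * (scale * (13 * vari T + 19 * past_vari T)) <= 13 / 16 * vari T + 19 / 16 * past_vari T.
  rewrite mulrC ler_pdivrMr//.
  have : 16 * scale * (13 * vari T + 19 * past_vari T) <= C * (13 * vari T + 19 * past_vari T).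
    by apply: ler_wpM2r => //; rewrite addr_ge0 ?mulr_ge0.
  lra.
rewrite mulrDr in h2.
lra.
Qed.

Lemma regret nb : (forall i, rb i <= nb) -> forall i,
  \sum_(t < N) psisum psi (X t.+1) + load N i <=
  N%:R * (psisum psi Xb + nb + m%:R * (rho * om)) + C * ln m%:R
  + overload * rho / 4 + rho / 4 + sco_error + N%:R * (5 * zbar ^+ 2) / C.
Proof.
move=> rbn i; have h1 := potential_sum (leqnn N); have h2 := gain_le (leqnn N).
have h3 := lse_ge m0 C0 (lag N) i.
have /andP[h4 h5] := hsum_le i (leqnn N); have h6 := rowsum_bound0 i (leqnn N).
have h7 := past_vari_ge0 (leqnn N).
have h8 : 0 <= \sum_i weight N i * hsum N i.
  rewrite sumr_ge0// => l _; apply: mulr_ge0; first exact/ltW/weight_gt0.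
  by have /andP[] := hsum_le l (leqnn N).
pose SX : R := \sum_(t < N) \sum_i \sum_(j < k) tau t.+1 i j * X t.+1 i j.
pose SB : R := \sum_(t < N) \sum_i \sum_(j < k) tau t.+1 i j * Xb i j.
have h9 : \sum_(t < N) psisum psi (X t.+1) + SX <=
    \sum_(t < N) (penalized (X t.+1) + \sum_i \sum_(j < k) tau t.+1 i j * X t.+1 i j).
  by rewrite big_split/= lerD2r; apply: ler_sum => t _; exact: penalized_ge.
have h10 : \sum_(s < N) (\sum_i weight s.+1 i * rb i + \sum_i \sum_(j < k) tau s.+1 i j * Xb i j)
    <= N%:R * nb + SB.
  rewrite big_split/= lerD2r -[X in X%:R * _]card_ord mulr_natl -sumr_const.
  apply: ler_sum => s _.
  apply: (@le_trans _ _ (\sum_i weight s.+1 i * nb)); last by rewrite -mulr_suml weight_sum mul1r.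
  by apply: ler_sum => l _; apply: ler_wpM2l; [exact/ltW/weight_gt0|exact: rbn].
(* At overload prices the comparator pays at most [rho * om] more than the iterate, per row and
   round. *)
have h11 : SB - SX <= N%:R * (m%:R * (rho * om)).
  rewrite /SB /SX -sumrB -[X in X%:R * (_ * _)]card_ord mulr_natl -[leRHS]sumr_const.
  apply: ler_sum => s _; rewrite -sumrB -[X in X%:R * _]card_ord mulr_natl -[leRHS]sumr_const.
  apply: ler_sum => l _; have := tau_gap l (ltn_ord s); have := tau_ge l k (ltn_ord s) => q.
  have : 3 * rho * om <= 3 * rho * tau s.+1 l k by rewrite ler_wpM2l// mulr_ge0// ltW.
  lra.
rewrite [C^-1 * _]mulrC in h1.
have h12 : load N i = lag N i + hsum N i by rewrite /lag; ring.
rewrite h12 !mulrDr.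
move: SX SB h9 h10 h11 => SX SB h9 h10 h11.
lra.
Qed.

End Core.

(** * The regularizer *)

Section PowerCost.
Variables (R : realType) (w eta th Pm : R).
Hypotheses (w0 : 0 < w) (eta0 : 0 < eta) (eta1 : eta <= 1) (th0 : 0 < th) (th1 : th <= 1).
Hypotheses (Pm0 : 0 <= Pm) (Pm_th : (1 + Pm) `^ th <= 3).

Local Ltac slra := move: w0 eta0 eta1 th0 th1 Pm0; lra.

(** The constant is [24 = 4 * 2 * 3]: the slope of [gfun hpar] is at least [24 * q * A ^ (- th)]
    with [q >= 1 / 2] and [A ^ (- th) >= 1 / 3], so the inverse is 1/4-Lipschitz. The term with
    [eta] keeps the slope above [eta] for all arguments. *)
Definition hpar : gpar R := GPar w (24 / w) eta 0 (1 + th)^-1.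
Definition hcost : R -> R := ginv hpar.
Definition hpow (x : R) : R := w / 24 * ((1 + x / w) `^ (1 + th) - 1).

Local Notation q := ((1 + th)^-1).

Lemma hq_bounds : 2^-1 <= q <= 1.
Proof.
have t0 : 0 < 1 + th by slra.
apply/andP; split; first by rewrite lef_pV2 ?posrE//; slra.
by rewrite invf_le1//; slra.
Qed.

Lemma hpar_ok : gok hpar.
Proof.
have /andP[q1 q2] := hq_bounds.
split=> //=; first exact: ltW.
- by rewrite divr_ge0// ltW.
- by apply/andP; split=> //; slra.
Qed.

Lemma hcost_ge0 x : 0 <= hcost x. Proof. exact: ginv_ge0 hpar_ok _. Qed.
Lemma hcost0 : hcost 0 = 0. Proof. by apply: (ginv_eq0 hpar_ok); rewrite lexx. Qed.

Lemma gfun_hcost x : 0 <= x -> gfun hpar (hcost x) = x.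
Proof. by move=> x0; apply: (ginv_gfun hpar_ok). Qed.

Lemma hcost_le_imp s x : 0 <= x -> s <= hcost x -> 0 <= s -> gfun hpar s <= x.
Proof. by move=> x0 sx s0; rewrite -[leRHS](gfun_hcost x0); apply: (gfun_mono hpar_ok). Qed.

(** Expressed in [A], which is [1 + x / w] up to the [eta] term, the exponents [q - 1] and [q - 2]
    become [- th] and [- 2 th - 1]; and [A ^ th <= 3] in the relevant range. *)
Lemma hbase s x : 0 <= s -> gfun hpar s <= x ->
  exists A : R, [/\ 1 <= A, A <= 1 + x / w, A = (1 + 24 / w * s) `^ q &
    forall r, (1 + 24 / w * s) `^ r = A `^ ((1 + th) * r)].
Proof.
move=> s0 gx; set u := 1 + 24 / w * s.
have u1 : 1 <= u by rewrite lerDl mulr_ge0 ?divr_ge0// ltW.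
have /andP[q1 q2] := hq_bounds.
have t0 : 0 < 1 + th by slra.
exists (u `^ q); split => //.
- by have := ler_powR u1 (_ : 0 <= q); rewrite powRr0; apply; slra.
- have : w * (u `^ q - 1) <= x.
    apply: le_trans gx; rewrite /gfun/= addr0 -/u lerDl mulr_ge0// ltW//.
  rewrite mulrC -ler_pdivlMr//; slra.
- by move=> r; rewrite -powRrM mulrA mulVf ?mul1r// gt_eqF.
Qed.

Lemma hbase_th A x : 1 <= A -> A <= 1 + x / w -> x <= Pm * w -> 3^-1 <= A `^ (- th).
Proof.
move=> A1 Ax xP; rewrite powRN lef_pV2 ?posrE ?powR_gt0//; last slra.
apply: le_trans Pm_th; apply: ge0_ler_powR; rewrite ?nnegrE ?(ltW th0)//; try slra.
by apply: le_trans Ax _; rewrite lerD2l ler_pdivrMr.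
Qed.

Lemma hgfun1_ge s x : 0 <= s -> gfun hpar s <= x -> x <= Pm * w -> 4 <= gfun1 hpar s.
Proof.
move=> s0 gx xP; have [A [A1 Ax _ Ar]] := hbase s0 gx.
have := hbase_th A1 Ax xP.
rewrite /gfun1/= Ar.
have -> : (1 + th) * (q - 1) = - th by field; slra.
have -> : w * (24 / w) = 24 by field; rewrite gt_eqF.
move: (A `^ - th) => z z0; have /andP[q1 q2] := hq_bounds.
have := ler_pM (_ : 0 <= 2^-1) (_ : 0 <= 3^-1) q1 z0; slra.
Qed.

Lemma hgfun1_le s : 0 <= s -> gfun1 hpar s <= 25.
Proof.
move=> s0; have /andP[q1 q2] := hq_bounds.
have u1 : 1 <= 1 + 24 / w * s by rewrite lerDl mulr_ge0 ?divr_ge0// ltW.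
have : (1 + 24 / w * s) `^ (q - 1) <= 1.
  by have := ler_powR u1 (_ : q - 1 <= 0); rewrite powRr0; apply; slra.
have : 0 <= (1 + 24 / w * s) `^ (q - 1) by exact: powR_ge0.
rewrite /gfun1/=; have -> : w * (24 / w) = 24 by field; rewrite gt_eqF.
move: (_ `^ _) => z z0 z1; have q0 : 0 <= q by slra.
have := ler_pM q0 z0 q2 z1; slra.
Qed.

Lemma hcost_incr x y : x <= y -> hcost x <= hcost y.
Proof. by move=> xy; apply: (ginv_incr hpar_ok). Qed.

Lemma hcost_lip a b : 0 <= a -> a <= Pm * w -> 0 <= b -> b <= Pm * w ->
  `|hcost a - hcost b| <= `|a - b| / 4.
Proof.
wlog ab : a b / a <= b.
  move=> H a0 aP b0 bP; have [ab|/ltW ba] := leP a b; first exact: H.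
  by rewrite distrC [`|a - b|]distrC; apply: H.
move=> a0 aP b0 bP.
have hab := hcost_incr ab; have ha := hcost_ge0 a.
have [c /andP[c1 c2] E] := gfun_diff hpar_ok ha hab.
have c0 := le_trans ha c1.
have g4 : 4 <= gfun1 hpar c by apply: (@hgfun1_ge c b) => //; exact: hcost_le_imp.
rewrite !gfun_hcost// in E.
rewrite distrC [`|a - b|]distrC !ger0_norm ?subr_ge0// E.
have : 4 * (hcost b - hcost a) <= gfun1 hpar c * (hcost b - hcost a).
  by rewrite ler_wpM2r// subr_ge0.
slra.
Qed.

Lemma hcost_quarter x : 0 <= x -> x <= Pm * w -> hcost x <= x / 4.
Proof.
move=> x0 xP; have := hcost_lip x0 xP (lexx 0) (le_trans x0 xP).
by rewrite hcost0 !subr0 (ger0_norm x0) ger0_norm// hcost_ge0.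
Qed.

Lemma hcost_mid a b : 0 <= a -> a <= Pm * w -> 0 <= b -> b <= Pm * w ->
  hcost ((a + b) / 2) + (a - b) ^+ 2 / (20 ^+ 3 / th * (w + 6 * a + 6 * b))
  <= (hcost a + hcost b) / 2.
Proof.
move=> a0 aP b0 bP; set x := Num.max a b.
have x0 : 0 <= x by rewrite le_max a0.
have xP : x <= Pm * w by rewrite ge_max aP.
have wx : 0 < w + x by rewrite ltr_wpDr.
(* [16 = 576 / (4 * 9)], from [q ^+ 2 >= 1 / 4], [A ^ (- 2 th) >= 1 / 9] and [A <= 1 + x / w]. *)
pose nu := 16 * th / (w + x).
have nu0 : 0 <= nu by rewrite divr_ge0 ?mulr_ge0// ltW.
have hg2 r : 0 <= r -> r <= hcost x -> gfun2 hpar r <= - nu.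
  move=> r0 rB; have [A [A1 Ax _ Ar]] := hbase r0 (hcost_le_imp x0 rB r0).
  have A3 := hbase_th A1 Ax xP.
  have A0 : 0 < A by slra.
  rewrite /gfun2/= Ar.
  have -> : (1 + th) * (q - 2) = - th + (- th) + (-1) by field; slra.
  rewrite !powRD ?(gt_eqF A0) ?implybT// powR_inv1 ?(ltW A0)//.
  have -> : q * (q - 1) = - (th * q ^+ 2) by field; slra.
  have -> : w * (24 / w) ^+ 2 = 576 / w by field; rewrite gt_eqF.
  move: (A `^ - th) A3 => z z3.
  have /andP[q1 q2] := hq_bounds.
  have zz : 9^-1 <= z * z by have := ler_pM (_ : 0 <= 3^-1) (_ : 0 <= 3^-1) z3 z3; slra.
  have qq : 4^-1 <= q ^+ 2 by have := ler_pM (_ : 0 <= 2^-1) (_ : 0 <= 2^-1) q1 q1; slra.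
  have Ai : (1 + x / w)^-1 <= A^-1 by rewrite lef_pV2 ?posrE//; slra.
  rewrite mulrN mulNr lerN2.
  have -> : nu = 576 / w * (th * 4^-1) * (9^-1 * (1 + x / w)^-1).
    by rewrite /nu; field; rewrite !gt_eqF//= addrC.
  have x1 : 0 < 1 + x / w by rewrite ltr_wpDr// divr_ge0// ltW.
  have k0 : 0 <= 576%:R / w by apply: divr_ge0; [exact: ler0n|exact: ltW].
  move: (576%:R / w) k0 => c k0.
  have t4 : 0 <= th * 4^-1 by rewrite mulr_ge0// ltW.
  have i0 : 0 <= (1 + x / w)^-1 by rewrite invr_ge0 ltW.
  apply: ler_pM; first exact: mulr_ge0.
  - exact: mulr_ge0.
  - by apply: ler_wpM2l => //; apply: ler_wpM2l; [exact: ltW|].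
  - exact: ler_pM.
have hB : nu * hcost x <= 4 * 25.
  have h1 : hcost x <= x / 4 by exact: hcost_quarter.
  have : nu * hcost x <= nu * ((w + x) / 4) by apply: ler_wpM2l => //; slra.
  have -> : nu * ((w + x) / 4) = 4 * th by rewrite /nu; field; rewrite gt_eqF.
  slra.
have ax : a <= x by rewrite le_max lexx.
have bx : b <= x by rewrite le_max lexx orbT.
have := ginv_midpoint hpar_ok nu0 (_ : 0 < 25) hg2 (fun r r0 _ => hgfun1_le r0) hB a0 b0
  (hcost_incr ax) (hcost_incr bx).
move=> H; apply: le_trans (H _) => //; rewrite lerD2l [leRHS]mulrC.
apply: ler_wpM2l; first exact: sqr_ge0.
have w2 : 0 < w + 6 * a + 6 * b by rewrite -addrA ltr_wpDr// addr_ge0 ?mulr_ge0.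
(* With the slope bound 25 the modulus carries [16 / (8 * 25 ^ 3)], which is slightly more than
   [1 / 20 ^ 3]. *)
have -> : 25 = 5 / 4 * 20 :> R by lra.
rewrite exprMn; have z0 : 0 < 20 ^+ 3 :> R by rewrite exprn_gt0.
move: (20 ^+ 3 : R) z0 => z z0.
have -> : nu / (8 * ((5 / 4) ^+ 3 * z)) = 128 / 125 * (z / th * (w + x))^-1.
  by rewrite /nu; field; rewrite !gt_eqF.
apply: (@le_trans _ _ (z / th * (w + x))^-1).
  have zt : 0 < z / th by rewrite divr_gt0.
  rewrite lef_pV2 ?posrE; [|exact: mulr_gt0|exact: mulr_gt0].
  rewrite ler_pM2l// -addrA lerD2l /x ge_max.
  by apply/andP; split; slra.
have : 0 <= (z / th * (w + x))^-1 by rewrite invr_ge0 mulr_ge0 ?divr_ge0 ?ltW.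
by move: (_^-1) => y; lra.
Qed.

(** [hpow] inverts [gfun hpar] without its [eta] term: with [s = hcost x], [hpow (x - eta * s) = s].
    The slope of [hpow] is at most 1 in this range, so the difference is at most [eta * s]. *)
Lemma hpow_close x : 0 <= x -> x <= Pm * w -> `|hpow x - hcost x| <= eta * x.
Proof.
move=> x0 xP; set s := hcost x.
have s0 : 0 <= s := hcost_ge0 x.
have s4 : s <= x / 4 := hcost_quarter x0 xP.
have t0 : 0 < 1 + th by slra.
have Es : x = w * ((1 + 24 / w * s) `^ q - 1) + eta * s.
  by rewrite -[LHS](gfun_hcost x0) /gfun/= addr0.
set x' := x - eta * s.
have es : eta * s <= s by rewrite ler_piMl.
have es0 : 0 <= eta * s by rewrite mulr_ge0// ltW.
have x'0 : 0 <= x' by rewrite /x'; slra.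
have u1 : 0 <= 1 + 24 / w * s by rewrite addr_ge0// mulr_ge0// divr_ge0// ltW.
have hx' : hpow x' = s.
  rewrite /hpow (_ : 1 + x' / w = (1 + 24 / w * s) `^ q); last first.
    rewrite /x' Es; field; by rewrite gt_eqF.
  rewrite -powRrM mulVf ?gt_eqF// powRr1//; field; by rewrite gt_eqF.
have p0 y : 0 <= y -> 0 < 1 + w^-1 * y.
  by move=> y0; rewrite ltr_pwDl// mulr_ge0// invr_ge0 ltW.
have hpowE y : hpow y = w / 24 * ((1 + w^-1 * y) `^ (1 + th) - 1) by rewrite /hpow [y / w]mulrC.
have [c /andP[c1 c2] E] : exists2 c, x' <= c <= x &
    hpow x - hpow x' = (1 + th) / 24 * (1 + w^-1 * c) `^ th * (x - x').
  have ok : gok (GPar 0 w^-1 1 0 0 : gpar R).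
    by split => //=; [rewrite invr_ge0 ltW|rewrite lexx ler01].
  have D (y : R) : 0 <= y -> is_derive y (1 : R) hpow ((1 + th) / 24 * (1 + w^-1 * y) `^ th).
    move=> y0.
    have D := is_derive_cstmul (w / 24) (@is_derive_gpow _ _ ok (1 + th) y y0).
    have Dc : is_derive y (1 : R) (fun _ : R => - (w / 24)) 0 by exact: is_derive_cst.
    have D2 := is_derive_add D Dc.
    have -> : hpow = (fun z => w / 24 * (1 + w^-1 * z) `^ (1 + th) + - (w / 24)).
      by apply/funext => z; rewrite hpowE; ring.
    apply: (is_derive_eq D2) => /=.
    have -> : 1 + th - 1 = th by ring.
    field; by rewrite gt_eqF.
  have xx' : x' <= x by rewrite /x' gerBl.
  have [||c cI ->] := @MVT_segment R hpow (fun y => (1 + th) / 24 * (1 + w^-1 * y) `^ th) x' x xx'.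
  - by move=> y; rewrite in_itv/= => /andP[y1 _]; apply: D; exact: (ltW (le_lt_trans x'0 y1)).
  - apply: derivable_within_continuous => y; rewrite in_itv/= => /andP[y1 _].
    by have [] := D y (le_trans x'0 y1).
  by exists c => //; rewrite in_itv/= in cI.
rewrite hx' in E; rewrite E.
have c0 := le_trans x'0 c1.
have z3 : (1 + w^-1 * c) `^ th <= 3.
  apply: le_trans Pm_th; apply: ge0_ler_powR; rewrite ?nnegrE ?(ltW th0)//; try slra.
    exact/ltW/p0.
  by rewrite lerD2l mulrC ler_pdivrMr// (le_trans c2).
have z0 : 0 <= (1 + w^-1 * c) `^ th by exact: powR_ge0.
have xx : x - x' = eta * s by rewrite /x'; ring.
rewrite xx ger0_norm; last by rewrite mulr_ge0// mulr_ge0// divr_ge0// ltW.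
move: (_ `^ _) z3 z0 => z z3 z0.
have k1 : (1 + th) / 24 * z <= 1.
  have := ler_pM (_ : 0 <= (1 + th) / 24) z0 (_ : (1 + th) / 24 <= 1 / 12) z3; slra.
have k2 : (1 + th) / 24 * z * (eta * s) <= 1 * (eta * s) by apply: ler_wpM2r.
apply: le_trans k2 _; rewrite mul1r ler_wpM2l ?(ltW eta0)//; slra.
Qed.

End PowerCost.

(** * Oracle queries made of costs of the family *)

Section Pieces.
Variable R : realType.

Definition linpar (p e : R) : gpar R := GPar 0 0 p^-1 e 0.

Lemma linpar_ok p e : 0 < p -> 0 <= e -> gok (linpar p e).
Proof. by move=> p0 e0; split => //=; rewrite ?invr_gt0// lexx ler01. Qed.

Lemma ginv_linpar p e x : 0 < p -> 0 <= e -> ginv (linpar p e) x = p * Num.max (x - e) 0.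
Proof.
move=> p0 e0; have ok := linpar_ok p0 e0.
have H s : (ginv (linpar p e) x <= s) <-> (p * Num.max (x - e) 0 <= s).
  rewrite (ginvP ok) /gfun/= mul0r add0r.
  have -> : (x <= p^-1 * s + e) = (p * (x - e) <= s).
    by rewrite -lerBlDr mulrC ler_pdivlMr// mulrC.
  split=> [[s0 xs]|h]; first by rewrite maxr_pMr ?(ltW p0)// mulr0 ge_max xs.
  by move: h; rewrite maxr_pMr ?(ltW p0)// mulr0 ge_max => /andP[].
by apply/eqP; rewrite eq_le; apply/andP; split; apply/H.
Qed.

(** Rescaling the argument of [g] divides the inverse by [c] within the family; in this way the
    factor [weight / t] enters the regularizing piece. *)
Definition gscale (c : R) (P : gpar R) : gpar R := GPar (ga P) (c * gb P) (c * gd P) (ge P) (gq P).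

Lemma gscale_ok c P : 0 < c -> gok P -> gok (gscale c P).
Proof.
by move=> c0 [h1 h2 h3 h4 h5]; split => //=; [rewrite mulr_ge0// ltW|rewrite mulr_gt0].
Qed.

Lemma ginv_gscale c P x : 0 < c -> gok P -> ginv (gscale c P) x = c^-1 * ginv P x.
Proof.
move=> c0 ok; have okc := gscale_ok c0 ok.
have H s : (ginv (gscale c P) x <= s) <-> (c^-1 * ginv P x <= s).
  rewrite (ginvP okc) mulrC ler_pdivrMr// (ginvP ok) pmulr_lge0//.
  by rewrite /gfun/=; have -> : c * gb P * s = gb P * (s * c) by [ring];
    have -> : c * gd P * s = gd P * (s * c) by ring.
by apply/eqP; rewrite eq_le; apply/andP; split; apply/H.
Qed.

Lemma polylog_ge (C m : nat) : (0 < m)%N -> (0 < C)%N -> C%:R <= polylog R C m.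
Proof.
move=> m0 C0; rewrite /polylog ler_peMr// exprn_ege1// lerDl ln_ge0// ler1n//.
Qed.

(** The threshold interval [[0, 0]] forces [a = 0], and [ginv] vanishes at 0, so the infimal
    convolution is the second function alone. *)
Lemma decomposable_gcode (C m E : nat) (ps : seq (nat -> R)) :
  (0 < m)%N -> (size ps <= C)%N -> (4 ^ E <= C)%N -> (E.*2.+2 <= C)%N -> (scost gcode <= C)%N ->
  (forall l : 'I_(size ps), gok (gpar_of (tnth (in_tuple ps) l)) /\
     (gd (gpar_of (tnth (in_tuple ps) l)))^-1 <= polybd R E m) ->
  decomposable C m (fun x => \sum_(par <- ps) ginv (gpar_of par) x)
    [seq Piece 0 0 gcode gcode par | par <- ps].
Proof.
move=> m0 sC C1 C2 C3 H; split; first by rewrite size_map.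
have C0 : (0 < C)%N by rewrite (leq_trans _ C2).
have sz : size [seq Piece 0 0 gcode gcode par | par <- ps] = size ps by rewrite size_map.
pose cs l := cast_ord sz l.
exists (fun l => ginv (gpar_of (tnth (in_tuple ps) (cs l)))); split; last first.
  move=> x; rewrite (big_nth (fun=> 0)) big_mkord.
  rewrite (reindex cs)/=; last first.
    by exists (cast_ord (esym sz)) => l _; apply: val_inj.
  by apply: eq_bigr => l _; rewrite (tnth_nth (fun=> 0)).
move=> l; set par := tnth (in_tuple ps) (cs l).
have -> : tnth (in_tuple [seq Piece 0 0 gcode gcode par | par <- ps]) l = Piece 0 0 gcode gcode par.
  rewrite (tnth_nth (Piece 0 0 gcode gcode par))/= (nth_map (fun=> 0)) ?(ltn_ord (cs l))//.
  by rewrite /par (tnth_nth (fun=> 0)).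
have [ok hd] := H (cs l).
exists (ginv (gpar_of par)), (ginv (gpar_of par)).
have cc : exists2 K, K <= polylog R C m & computable C m K (ginv (gpar_of par)) gcode par.
  exists (E.*2.+2)%:R; last exact: computable_ginv.
  by apply: le_trans (polylog_ge m0 C0); rewrite ler_nat.
split => //=; first by rewrite lexx.
have g0 : ginv (gpar_of par) 0 = 0 by apply: (ginv_eq0 ok); case: ok.
move=> x; split; first by exists 0; rewrite ?lexx// g0 add0r subr0.
by move=> a /andP[a1 a2]; have -> : a = 0 by [apply/eqP; rewrite eq_le a1 a2]; rewrite g0 add0r subr0.
Qed.

End Pieces.

(** * Loops *)

Section Loops.
Variables (R : realType) (Q : Type) (ask : Q -> state R -> nat -> state R -> Prop).

(* Row 0 of the natural array 1 holds the loop counters, an inner loop using a smaller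
   column than the loops around it. *)
Definition counter (c : nat) : iexp := ICell 1 (INat 0) (INat c).

Definition keeps (c : nat) (M M' : nat -> nat -> nat -> nat) : Prop :=
  forall a i j, ~~ [&& a == 1, i == 0 & j < c]%N -> M' a i j = M a i j.

Lemma keeps_trans c M1 M2 M3 : keeps c M1 M2 -> keeps c M2 M3 -> keeps c M1 M3.
Proof. by move=> h1 h2 a i j h; rewrite h2// h1. Qed.

Lemma keepsS c M M' : keeps c M M' -> keeps c.+1 M M'.
Proof. by move=> h a i j hc; apply: h; apply: contra hc => /and3P[-> -> jc]; rewrite ltnS ltnW. Qed.

Lemma keeps_upd c M v : keeps c.+1 M (upd M 1 0 c v).
Proof.
move=> a i j; rewrite /upd; case: ifP => // /and3P[/eqP-> /eqP-> /eqP->].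
by rewrite !eqxx ltnSn.
Qed.

Definition incr (c : nat) : cmd Q := SetI 1 (INat 0) (INat c) (IAdd (counter c) (INat 1)).

(** The invariant [I] speaks of the real memory only, the natural memory being described by [keeps].
    The test [b] is arbitrary because the main loop stops on a comparison of reals. *)
Lemma exec_count (c n0 : nat) (b : bexp) (body : cmd Q) (I : nat -> (nat -> nat -> nat -> R) -> Prop)
    (T : nat -> nat) (s : state R) :
  (forall i s1, keeps c.+1 (imem s) (imem s1) -> imem s1 1 0 c = i -> I i (rmem s1) ->
     (i <= n0)%N -> beval s1 b = (i < n0)%N) ->
  (forall i s1, (i < n0)%N -> keeps c.+1 (imem s) (imem s1) -> imem s1 1 0 c = i ->
     I i (rmem s1) -> exists n s2, [/\ exec ask body s1 n s2, (n <= T i)%N,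
       keeps c (imem s1) (imem s2) & I i.+1 (rmem s2)]) ->
  imem s 1 0 c = 0%N -> I 0%N (rmem s) ->
  exists n s2, [/\ exec ask (While b (Seq body (incr c))) s n s2,
    (n <= \sum_(i < n0) (T i + (bcost b + 20)) + (bcost b).+1)%N,
    keeps c.+1 (imem s) (imem s2), imem s2 1 0 c = n0 & I n0 (rmem s2)].
Proof.
move=> Hb Hbody c0 I0.
suff H d : forall i s1, (i + d = n0)%N -> keeps c.+1 (imem s) (imem s1) -> imem s1 1 0 c = i ->
    I i (rmem s1) ->
  exists n s2, [/\ exec ask (While b (Seq body (incr c))) s1 n s2,
    (n <= \sum_(i <= l < n0) (T l + (bcost b + 20)) + (bcost b).+1)%N,
    keeps c.+1 (imem s) (imem s2), imem s2 1 0 c = n0 & I n0 (rmem s2)].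
  have [n [s2 H']] := H n0 0%N s (add0n _) (fun _ _ _ _ => erefl) c0 I0.
  by exists n, s2; rewrite big_mkord in H'.
elim: d => [|d IH] i s1 idn k1 ci Ii.
  have -> : n0 = i by rewrite -idn addn0.
  exists (bcost b).+1, s1; split=> //; last by rewrite leq_addl.
  apply: EWhileF; rewrite (Hb i)//; first by rewrite -idn addn0 ltnn.
  by rewrite -idn leq_addr.
have il : (i < n0)%N by rewrite -idn -addSnnS leq_addr.
have [n1 [s2 [e1 l1 k2 I2]]] := Hbody i s1 il k1 ci Ii.
have ci2 : imem s2 1 0 c = i by rewrite k2// ltnn andbF.
set s3 := State (upd (imem s2) 1 0 c i.+1) (rmem s2).
have k3 : keeps c.+1 (imem s) (imem s3).
  by apply: keeps_trans k1 _; apply: keeps_trans (keepsS k2) _; exact: keeps_upd.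
have c3 : imem s3 1 0 c = i.+1 by rewrite /s3/= /upd !eqxx.
have idn' : (i.+1 + d = n0)%N by rewrite addSnnS.
have [n [s4 [e4 l4 k4 c4 I4]]] := IH i.+1 s3 idn' k3 c3 I2.
have ei : exec ask (incr c) s2 (icost (INat 0) + icost (INat c) + icost (IAdd (counter c) (INat 1))).+1 s3.
  have := @ESetI _ _ ask 1 (INat 0) (INat c) (IAdd (counter c) (INat 1)) s2.
  by rewrite /= ci2 (addn1 i); apply.
eexists; exists s4; split; [apply: EWhileT (ESeq e1 ei) e4| |exact: k4|exact: c4|exact: I4].
  by rewrite (Hb i)//; exact: ltnW.
rewrite big_ltn//=; move: l1 l4; lia.
Qed.

Definition For (c b : nat) (body : cmd Q) : cmd Q :=
  Seq (SetI 1 (INat 0) (INat c) (INat 0))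
    (While (BLeI (IAdd (counter c) (INat 1)) (ICell 0 (INat 0) (INat b))) (Seq body (incr c))).

Lemma exec_for (c b n0 : nat) (body : cmd Q) (I : nat -> (nat -> nat -> nat -> R) -> Prop)
    (T : nat -> nat) (s : state R) :
  imem s 0 0 b = n0 ->
  (forall i s1, (i < n0)%N -> keeps c.+1 (imem s) (imem s1) -> imem s1 1 0 c = i ->
     I i (rmem s1) -> exists n s2, [/\ exec ask body s1 n s2, (n <= T i)%N,
       keeps c (imem s1) (imem s2) & I i.+1 (rmem s2)]) ->
  I 0%N (rmem s) ->
  exists n s2, [/\ exec ask (For c b body) s n s2,
    (n <= \sum_(i < n0) (T i + 30) + 20)%N,
    keeps c.+1 (imem s) (imem s2) & I n0 (rmem s2)].
Proof.
move=> sb Hbody I0.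
set s0 := State (upd (imem s) 1 0 c 0%N) (rmem s).
have k0 : keeps c.+1 (imem s) (imem s0) by exact: keeps_upd.
have [||||n [s2 [e l k2 _ I2]]] := @exec_count c n0
  (BLeI (IAdd (counter c) (INat 1)) (ICell 0 (INat 0) (INat b))) body I T s0.
- move=> i s1 k1 ci _ _; rewrite /= ci k1// /s0/= /upd/= sb addn1; done.
- by move=> i s1 il k1; apply: Hbody => //; exact: keeps_trans k1.
- by rewrite /s0/= /upd !eqxx.
- by [].
have e0 : exec ask (SetI 1 (INat 0) (INat c) (INat 0)) s 4 s0 by exact: ESetI.
exists (4 + n).+1, s2; split=> //; first exact: ESeq e0 e.
  apply: leq_trans (_ : (5 + (\sum_(i < n0) (T i + 30) + 11) <= _)%N); last by lia.
  rewrite -addSn leq_add2l; apply: leq_trans l _ => /=.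
  by apply: leq_add => //; apply: leq_sum => i _; rewrite leq_add2l.
exact: keeps_trans k2.
Qed.

Lemma run_setR a ei ej e (l : seq (cmd Q)) (s : state R) (Post : state R -> Prop) :
  (forall v s', v = reval s e -> imem s' = imem s ->
    (forall a' i' j', rmem s' a' i' j' =
       if [&& a' == a, i' == ieval s ei & j' == ieval s ej] then v else rmem s a' i' j') ->
    Post (run (block l) s')) ->
  Post (run (block (SetR a ei ej e :: l)) s).
Proof. by move=> H; exact: (H (reval s e)). Qed.

Lemma run_ifR a ei ej b e1 e2 (l : seq (cmd Q)) (s : state R) (Post : state R -> Prop) :
  (forall v s', v = (if beval s b then reval s e1 else reval s e2) -> imem s' = imem s ->
    (forall a' i' j', rmem s' a' i' j' =
       if [&& a' == a, i' == ieval s ei & j' == ieval s ej] then v else rmem s a' i' j') ->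
    Post (run (block l) s')) ->
  Post (run (block (If b (SetR a ei ej e1) (SetR a ei ej e2) :: l)) s).
Proof.
by move=> H; rewrite /=; case: ifP => bs;
  apply: (H (if beval s b then reval s e1 else reval s e2)); rewrite // bs.
Qed.

End Loops.

(** * The program *)

Definition ci := counter 0.
Definition cj := counter 1.
Definition ct := counter 2.
Definition vec (a : nat) : rexp := RCell a ci (INat 0).
Definition cvec (a : nat) : rexp := RCell a cj (INat 0).
Definition mat (a : nat) : rexp := RCell a ci cj.
Definition scal (n : nat) : rexp := rc 2 n.
Definition setv (a : nat) (e : rexp) : cmd query := SetR a ci (INat 0) e.
Definition setrow (a l : nat) (e : rexp) : cmd query := SetR a ci (INat l) e.
Definition setm (a : nat) (e : rexp) : cmd query := SetR a ci cj e.
Definition sets (n : nat) (e : rexp) : cmd query := SetR 2 (INat 0) (INat n) e.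
Definition tnext : rexp := RNat (IAdd ct (INat 1)).

(* Real arrays: 1 sum of the iterates, 2 scalars (in row 0), 3 loads of the rows, 4 predicted
   next row sums, 6 weights, 8 overload prices, 9 cumulated prices, 10 to 12 data of the linear,
   the regularizing and the hinge piece, 13 answer of the oracle, 14 column sums of the first
   answers, 15 widths of the columns. *)
Definition body_exp : cmd query := block [::
  setv 6 (RExp (RDiv (RAdd (vec 3) (vec 4)) (scal 7)));
  sets 9 (RAdd (scal 9) (vec 6))].

Definition body_norm : cmd query := block [::
  setv 6 (RDiv (vec 6) (scal 9));
  setv 4 (rnat 0);
  setv 8 (scal 3)].

Definition body_pieces : cmd query := block [::
  setm 9 (RAdd (mat 9) (RAdd (vec 6) (vec 8)));
  setrow 10 4 (RDiv tnext (mat 9));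
  setrow 11 2 (cvec 15);
  setrow 11 3 (RDiv (RMul (rnat 24) tnext) (RMul (vec 6) (cvec 15)));
  setrow 11 4 (RDiv (RMul (scal 6) tnext) (vec 6))].

Definition hpow_code (w x : rexp) : rexp :=
  RMul (RDiv w (rnat 24))
    (RSub (rpow (RAdd (rnat 1) (RDiv x w)) (RAdd (rnat 1) (scal 5))) (rnat 1)).

Definition tau_code : rexp :=
  RMul (vec 8) (RAdd (rnat 1) (RDiv (vec 13) (RMul (rnat 4) (scal 0)))).

Definition body_update : cmd query := block [::
  setm 1 (RAdd (mat 1) (vec 13));
  setv 3 (RAdd (vec 3) (vec 13));
  setv 4 (RAdd (vec 4) (RSub (vec 13) (hpow_code (cvec 15) (vec 13))));
  If (BLeR tau_code (scal 4)) (setv 8 tau_code) (setv 8 (scal 4))].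

(** * Effect and cost of the loops over the rows *)

Section Bodies.
Variables (R : realType) (Q : Type) (m k : nat) (O : 'I_k -> oracle R m).
Notation mem := (nat -> nat -> nat -> R).
Notation ex := (exec (ask O)).

Definition agree (d : nat -> nat -> nat -> bool) (M M' : mem) : Prop :=
  forall a i l, ~~ d a i l -> M' a i l = M a i l.

Lemma straight_step (c : cmd query) s (P : state R -> Prop) : straight c -> P (run c s) ->
  exists n s2, [/\ ex c s n s2, (n <= scost c)%N & P s2].
Proof. by move=> sc Pc; have [n e l] := exec_straight (ask O) s sc; exists n, (run c s). Qed.

Lemma loop_exp s : imem s 0 0 0 = m ->
  let u (M : mem) l := expR ((M 3 l 0%N + M 4 l 0%N) / M 2 0%N 7) in
  exists n s', [/\ ex (For 0 0 body_exp) s n s', (n <= m * (scost body_exp + 30) + 20)%N,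
    keeps 1 (imem s) (imem s') &
    [/\ agree (fun a i l => ((a == 6) && (l == 0)) || [&& a == 2, i == 0 & l == 9]) (rmem s) (rmem s'),
      forall l, (l < m)%N -> rmem s' 6 l 0 = u (rmem s) l &
      rmem s' 2 0 9 = rmem s 2 0 9 + \sum_(l < m) u (rmem s) l]].
Proof.
move=> sm u; set M0 := rmem s.
have [||n [s' [e l k1 [h1 h2 h3]]]] := @exec_for _ _ (ask O) 0 0 m body_exp (fun i M =>
   [/\ agree (fun a i l => ((a == 6) && (l == 0)) || [&& a == 2, i == 0 & l == 9]) M0 M,
      forall l, (l < i)%N -> M 6 l 0%N = u M0 l &
      M 2 0%N 9%N = M0 2 0%N 9%N + \sum_(l < i) u M0 l]) (fun=> scost body_exp) s sm; last first.
- exists n, s'; split=> //.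
  by rewrite sum_nat_const card_ord in l.
- by split=> [|//|]; [|rewrite big_ord0 addr0].
move=> i s1 im k1 si [H1 H2 H3].
pose Post (s2 : state R) := imem s2 = imem s1 /\
   [/\ agree (fun a i l => ((a == 6) && (l == 0)) || [&& a == 2, i == 0 & l == 9]) M0 (rmem s2),
      forall l, (l < i.+1)%N -> rmem s2 6 l 0%N = u M0 l &
      rmem s2 2 0%N 9%N = M0 2 0%N 9%N + \sum_(l < i.+1) u M0 l].
suff [n [s2 [e l [P1 P2]]]] : exists n s2, [/\ ex body_exp s1 n s2, (n <= scost body_exp)%N & Post s2].
  exists n, s2; split=> //; by move=> a i' j' _; rewrite P1.
apply: straight_step => //; rewrite /body_exp.
apply: run_setR => v0 t0 E0 I0 M1; rewrite /= si !H1// -/(u M0 i) in E0 M1.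
apply: run_setR => v1 t1 E1 I1 M2; rewrite /= I0 si !M1/= H3 E0 !eqxx/= in E1 M2.
split; first by rewrite /= I1 I0.
split.
- by move=> a i' l h; rewrite /= M2 M1; move: h; rewrite negb_or !negb_and;
   case: ifP => [/and3P[/eqP-> /eqP-> /eqP->]//|_]; case: ifP => [/and3P[/eqP-> /eqP-> /eqP->]//|_] h; rewrite H1// negb_or !negb_and.
- move=> l li; rewrite /= M2/= M1/= andbT; case: eqP => [->//|/eqP ne]; apply: H2; lia.
- by rewrite /= M2/= E1 big_ord_recr/= addrA.
Qed.

Lemma loop_norm s : imem s 0 0 0 = m ->
  exists n s', [/\ ex (For 0 0 body_norm) s n s', (n <= m * (scost body_norm + 30) + 20)%N,
    keeps 1 (imem s) (imem s') &
    [/\ agree (fun a i l => (a \in [:: 4; 6; 8]%N) && (l == 0)%N) (rmem s) (rmem s'),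
      forall l, (l < m)%N -> rmem s' 6 l 0 = rmem s 6 l 0 / rmem s 2 0 9,
      forall l, (l < m)%N -> rmem s' 4 l 0 = 0 &
      forall l, (l < m)%N -> rmem s' 8 l 0 = rmem s 2 0 3]].
Proof.
move=> sm; set M0 := rmem s.
(* Array 6 is overwritten in place, so the invariant must also fix the values of the rows not yet
   visited. *)
pose J i (M : mem) := [/\ agree (fun a i l => (a \in [:: 4; 6; 8]%N) && (l == 0)%N) M0 M,
      forall l, M 6 l 0%N = if (l < i)%N then M0 6 l 0%N / M0 2 0%N 9 else M0 6 l 0%N,
      forall l, (l < i)%N -> M 4 l 0%N = 0 &
      forall l, (l < i)%N -> M 8 l 0%N = M0 2 0%N 3].
have [||n [s' [e l k1 [h1 h2 h3 h4]]]] := @exec_for _ _ (ask O) 0 0 m body_norm J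
  (fun=> scost body_norm) s sm; last first.
- exists n, s'; split=> //; first by rewrite sum_nat_const card_ord in l.
  by split=> // l' lm; rewrite h2 lm.
- by split.
move=> i s1 im k1 si [H1 H2 H3 H4].
pose Post (s2 : state R) := imem s2 = imem s1 /\ J i.+1 (rmem s2).
suff [n [s2 [e l [P1 P2]]]] : exists n s2, [/\ ex body_norm s1 n s2, (n <= scost body_norm)%N & Post s2].
  exists n, s2; split=> //; by move=> a i' j' _; rewrite P1.
apply: straight_step => //; rewrite /body_norm.
apply: run_setR => v0 t0 E0 I0 M1; rewrite /= si H2 ltnn !H1//= in E0 M1.
apply: run_setR => v1 t1 E1 I1 M2; rewrite /= I0 si /= in E1 M2.
apply: run_setR => v2 t2 E2 I2 M3; rewrite /= I1 I0 si !M2/= !M1/= !H1//= in E2 M3.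
split; first by rewrite /= I2 I1 I0.
split.
- move=> a i' l h; rewrite /= M3 M2 M1.
  by do 3 (case: ifP => [/and3P[/eqP ? /eqP ? /eqP ?]|_]; first by subst); exact: H1.
- move=> l; rewrite /= M3/= M2/= M1/= andbT ltnS; case: ltngtP => [li|li|li].
  + by rewrite H2 li.
  + by rewrite H2 ltnNge (ltnW li).
  + by rewrite ?li; exact: E0.
- move=> l; rewrite /= M3/= M2/= M1/= andbT ltnS; case: ltngtP => [li _|//|li _]; last by rewrite ?li; exact: E1.
  exact: H3.
- move=> l; rewrite /= M3/= M2/= M1/= andbT ltnS; case: ltngtP => [li _|//|li _]; last by rewrite ?li; exact: E2.
  exact: H4.
Qed.

Lemma loop_pieces s t j : imem s 0 0 0 = m -> imem s 1 0 2 = t -> imem s 1 0 1 = j ->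
  let Qn (M : mem) l := M 9 l j + (M 6 l 0%N + M 8 l 0%N) in
  exists n s', [/\ ex (For 0 0 body_pieces) s n s', (n <= m * (scost body_pieces + 30) + 20)%N,
    keeps 1 (imem s) (imem s') &
    [/\ agree (fun a i l => [|| (a == 9) && (l == j), (a == 10) && (l == 4) |
         (a == 11) && (l \in [:: 2; 3; 4])]%N) (rmem s) (rmem s'),
      forall l, (l < m)%N -> rmem s' 9 l j = Qn (rmem s) l,
      forall l, (l < m)%N -> rmem s' 10 l 4 = t.+1%:R / Qn (rmem s) l &
      forall l, (l < m)%N -> [/\ rmem s' 11 l 2 = rmem s 15 j 0,
        rmem s' 11 l 3 = 24 * t.+1%:R / (rmem s 6 l 0 * rmem s 15 j 0) &
        rmem s' 11 l 4 = rmem s 2 0 6 * t.+1%:R / rmem s 6 l 0]]].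
Proof.
move=> sm st sj Qn; set M0 := rmem s.
pose J i (M : mem) := [/\ agree (fun a i l => [|| (a == 9) && (l == j), (a == 10) && (l == 4) |
         (a == 11) && (l \in [:: 2; 3; 4])]%N) M0 M,
      forall l, M 9 l j = if (l < i)%N then Qn M0 l else M0 9 l j,
      forall l, (l < i)%N -> M 10 l 4 = t.+1%:R / Qn M0 l &
      forall l, (l < i)%N -> [/\ M 11 l 2 = M0 15 j 0%N,
        M 11 l 3 = 24 * t.+1%:R / (M0 6 l 0%N * M0 15 j 0%N) &
        M 11 l 4 = M0 2 0%N 6 * t.+1%:R / M0 6 l 0%N]].
have [||n [s' [e l k1 [h1 h2 h3 h4]]]] := @exec_for _ _ (ask O) 0 0 m body_pieces J
  (fun=> scost body_pieces) s sm; last first.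
- exists n, s'; split=> //; first by rewrite sum_nat_const card_ord in l.
  by split=> // l' lm; rewrite h2 lm.
- by split.
move=> i s1 im k1 si [H1 H2 H3 H4].
have t1' : imem s1 1 0 2 = t by rewrite k1.
have j1 : imem s1 1 0 1 = j by rewrite k1.
pose Post (s2 : state R) := imem s2 = imem s1 /\ J i.+1 (rmem s2).
suff [n [s2 [e l [P1 P2]]]] : exists n s2, [/\ ex body_pieces s1 n s2, (n <= scost body_pieces)%N & Post s2].
  exists n, s2; split=> //; by move=> a i' j' _; rewrite P1.
apply: straight_step => //; rewrite /body_pieces.
apply: run_setR => v0 t0 E0 I0 M1; rewrite /= si j1 H2 ltnn !H1//= -/(Qn M0 i) in E0 M1.
apply: run_setR => v1 t1 E1 I1 M2; rewrite /= I0 si j1 t1' !M1 /= !eqxx/= E0 addn1 in E1 M2.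
apply: run_setR => v2 t2 E2 I2 M3; rewrite /= I1 I0 si j1 !M2/= !M1 /= !H1//= in E2 M3.
apply: run_setR => v3 t3 E3 I3 M4; rewrite /= I2 I1 I0 si j1 t1' !M3/= !M2/= !M1 /= !H1//= addn1 in E3 M4.
apply: run_setR => v4 t4 E4 I4 M5; rewrite /= I3 I2 I1 I0 si t1' !M4/= !M3/= !M2/= !M1 /= !H1//= addn1 in E4 M5.
split; first by rewrite /= I4 I3 I2 I1 I0.
split.
- move=> a i' l h; rewrite /= M5 M4 M3 M2 M1.
  by do 5 (case: ifP => [/and3P[/eqP ? /eqP ? /eqP ?]|_]; first by subst; rewrite !eqxx ?orbT in h); exact: H1.
- move=> l; rewrite /= M5/= M4/= M3/= M2/= M1/= eqxx andbT ltnS; case: ltngtP => [li|li|li].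
  + by rewrite H2 li.
  + by rewrite H2 ltnNge (ltnW li).
  + by rewrite ?li; exact: E0.
- move=> l; rewrite /= M5/= M4/= M3/= M2/= M1/= andbT ltnS; case: ltngtP => [li _|//|li _]; last by rewrite ?li; exact: E1.
  exact: H3.
- move=> l; rewrite /= !M5/= !M4/= !M3/= !M2/= !M1/= !andbT !andbF ltnS; case: ltngtP => [li _|//|-> _] //.
  exact: H4.
Qed.

Lemma loop_update s j : imem s 0 0 0 = m -> imem s 1 0 1 = j ->
  let tn (M : mem) l := M 8 l 0%N * (1 + M 13 l 0%N / (4 * M 2 0%N 0%N)) in
  let hp (M : mem) l := M 15 j 0%N / 24 *
    (expR ((1 + M 2 0%N 5) * ln (1 + M 13 l 0%N / M 15 j 0%N)) - 1) in
  exists n s', [/\ ex (For 0 0 body_update) s n s', (n <= m * (scost body_update + 30) + 20)%N,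
    keeps 1 (imem s) (imem s') &
    [/\ agree (fun a i l => (a == 1) && (l == j) || (a \in [:: 3; 4; 8]) && (l == 0))%N (rmem s) (rmem s'),
      forall l, (l < m)%N -> rmem s' 1 l j = rmem s 1 l j + rmem s 13 l 0,
      forall l, (l < m)%N -> rmem s' 3 l 0 = rmem s 3 l 0 + rmem s 13 l 0,
      forall l, (l < m)%N -> rmem s' 4 l 0 = rmem s 4 l 0 + (rmem s 13 l 0 - hp (rmem s) l) &
      forall l, (l < m)%N -> rmem s' 8 l 0 = Num.min (tn (rmem s) l) (rmem s 2 0 4)]].
Proof.
move=> sm sj tn hp; set M0 := rmem s.
pose J i (M : mem) := [/\ agree (fun a i l => (a == 1) && (l == j) || (a \in [:: 3; 4; 8]) && (l == 0))%N M0 M,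
      forall l, M 1 l j = if (l < i)%N then M0 1 l j + M0 13 l 0%N else M0 1 l j,
      forall l, M 3 l 0%N = if (l < i)%N then M0 3 l 0%N + M0 13 l 0%N else M0 3 l 0%N,
      forall l, M 4 l 0%N = if (l < i)%N then M0 4 l 0%N + (M0 13 l 0%N - hp M0 l) else M0 4 l 0%N &
      forall l, M 8 l 0%N = if (l < i)%N then Num.min (tn M0 l) (M0 2 0%N 4) else M0 8 l 0%N].
have [||n [s' [e l k1 [h1 h2 h3 h4 h5]]]] := @exec_for _ _ (ask O) 0 0 m body_update J
  (fun=> scost body_update) s sm; last first.
- exists n, s'; split=> //; first by rewrite sum_nat_const card_ord in l.
  by split=> // l' lm; rewrite ?h2 ?h3 ?h4 ?h5 lm.
- by split.
move=> i s1 im k1 si [H1 H2 H3 H4 H5].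
have j1 : imem s1 1 0 1 = j by rewrite k1.
pose Post (s2 : state R) := imem s2 = imem s1 /\ J i.+1 (rmem s2).
suff [n [s2 [e l [P1 P2]]]] : exists n s2, [/\ ex body_update s1 n s2, (n <= scost body_update)%N & Post s2].
  exists n, s2; split=> //; by move=> a i' j' _; rewrite P1.
apply: straight_step => //; rewrite /body_update.
apply: run_setR => v0 t0 E0 I0 M1; rewrite /= si j1 H2 ltnn !H1//= in E0 M1.
apply: run_setR => v1 t1 E1 I1 M2; rewrite /= I0 si !M1 /= H3 ltnn !H1//= in E1 M2.
apply: run_setR => v2 t2 E2 I2 M3; rewrite /= I1 I0 si j1 !M2/= !M1 /= H4 ltnn !H1//= -/(hp M0 i) in E2 M3.
apply: run_ifR => v3 t3 E3 I3 M4; rewrite /= I2 I1 I0 si !M3/= !M2/= !M1 /= H5 ltnn !H1//= -/(tn M0 i) -minEle in E3 M4.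
split; first by rewrite /= I3 I2 I1 I0.
split.
- move=> a i' l h; rewrite /= M4 M3 M2 M1.
  by do 4 (case: ifP => [/and3P[/eqP ? /eqP ? /eqP ?]|_]; first by subst; rewrite !eqxx ?orbT in h); exact: H1.
- move=> l; rewrite /= M4/= M3/= M2/= M1/= eqxx andbT ltnS; case: ltngtP => [li|li|li].
  + by rewrite H2 li.
  + by rewrite H2 ltnNge (ltnW li).
  + by rewrite ?li; exact: E0.
- move=> l; rewrite /= M4/= M3/= M2/= M1/= andbT ltnS; case: ltngtP => [li|li|li].
  + by rewrite H3 li.
  + by rewrite H3 ltnNge (ltnW li).
  + by rewrite ?li; exact: E1.
- move=> l; rewrite /= M4/= M3/= M2/= M1/= andbT ltnS; case: ltngtP => [li|li|li].
  + by rewrite H4 li.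
  + by rewrite H4 ltnNge (ltnW li).
  + by rewrite ?li; exact: E2.
- move=> l; rewrite /= M4/= M3/= M2/= M1/= andbT ltnS; case: ltngtP => [li|li|li].
  + by rewrite H5 li.
  + by rewrite H5 ltnNge (ltnW li).
  + by rewrite ?li; exact: E3.
Qed.
End Bodies.

Definition query_on (L : seq nat) : query := MkQuery cj [seq (a, gcode, gcode) | a <- L] 13.

(** * One oracle query *)

Section Oracles.
Variables (R : realType) (m k Cn E : nat) (XX : 'I_k -> set 'cV[R]_m) (psi : 'I_k -> 'cV[R]_m -> R).
Variables (dsco : R) (O : 'I_k -> oracle R m).
Notation ex := (exec (ask O)).
Hypotheses (m0 : (0 < m)%N) (Cn3 : (3 <= Cn)%N) (CnE : (4 ^ E <= Cn)%N) (CnE2 : (E.*2.+2 <= Cn)%N).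
Hypothesis Cng : (scost gcode <= Cn)%N.
Hypothesis sco : forall j, is_sco Cn (XX j) (psi j) dsco (O j).

Definition row_par (M : nat -> nat -> nat -> R) (a i l : nat) : R := M a i l.+2.

Lemma exec_query L s (j : 'I_k) : imem s 1 0 1 = j -> (size L <= 3)%N ->
  (forall (i : 'I_m) a, a \in L -> [/\ rmem s a i 0 = 0, rmem s a i 1 = 0,
     gok (gpar_of (row_par (rmem s) a i)) &
     (gd (gpar_of (row_par (rmem s) a i)))^-1 <= polybd R E m]) ->
  exists n s' (xh : 'cV[R]_m), [/\ ex (Query (query_on L)) s n s', (n <= oracle_time (O j) + 5)%N,
    imem s' = imem s,
    agree (fun a i l => (a == 13) && (l == 0))%N (rmem s) (rmem s') &
    [/\ forall i : 'I_m, rmem s' 13 i 0 = xh i 0, XX j xh &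
      forall x, XX j x ->
      psi j xh + \sum_(i < m) \sum_(a <- L) ginv (gpar_of (row_par (rmem s) a i)) (xh i 0) <=
      psi j x + \sum_(i < m) \sum_(a <- L) ginv (gpar_of (row_par (rmem s) a i)) (x i 0) + dsco]].
Proof.
move=> sj sL HL; set M := rmem s.
set xh := oracle_answer (O j) (query_desc s (query_on L)).
pose s' := State (imem s) (fun a i l => match insub i : option 'I_m with
                             | Some i' => if (a == 13) && (l == 0)%N
                                          then xh i' 0 else rmem s a i l
                             | None => rmem s a i l
                             end).
exists (icost cj + oracle_time (O j)).+1, s', xh; split=> //.
- by apply: EQuery; exists j; rewrite /= sj.
- by rewrite /= addnC !addnS.
- move=> a i l h; rewrite /s'/=; case: insub => // i'.
  by rewrite (negbTE h).
have D : forall i : 'I_m, decomposable Cn m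
    (fun x => \sum_(par <- [seq row_par M a i | a <- L]) ginv (gpar_of par) x)
    (query_desc s (query_on L) i).
  move=> i.
  have -> : query_desc s (query_on L) i =
      [seq Piece 0 0 gcode gcode par | par <- [seq row_par M a i | a <- L]].
    rewrite /query_desc /query_on/= -!map_comp; apply/eq_in_map => a aL /=.
    by have [-> -> _ _] := HL i a aL.
  apply: (decomposable_gcode (E := E)) => //; first by rewrite size_map (leq_trans sL).
  move=> l; rewrite (tnth_nth (fun=> 0))/=.
  have ll : (l < size L)%N by rewrite -(size_map (fun a => row_par M a i)).
  by rewrite (nth_map 0%N)//; have [_ _] := HL i _ (mem_nth 0%N ll).
have [Xxh opt] := @sco j _ _ D.
split => //; first by move=> i; rewrite /s'/= valK.
have E' (y : 'cV[R]_m) :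
    \sum_(i < m) \sum_(par <- [seq row_par M a i | a <- L]) ginv (gpar_of par) (y i 0) =
    \sum_(i < m) \sum_(a <- L) ginv (gpar_of (row_par M a i)) (y i 0).
  by apply: eq_bigr => i _; rewrite big_map.
by move=> x Xx; have := opt x Xx; rewrite !E'.
Qed.

End Oracles.

Definition column_code : cmd query :=
  Seq (For 0 0 body_pieces) (Seq (Query (query_on [:: 10; 11; 12]%N)) (For 0 0 body_update)).

(* The cells that the main loop may modify. *)
Definition dyn (a i l : nat) : bool :=
  [|| a \in [:: 1; 3; 4; 6; 8; 9; 13], [&& a == 2, i == 0 & l == 9],
    (a == 10) && (l == 4) | (a == 11) && (l \in [:: 2; 3; 4])]%N.

Lemma tau_seq_eq (R : realType) (rho Mt om : R) u v j :
  (forall l, (l < j)%N -> u l = v l) -> tau_seq rho om Mt u j = tau_seq rho om Mt v j.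
Proof.
elim: j => //= j IH uv; rewrite IH => [|l lj]; last by apply: uv; exact: ltnW.
by rewrite uv.
Qed.

(** The weights, prices and column costs of a round are determined by earlier iterates, except that
    a price also sees earlier columns of its own round. An invariant over the sequence of iterates
    thus survives the appending of a matrix. *)
Lemma eq_history (R : realType) (m k : nat) (rho C om Mt Mh : R) (h hh : 'I_k -> R -> R)
    (X X' : nat -> 'M[R]_(m, k)) t : (forall s, (s <= t)%N -> X' s = X s) ->
  [/\ forall i, load X' t i = load X t i, weight C hh X' t.+1 =1 weight C hh X t.+1,
      forall i j, price rho C om Mt hh X' t i j = price rho C om Mt hh X t i j &
      forall s j i z, (s < t)%N ->
        colcost rho C om Mt Mh h hh X' s.+1 j i z = colcost rho C om Mt Mh h hh X s.+1 j i z].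
Proof.
move=> XX'.
have r s i : (s <= t)%N -> rowsum X' s i = rowsum X s i by move=> st; rewrite /rowsum XX'.
have l s i : (s <= t)%N -> load X' s i = load X s i.
  move=> st; apply: eq_bigr => u _; apply: r; rewrite (leq_trans _ st)// -ltnS.
  exact: ltn_ord.
have w s : (s <= t)%N -> weight C hh X' s.+1 =1 weight C hh X s.+1.
  move=> st i; rewrite /weight (_ : pred_load hh X' s.+1 = pred_load hh X s.+1)//.
  by apply/funext => i'; rewrite /pred_load l// r// /hhsum XX'.
have ta s i j : (s <= t)%N -> tau rho om Mt X' s i j = tau rho om Mt X s i j.
  by move=> st; apply: tau_seq_eq => u _; rewrite /entry XX'.
have p s i j : (s <= t)%N -> price rho C om Mt hh X' s i j = price rho C om Mt hh X s i j.
  move=> st; apply: eq_bigr => u _; rewrite w ?ta//.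
    by rewrite (leq_trans _ st)// ltn_ord.
  by rewrite (leq_trans _ st)// ltnW// ltn_ord.
split => //.
- by move=> i; exact: l.
- exact: w.
- by move=> i j; exact: p.
- by move=> s j i z st; rewrite /colcost p// w// ltnW.
Qed.

(** * One round of the main loop *)

Section Iteration.
Variables (R : realType) (m k Cn E : nat) (XX : 'I_k -> set 'cV[R]_m) (psi : 'I_k -> 'cV[R]_m -> R).
Variables (dsco : R) (O : 'I_k -> oracle R m).
Notation ex := (exec (ask O)).
Notation mem := (nat -> nat -> nat -> R).
Hypotheses (m0 : (0 < m)%N) (Cn3 : (3 <= Cn)%N) (CnE : (4 ^ E <= Cn)%N) (CnE2 : (E.*2.+2 <= Cn)%N).
Hypothesis Cng : (scost gcode <= Cn)%N.
Hypothesis sco : forall j, is_sco Cn (XX j) (psi j) dsco (O j).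
Hypothesis XX_ge0 : forall j x, XX j x -> forall i, 0 <= x i 0.
Variables (rho C om Mt Mh th eta : R) (M0 : mem).
Hypotheses (rho0 : 0 < rho) (C0 : 0 < C) (om0 : 0 < om) (omM : om <= Mt) (Mh0 : 0 < Mh).
Hypotheses (th0 : 0 < th) (th1 : th <= 1) (eta0 : 0 < eta) (eta1 : eta <= 1).
Hypotheses (MtE : 1 + Mt <= polybd R E m) (etaE : eta^-1 <= polybd R E m) (MhE : Mh <= polybd R E m).
Notation wn l := (M0 15%N l 0%N).
Hypothesis wn0 : forall l, (l < k)%N -> 0 < wn l.

Definition setup : Prop :=
  [/\ [/\ M0 2 0%N 0%N = rho, M0 2 0%N 3 = om & M0 2 0%N 4 = Mt],
      [/\ M0 2 0%N 5 = th, M0 2 0%N 6 = eta & M0 2 0%N 7 = C],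
      forall i, (i < m)%N -> [/\ M0 10 i 0%N = 0 /\ M0 10 i 1%N = 0, M0 10 i 2 = 0, M0 10 i 3 = 0,
        M0 10 i 5 = 0 & M0 10 i 6 = 0],
      forall i, (i < m)%N -> [/\ M0 11 i 0%N = 0, M0 11 i 1%N = 0,
        M0 11 i 5 = 0 & M0 11 i 6 = 1 / (1 + th)] &
      forall i, (i < m)%N -> [/\ M0 12 i 0%N = 0 /\ M0 12 i 1%N = 0, M0 12 i 2 = 0 /\ M0 12 i 3 = 0,
        M0 12 i 4 = 1 / Mh, M0 12 i 5 = rho & M0 12 i 6 = 0]].
Hypothesis M0_setup : setup.

Definition hj (j : 'I_k) : R -> R := hcost (wn j) eta th.
Definition hhj (j : 'I_k) : R -> R := hpow (wn j) th.

Section Column.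
Variables (t : nat) (y : 'I_m -> R) (out Q : 'I_m -> 'I_k -> R) (S : 'I_m -> R).
Hypotheses (y0 : forall i, 0 < y i) (y1 : forall i, y i <= 1).
Hypothesis Q_bound : forall i j, 0 <= Q i j <= t%:R * (1 + Mt).

Definition ctau (Y : nat -> 'cV[R]_m) i j := tau_seq rho om Mt (fun l => Y l i 0) j.

Definition ccost (Y : nat -> 'cV[R]_m) (j : 'I_k) (i : 'I_m) (z : R) : R :=
  (Q i j + (y i + ctau Y i j)) / t.+1%:R * z + y i / t.+1%:R * hj j z + Mh * hinge rho z.

Definition copt (Y : nat -> 'cV[R]_m) (j : 'I_k) : Prop := XX j (Y j) /\ forall x, XX j x ->
  psi j (Y j) + \sum_(i < m) ccost Y j i (Y j i 0) <= psi j x + \sum_(i < m) ccost Y j i (x i 0) + dsco.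

(** State within a round when the columns below [j] are done: [Y] collects the answers of the round;
    [out], [S] and [Q] are the contents of arrays 1, 3 and 9 at its start. *)
Definition colinv (j : nat) (M : mem) : Prop := agree dyn M0 M /\ exists Y : nat -> 'cV[R]_m,
  [/\ forall l i, 0 <= Y l i 0,
    forall l : 'I_k, (l < j)%N -> copt Y l,
    forall (i : 'I_m) (l : 'I_k), M 1%N i l = out i l + (if (l < j)%N then Y l i 0 else 0),
    forall i : 'I_m, M 3 i 0%N = S i + \sum_(l < j) Y l i 0 /\
      M 4 i 0%N = \sum_(l < j) (Y l i 0 - hpow (wn l) th (Y l i 0)) &
    [/\ forall i : 'I_m, M 8 i 0%N = ctau Y i j,
      forall (i : 'I_m) (l : 'I_k), M 9 i l = Q i l + (if (l < j)%N then y i + ctau Y i l else 0) &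
      forall i : 'I_m, M 6 i 0%N = y i]].

Lemma ctau_bounds (Y : nat -> 'cV[R]_m) i j : (forall l i, 0 <= Y l i 0) -> om <= ctau Y i j <= Mt.
Proof.
move=> Y0; have [//] := @tau_bounds _ om Mt rho (fun l => Y l i 0)
  (tau_seq rho om Mt (fun l => Y l i 0))
  om0 omM rho0 (fun l => Y0 l i) erefl (fun=> erefl) j.
Qed.

Lemma column_step s (j : 'I_k) : imem s 0 0 0 = m -> imem s 1 0 2 = t -> imem s 1 0 1 = j ->
  colinv j (rmem s) ->
  exists n s', [/\ ex column_code s n s',
    (n <= m * (scost body_pieces + 30) + 20 + (m * (scost body_update + 30) + 20) + oracle_time (O j) + 7)%N,
    keeps 1 (imem s) (imem s') & colinv j.+1 (rmem s')].
Proof.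
move=> sm st sj [agr [Y [Y0 Yopt H1 H34 [H8 H9 H6]]]].
have [[sc0 sc3 sc4] [sc5 sc6 sc7] r10 r11 r12] := M0_setup.
have [n1 [s1 [e1 l1 k1 [a1 P9 P10 P11]]]] := loop_pieces O sm st sj.
have w0 := wn0 (ltn_ord j).
have st2 a i l : ~~ dyn a i l -> rmem s a i l = M0 a i l by exact: agr.
have st1 a i l : ~~ dyn a i l -> rmem s1 a i l = M0 a i l.
  move=> h; rewrite a1 ?st2//; apply: contra h => /or3P[/andP[/eqP-> _]//|h'|h'];
    by rewrite /dyn h' ?orbT.
pose q i : R := (Q i j + (y i + ctau Y i j)) / t.+1%:R.
have t0 : 0 < t.+1%:R :> R by rewrite ltr0n.
have q0 i : 0 < q i.
  have /andP[tb _] := ctau_bounds i j Y0; have /andP[qb _] := Q_bound i j; have := y0 i => yi.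
  rewrite divr_gt0// ltr_wpDl// addr_gt0//; exact: lt_le_trans tb.
have qE i : q i <= polybd R E m.
  apply: le_trans MtE; have /andP[_ tb] := ctau_bounds i j Y0.
  have /andP[_ qb] := Q_bound i j; have := y1 i => yi.
  rewrite ler_pdivrMr// -natr1; lra.
have Qn (i : 'I_m) : rmem s 9 i j + (rmem s 6 i 0 + rmem s 8 i 0) = Q i j + (y i + ctau Y i j).
  by rewrite H9 H6 H8 ltnn addr0.
have p10 (i : 'I_m) : gpar_of (row_par (rmem s1) 10 i) = linpar (q i) 0.
  have [_ e2 e3 e5 e6] := r10 i (ltn_ord i).
  by rewrite /gpar_of /row_par/= P10// Qn !st1// e2 e3 e5 e6 /linpar /q invf_div.
have p12 (i : 'I_m) : gpar_of (row_par (rmem s1) 12 i) = linpar Mh rho.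
  have [_ [e2 e3] e4 e5 e6] := r12 i (ltn_ord i).
  by rewrite /gpar_of /row_par/= !st1// e2 e3 e4 e5 e6 /linpar div1r.
have p11 (i : 'I_m) : gpar_of (row_par (rmem s1) 11 i) = gscale (t.+1%:R / y i) (hpar (wn j) eta th).
  have [_ _ e5 e6] := r11 i (ltn_ord i); have [e2 e3 e4] := P11 i (ltn_ord i).
  rewrite /gpar_of /row_par/= e2 e3 e4 !st1// e5 e6 H6 !st2// sc6 /gscale /hpar/=; congr GPar.
  - by field; rewrite !gt_eqF// y0.
  - by field; rewrite gt_eqF// y0.
  - by rewrite div1r.
have ok (i : 'I_m) : gok (gscale (t.+1%:R / y i) (hpar (wn j) eta th)).
  by apply: gscale_ok; [rewrite divr_gt0|exact: hpar_ok].
have sj1 : imem s1 1 0 1 = j by rewrite k1.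
have [i a|n2 [s2 [xh [e2 l2 im2 a2 [x2 Xxh opt]]]]] :=
  exec_query (L := [:: 10; 11; 12]%N) m0 Cn3 CnE CnE2 Cng sco sj1 isT.
  rewrite !inE => /or3P[] /eqP ->; [rewrite p10|rewrite p11|rewrite p12].
  - have [[z0 z1] _ _ _ _] := r10 i (ltn_ord i); rewrite !st1//; split=> //; last by rewrite /= invrK.
    exact: linpar_ok.
  - have [z0 z1 _ _] := r11 i (ltn_ord i); rewrite !st1//; split=> //.
    apply: le_trans etaE; rewrite /= lef_pV2 ?posrE//; last by rewrite mulr_gt0// divr_gt0.
    by rewrite ler_peMl ?(ltW eta0)// ler_pdivlMr// mul1r (le_trans (y1 i))// ler1n.
  - have [[z0 z1] _ _ _ _] := r12 i (ltn_ord i); rewrite !st1//; split=> //; last by rewrite /= invrK.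
    by apply: linpar_ok => //; exact: ltW.
have pieceE (x : 'cV[R]_m) : XX j x ->
    \sum_(i < m) \sum_(a <- [:: 10; 11; 12]%N) ginv (gpar_of (row_par (rmem s1) a i)) (x i 0) =
    \sum_(i < m) ccost Y j i (x i 0).
  move=> Xx; apply: eq_bigr => i _; rewrite !big_cons big_nil addr0 p10 p11 p12.
  have x0 := XX_ge0 Xx i.
  rewrite !ginv_linpar// ?(ltW rho0)// subr0 (max_idPl x0).
  rewrite ginv_gscale//; [|by rewrite divr_gt0|exact: hpar_ok].
  by rewrite /ccost invf_div addrA.
have sm2 : imem s2 0 0 0 = m by rewrite im2 k1.
have sj2 : imem s2 1 0 1 = j by rewrite im2.
have [n3 [s3 [e3 l3 k3 [a3 U1 U3 U4 U8]]]] := loop_update O sm2 sj2.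
exists (n1 + (n2 + n3).+1).+1, s3; split.
- exact: ESeq e1 (ESeq e2 e3).
- by move: (m * _)%N (m * _)%N (oracle_time _) l1 l2 l3 => A B D; clear; lia.
- by move=> a i l h; rewrite k3// im2 k1.
have st3 a i l : ~~ dyn a i l -> rmem s2 a i l = M0 a i l.
  move=> h; rewrite a2 ?st1//; apply: contra h => /andP[/eqP-> _] //.
split.
  move=> a i l h; rewrite a3 ?st3//; apply: contra h => /orP[] /andP[].
    by move=> /eqP->.
  by rewrite !inE => /or3P[] /eqP->.
have o2 (i : 'I_m) l : rmem s2 1 i l = rmem s 1 i l by rewrite a2// a1.
have o3 (i : 'I_m) a : a \in [:: 3; 4; 6; 8]%N -> rmem s2 a i 0 = rmem s a i 0.
  by rewrite !inE => /or4P[] /eqP->; rewrite a2// a1.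
(* Inserting the answer for column [j] changes no price of index at most [j], since [tau_seq] at [l]
   reads entries below [l] only. *)
pose Y' (l : nat) : 'cV[R]_m := if l == j :> nat then xh else Y l.
have Y'j : Y' j = xh by rewrite /Y' eqxx.
have Y'l l : (l < j)%N -> Y' l = Y l by rewrite /Y'; case: ltngtP.
have ct i l : (l <= j)%N -> ctau Y' i l = ctau Y i l.
  by move=> lj; apply: tau_seq_eq => l' l'l; rewrite Y'l// (leq_trans l'l).
exists Y'; split.
- by move=> l i; rewrite /Y'; case: ifP => // _; exact: XX_ge0 Xxh _.
- move=> l; rewrite ltnS => lj.
  have E1 (x : 'cV[R]_m) : \sum_(i < m) ccost Y' l i (x i 0) = \sum_(i < m) ccost Y l i (x i 0).
    by apply: eq_bigr => i _; rewrite /ccost ct.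
  have [l'j|] := ltnP l j.
    have [Xl optl] := Yopt l l'j; rewrite /copt Y'l//; split=> // x Xx.
    by rewrite !E1; exact: optl.
  move=> jl; have -> : l = j by apply/val_inj/eqP; rewrite eqn_leq lj jl.
  rewrite /copt Y'j; split=> // x Xx; have := opt x Xx; rewrite !pieceE//.
  have E2 (z : 'cV[R]_m) : \sum_(i < m) ccost Y' j i (z i 0) = \sum_(i < m) ccost Y j i (z i 0).
    by apply: eq_bigr => i _; rewrite /ccost ct.
  by rewrite !E2.
- move=> i l; rewrite ltnS.
  have [lj|lj|/val_inj lj] := ltngtP (l : nat) j.
  + have ne : (l == j :> nat) = false by rewrite ltn_eqF.
    by rewrite a3 /= ?ne// o2 H1 lj Y'l.
  + have ne : (l == j :> nat) = false by rewrite gtn_eqF.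
    by rewrite a3 /= ?ne// o2 H1 ltnNge (ltnW lj).
  + by rewrite lj U1// o2 H1 ltnn addr0 Y'j x2.
- move=> i; rewrite U3// U4// (o3 i 3%N)// (o3 i 4%N)//; have [-> ->] := H34 i.
  rewrite !big_ord_recr/= Y'j x2 addrA; split.
    by congr (_ + _ + _); apply: eq_bigr => l _; rewrite Y'l.
  congr (_ + _); first by apply: eq_bigr => l _; rewrite Y'l.
  rewrite !st3// sc5; congr (_ - _); rewrite /hpow /powR gt_eqF//.
  by rewrite ltr_pwDl// divr_ge0 ?(ltW w0)// (XX_ge0 Xxh).
split.
- move=> i; rewrite U8// (o3 i 8%N)// H8 x2 (st3 2%N 0%N 0%N)// (st3 2%N 0%N 4%N)// sc0 sc4 {2}/ctau/= -/(ctau Y' i j) ct//.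
  by rewrite -Y'j.
- move=> i l; rewrite ltnS.
  have o9 : rmem s3 9 i l = rmem s1 9 i l by rewrite a3// a2.
  rewrite o9; have [lj|lj|/val_inj lj] := ltngtP (l : nat) j.
  + have ne : (l == j :> nat) = false by rewrite ltn_eqF.
    by rewrite a1 /= ?ne// H9 lj ct// ltnW.
  + have ne : (l == j :> nat) = false by rewrite gtn_eqF.
    by rewrite a1 /= ?ne// H9 ltnNge (ltnW lj).
  + by rewrite lj P9// Qn ct.
- by move=> i; rewrite a3// (o3 i 6%N)// H6.
Qed.

End Column.

Definition iteration_code : cmd query :=
  Seq (sets 9 (rnat 0)) (Seq (For 0 0 body_exp) (Seq (For 0 0 body_norm) (For 1 1 column_code))).

Definition run_of (T : nat) (X : nat -> 'M[R]_(m, k)) : Prop :=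
  [/\ X 0%N = 0, forall t, (t < T)%N -> colprod XX (X t.+1) &
      forall t j x, (t < T)%N -> XX j x ->
        psi j (col j (X t.+1)) + \sum_i colcost rho C om Mt Mh hj hhj X t.+1 j i (X t.+1 i j)
        <= psi j x + \sum_i colcost rho C om Mt Mh hj hhj X t.+1 j i (x i 0) + dsco].

Definition maininv (t : nat) (M : mem) : Prop := agree dyn M0 M /\
  exists X, run_of t X /\
  [/\ forall (i : 'I_m) (j : 'I_k), M 1%N i j = \sum_(s < t) X s.+1 i j,
      forall i : 'I_m, M 3 i 0%N = load X t i,
      forall i : 'I_m, M 4 i 0%N = rowsum X t i - hhsum hhj X t i &
      forall (i : 'I_m) (j : 'I_k), M 9 i j = price rho C om Mt hhj X t i j].

Definition column_time : nat :=
  (m * (scost body_pieces + 30) + 20 + (m * (scost body_update + 30) + 20) + 37)%N.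

Definition iteration_time : nat :=
  (m * (scost body_exp + 30) + m * (scost body_norm + 30) + 100
   + \sum_(j < k) (column_time + oracle_time (O j)))%N.

Lemma price_bound t X i j : run_of t X ->
  0 <= price rho C om Mt hhj X t i j <= t%:R * (1 + Mt).
Proof.
move=> [X0 Xin _].
have tb s : (s < t)%N -> om <= tau rho om Mt X s.+1 i j <= Mt.
  move=> st; have e0 l : 0 <= entry X s.+1 i l.
    rewrite /entry; case: insubP => // l' _ _.
    by have := XX_ge0 (Xin s st l') i; rewrite mxE.
  by have [] := @tau_bounds _ om Mt rho _ (tau_seq rho om Mt (entry X s.+1 i))
    om0 omM rho0 e0 erefl (fun=> erefl) j.
have w0 s : 0 < weight C hhj X s i by exact: softmax_gt0.
have w1 s : weight C hhj X s i <= 1.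
  have <- := softmax_sum1 C m0 (pred_load hhj X s).
  rewrite (bigD1 i)//= lerDl sumr_ge0// => l _; exact/ltW/softmax_gt0.
apply/andP; split.
  rewrite sumr_ge0// => s _; have /andP[h _] := tb s (ltn_ord s).
  by rewrite addr_ge0 ?(ltW (w0 _))// (le_trans _ h)// ltW.
rewrite -[X in X%:R]card_ord mulr_natl -sumr_const; apply: ler_sum => s _.
by have /andP[_ h] := tb s (ltn_ord s); rewrite lerD.
Qed.

Lemma iteration_step s t : imem s 0 0 0 = m -> imem s 0 0 1 = k -> imem s 1 0 2 = t ->
  maininv t (rmem s) ->
  exists n s', [/\ ex iteration_code s n s', (n <= iteration_time)%N,
    keeps 2 (imem s) (imem s') & maininv t.+1 (rmem s')].
Proof.
move=> sm sk st [agr [X [Xrun [H1 H3 H4 H9]]]].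
have [[sc0 sc3 sc4] [sc5 sc6 sc7] _ _ _] := M0_setup.
have [X0 Xin Xopt] := Xrun.
set s1 := State (imem s) (upd (rmem s) 2 0 9 0).
have e1 : ex (sets 9 (rnat 0)) s 5 s1.
  by have := @ESetR R query (ask O) 2 (INat 0) (INat 9) (rnat 0) s.
have r1 a i l : ~~ [&& a == 2, i == 0 & l == 9]%N -> rmem s1 a i l = rmem s a i l.
  by move=> h; rewrite /s1/= /upd (negbTE h).
have [n2 [s2 [e2 l2 k2 [a2 E2 Z2]]]] := loop_exp O (s := s1) sm.
have sm2 : imem s2 0 0 0 = m by rewrite k2.
have [n3 [s3 [e3 l3 k3 [a3 N6 N4 N8]]]] := loop_norm O sm2.
pose y i := weight C hhj X t.+1 i.
have st3 a i l : ~~ dyn a i l -> rmem s3 a i l = M0 a i l.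
  move=> h; rewrite a3 ?a2 ?r1 ?agr//; apply: contra h => h'; rewrite /dyn.
  - by rewrite h' !orbT.
  - by case/orP: h' => [/andP[/eqP-> _]|->]; rewrite ?orbT.
  - by case/andP: h'; rewrite !inE => /or3P[]/eqP->.
have yE (i : 'I_m) : rmem s3 6 i 0 = y i.
  rewrite N6// E2// Z2 /y /weight /softmax /=.
  have u (l : 'I_m) : (rmem s1 3 l 0 + rmem s1 4 l 0) / rmem s1 2 0 7 =
      (load X t l + rowsum X t l - hhsum hhj X t l) / C.
    by rewrite !r1// (agr 2%N 0%N 7%N)// sc7 H3 H4 addrA.
  rewrite u; congr (_ / _); rewrite /s1/= /upd/= add0r /expsum.
  by apply: eq_bigr => l _; have := u l; rewrite /s1/= /upd/= => ->.
have y0 i : 0 < y i by exact: softmax_gt0.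
have y1 i : y i <= 1.
  have <- := softmax_sum1 C m0 (pred_load hhj X t.+1).
  rewrite (bigD1 i)//= lerDl sumr_ge0// => l _; exact/ltW/softmax_gt0.
pose out (i : 'I_m) (j : 'I_k) := \sum_(s < t) X s.+1 i j.
pose QQ i j := price rho C om Mt hhj X t i j.
have QQb i j : 0 <= QQ i j <= t%:R * (1 + Mt) by exact: price_bound.
pose J := colinv t y out QQ (load X t).
have st' : imem s3 1 0 2 = t by rewrite k3// k2.
have sk3 : imem s3 0 0 1 = k by rewrite k3// k2.
have sm3 : imem s3 0 0 0 = m by rewrite k3// k2.
(* [exec_for] charges 30 steps per iteration by itself; they are taken off in advance. *)
pose T l := (column_time - 30 + if insub l is Some j then oracle_time (O j) else 0)%N.
have [||n5 [s5 [e5 l5 k5 [agr5 [Y [Y0 Yopt V1 V34 [V8 V9 V6]]]]]]] :=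
  exec_for (ask := ask O) (c := 1) (body := column_code) (I := J) (T := T) sk3.
- move=> j s4 jk k4 j4 J4.
  have st4 : imem s4 1 0 2 = t by rewrite k4.
  have sm4 : imem s4 0 0 0 = m by rewrite k4.
  have [n [s5 [e l kk JJ]]] := column_step y0 y1 QQb sm4 st4 (j := Ordinal jk) j4 J4.
  exists n, s5; split=> //; apply: leq_trans l _; rewrite /T insubT /column_time.
  by move: (m * _)%N (m * _)%N (oracle_time _) => A B D; clear; lia.
- split; first by move=> a i l h; exact: st3.
  exists (fun=> 0); split.
  + by move=> l i; rewrite mxE.
  + by [].
  + by move=> i l; rewrite addr0 a3// a2// r1// H1.
  + by move=> i; rewrite !big_ord0 addr0 N4// a3// a2// r1// H3.
  split.
  + by move=> i; rewrite N8// a2// r1// agr// sc3.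
  + by move=> i l; rewrite addr0 a3// a2// r1// H9.
  + by move=> i; exact: yE.
pose X' u : 'M[R]_(m, k) := if u == t.+1 then \matrix_(i, j) Y j i 0 else X u.
have X't : X' t.+1 = \matrix_(i, j) Y j i 0 by rewrite /X' eqxx.
have X'X u : (u <= t)%N -> X' u = X u by move=> ut; rewrite /X' ltn_eqF.
have [HL HW HP HC] := eq_history rho C om Mt Mh hj hhj X'X.
have tE i (j : nat) : (j <= k)%N -> tau rho om Mt X' t.+1 i j = ctau Y i j.
  move=> jk; apply: tau_seq_eq => l lj; rewrite /entry X't.
  by have lk := leq_trans lj jk; rewrite insubT mxE.
have cE j i z : colcost rho C om Mt Mh hj hhj X' t.+1 j i z = ccost t y QQ Y j i z.
  rewrite /colcost /ccost /price big_ord_recr/= -/(price rho C om Mt hhj X' t i j) HP HW.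
  by rewrite tE// ltnW.
have colE j : col j (X' t.+1) = Y j.
  by apply/matrixP => i l; rewrite !mxE X't mxE ord1.
exists (5 + (n2 + (n3 + n5).+1).+1).+1, s5; split.
- exact: ESeq e1 (ESeq e2 (ESeq e3 e5)).
- rewrite /iteration_time.
  have ET : (\sum_(i < k) (T i + 30) <= \sum_(j < k) (column_time + oracle_time (O j)))%N.
    apply: leq_sum => j _; rewrite /T valK /column_time.
    by move: (m * _)%N (m * _)%N (oracle_time _) => A B D; clear; lia.
  move: (leq_trans l5 (leq_add ET (leqnn 20))) l2 l3.
  move: (m * _)%N (m * _)%N (\sum_(j < k) _)%N => A B D; clear; lia.
- move=> a i l h; rewrite k5// k3 ?k2//; apply: contra h => /and3P[-> -> lt]; exact: leq_trans lt _.
split=> //; exists X'; split; last split.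
- split; first by rewrite X'X.
  + move=> u; rewrite ltnS leq_eqVlt => /orP[/eqP-> j|ut j].
      by rewrite colE; have [] := Yopt j (ltn_ord j).
    by rewrite X'X//; exact: Xin.
  + move=> u j x; rewrite ltnS leq_eqVlt => /orP[/eqP->|ut] Xx.
      have [_ opt] := Yopt j (ltn_ord j); rewrite colE.
      under eq_bigr do rewrite cE X't mxE.
      under [X in _ <= _ + X + _]eq_bigr do rewrite cE.
      exact: opt.
    rewrite X'X//; under eq_bigr do rewrite HC//.
    under [X in _ <= _ + X + _]eq_bigr do rewrite HC//.
    exact: Xopt.
- move=> i j; rewrite V1 ltn_ord big_ord_recr/= X't mxE; congr (_ + _).
  by apply: eq_bigr => u _; rewrite X'X// ltn_ord.
- move=> i; have [-> _] := V34 i.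
  rewrite load_step HL; congr (_ + _).
  by rewrite /rowsum; apply: eq_bigr => j _; rewrite X't mxE.
- move=> i; have [_ ->] := V34 i; rewrite sumrB; congr (_ - _).
    by rewrite /rowsum; apply: eq_bigr => j _; rewrite X't mxE.
  by rewrite /hhsum; apply: eq_bigr => j _; rewrite X't mxE.
- move=> i j; rewrite V9 ltn_ord /price big_ord_recr/= -/(price rho C om Mt hhj X' t i j) HP HW.
  by rewrite tE// ltnW.
Qed.

End Iteration.

Section Program.
Variables eo et eh eP ee eC eK : nat.

Definition prelude : cmd query :=
  let rho := rc 0 0 in let eps := rc 0 1 in let delta := rc 0 2 in
  let logsize := scal 2 in
  block [::
    If (BLeR eps (rnat 1)) (sets 1 eps) (sets 1 (rnat 1));
    If (BLeR rho delta) (sets 0 delta) (sets 0 rho);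
    sets 2 (RLn (RNat (IAdd (ICell 0 (INat 0) (INat 0)) (INat 1))));
    sets 3 (RExp (RSub (rnat 0) (RMul (rnat eo) logsize)));
    sets 4 (RExp (RMul (rnat et) logsize));
    sets 11 (RExp (RMul (rnat eh) logsize));
    sets 5 (RDiv (rnat 1) (RMul (rnat eP) logsize));
    sets 6 (RExp (RSub (rnat 0) (RMul (rnat ee) logsize)));
    sets 7 (RMul (RMul (rnat eC) (RMul logsize logsize)) (scal 0));
    sets 8 (RMul (rnat eK) (RMul logsize (RMul logsize logsize)))].

Definition body_init : cmd query := block [::
  setrow 10 4 (RDiv (rnat 2) (scal 3));
  setrow 11 6 (RDiv (rnat 1) (RAdd (rnat 1) (scal 5)));
  setrow 12 4 (RDiv (rnat 1) (scal 11));
  setrow 12 5 (scal 0)].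

Definition body_sum : cmd query := block [:: SetR 14 cj (INat 0) (RAdd (cvec 14) (vec 13))].

Definition first_column : cmd query :=
  Seq (Query (query_on [:: 10%N])) (Seq (For 0 0 body_sum) (sets 10 (RAdd (scal 10) (cvec 14)))).

Definition body_width : cmd query := block [::
  SetR 15 cj (INat 0) (RMul (scal 0) (RDiv (RAdd (RDiv (cvec 14) (scal 10))
    (RDiv (rnat 1) (RNat (ICell 0 (INat 0) (INat 1))))) (rnat 2)))].

(** Reals cannot be converted to naturals, so the number of rounds is not computed: the loop
    compares [t * accuracy] with a real bound. *)
Definition guard : bexp := BLeR (RMul (RNat ct) (scal 1)) (scal 8).

Definition body_average : cmd query := block [:: setm 1 (RDiv (mat 1) (RNat ct))].

Definition regression_code : algorithm :=
  Seq prelude (Seq (For 0 0 body_init) (Seq (For 1 1 first_column) (Seq (For 1 1 body_width)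
    (Seq (While guard (Seq iteration_code (incr query 2))) (For 1 1 (For 0 0 body_average)))))).

(** * The whole program *)

Section Correct.
Variables (R : realType) (m k Cn E : nat) (XX : 'I_k -> set 'cV[R]_m) (psi : 'I_k -> 'cV[R]_m -> R).
Variables (rho eps delta dsco : R) (O : 'I_k -> oracle R m).
Notation ex := (exec (ask O)).
Notation mem := (nat -> nat -> nat -> R).
Hypotheses (m0 : (0 < m)%N) (k0 : (0 < k)%N).
Hypotheses (Cn3 : (3 <= Cn)%N) (CnE : (4 ^ E <= Cn)%N) (CnE2 : (E.*2.+2 <= Cn)%N).
Hypothesis Cng : (scost gcode <= Cn)%N.
Hypothesis sco : forall j, is_sco Cn (XX j) (psi j) dsco (O j).
Hypothesis XX_ge0 : forall j x, XX j x -> forall i, 0 <= x i 0.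
Hypotheses (rho0 : 0 < rho) (eps0 : 0 < eps).

Definition logsize : R := ln (m.+1)%:R.
(** [rho] has no lower bound, whereas prices and slopes are fixed powers of [m + 1]. Since [delta]
    is at least an inverse polynomial, so is the maximum, and [delta] also pays for the enlargement,
    see [error_radius]. *)
Definition radius : R := Num.max rho delta.
Definition accuracy : R := Num.min eps 1.
Definition base_price : R := expR (- (eo%:R * logsize)).
Definition cap_price : R := expR (et%:R * logsize).
Definition hinge_slope : R := expR (eh%:R * logsize).
Definition theta : R := 1 / (eP%:R * logsize).
Definition barrier_slope : R := expR (- (ee%:R * logsize)).
Definition temperature : R := eC%:R * (logsize * logsize) * radius.
Definition rounds : R := eK%:R * (logsize * (logsize * logsize)).

Hypotheses (th0 : 0 < theta) (th1 : theta <= 1) (CC0 : 0 < temperature) (Kc0 : 0 <= rounds).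
Hypotheses (MtE : 1 + cap_price <= polybd R E m) (etaE : barrier_slope^-1 <= polybd R E m) (MhE : hinge_slope <= polybd R E m).

Lemma logsize_ge0 : 0 <= logsize. Proof. by rewrite ln_ge0// ler1n. Qed.
Lemma radius_gt0 : 0 < radius. Proof. by rewrite lt_max rho0. Qed.
Lemma accuracy_gt0 : 0 < accuracy. Proof. by rewrite lt_min eps0 ltr01. Qed.
Lemma base_price_gt0 : 0 < base_price. Proof. exact: expR_gt0. Qed.
Lemma barrier_slope_gt0 : 0 < barrier_slope. Proof. exact: expR_gt0. Qed.
Lemma hinge_slope_gt0 : 0 < hinge_slope. Proof. exact: expR_gt0. Qed.
Lemma base_price_le1 : base_price <= 1.
Proof. by rewrite -expR0 ler_expR oppr_le0 mulr_ge0// logsize_ge0. Qed.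
Lemma barrier_slope_le1 : barrier_slope <= 1.
Proof. by rewrite -expR0 ler_expR oppr_le0 mulr_ge0// logsize_ge0. Qed.
Lemma cap_price_ge1 : 1 <= cap_price.
Proof. by rewrite -expR0 ler_expR mulr_ge0// logsize_ge0. Qed.

Definition prelude_mem (M : mem) : Prop :=
  [/\ [/\ M 2 0%N 0%N = radius, M 2 0%N 1%N = accuracy, M 2 0%N 3 = base_price, M 2 0%N 4 = cap_price & M 2 0%N 5 = theta],
      [/\ M 2 0%N 6 = barrier_slope, M 2 0%N 7 = temperature, M 2 0%N 8 = rounds, M 2 0%N 10 = 0 & M 2 0%N 11 = hinge_slope] &
      forall a i l, (2 < a)%N || (a == 1%N) -> M a i l = 0].

Lemma prelude_run s : imem s 0 0 0 = m ->
  (forall a i l, rmem s a i l = match a, i, l with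
  | 0%N, 0%N, 0%N => rho | 0%N, 0%N, 1%N => eps | 0%N, 0%N, 2%N => delta | _, _, _ => 0 end) ->
  imem (run prelude s) = imem s /\ prelude_mem (rmem (run prelude s)).
Proof.
move=> I0 M0; pose Post (s2 : state R) := imem s2 = imem s /\ prelude_mem (rmem s2).
rewrite -/(Post _) /prelude.
apply: run_ifR => v0 t0 E0 J0 M1; rewrite /= !M0 -minEle in E0 M1.
apply: run_ifR => v1 t1 E1 J1 M2; rewrite /= !M1/= !M0 in E1 M2.
apply: run_setR => v2 t2 E2 J2 M3; rewrite /= J1 J0 I0 addn1 -/logsize in E2 M3.
apply: run_setR => v3 t3 E3 J3 M4; rewrite /= !M3/= E2 sub0r -/base_price in E3 M4.
apply: run_setR => v4 t4 E4 J4 M5; rewrite /= !M4/= !M3/= E2 -/cap_price in E4 M5.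
apply: run_setR => v5 t5 E5 J5 M6; rewrite /= !M5/= !M4/= !M3/= E2 -/hinge_slope in E5 M6.
apply: run_setR => v6 t6 E6 J6 M7; rewrite /= !M6/= !M5/= !M4/= !M3/= E2 -/theta in E6 M7.
apply: run_setR => v7 t7 E7 J7 M8; rewrite /= !M7/= !M6/= !M5/= !M4/= !M3/= E2 sub0r -/barrier_slope in E7 M8.
have E1' : v1 = radius by rewrite E1 /radius maxEle.
apply: run_setR => v8 t8 E8 J8 M9.
rewrite /= !M8/= !M7/= !M6/= !M5/= !M4/= !M3/= !M2/= E2 E1' -/temperature in E8 M9.
apply: run_setR => v9 t9 E9 J9 M10.
rewrite /= !M9/= !M8/= !M7/= !M6/= !M5/= !M4/= !M3/= E2 -/rounds in E9 M10.
split; first by rewrite /= J9 J8 J7 J6 J5 J4 J3 J2 J1 J0.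
have simp := (M10, M9, M8, M7, M6, M5, M4, M3, M2, M1).
split.
- by rewrite /= !simp /= E0 E1' E3 E4 E6.
- by rewrite /= !simp /= M0 E5 E7 E8 E9.
- move=> a i l; rewrite /= => h.
  have na : (a == 2)%N = false by case: a h => [|[|[|]]].
  by rewrite !simp na M0; case: a h {na} => [|[|]].
Qed.

Lemma prelude_correct : exists n s', [/\ ex prelude (alg_input m k rho eps delta) n s',
  (n <= scost prelude)%N, imem s' = imem (alg_input m k rho eps delta) & prelude_mem (rmem s')].
Proof.
have [|//|P1 P2] := @prelude_run (alg_input m k rho eps delta); first by [].
pose Post (s2 : state R) := imem s2 = imem (alg_input m k rho eps delta) /\ prelude_mem (rmem s2).
have PP : Post (run prelude (alg_input m k rho eps delta)) by [].
have [n [s2 [e l [h1 h2]]]] := straight_step O (isT : straight prelude) PP.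
by exists n, s2.
Qed.

Lemma init_correct s : imem s 0 0 0 = m -> prelude_mem (rmem s) ->
  exists n s', [/\ ex (For 0 0 body_init) s n s', (n <= m * (scost body_init + 30) + 20)%N,
    keeps 1 (imem s) (imem s') &
    [/\ agree (fun a i l => [|| (a == 10) && (l == 4), (a == 11) && (l == 6) |
         (a == 12) && (l \in [:: 4; 5])]%N) (rmem s) (rmem s'),
      forall l, (l < m)%N -> rmem s' 10 l 4 = 2 / base_price /\ rmem s' 11 l 6 = 1 / (1 + theta) &
      forall l, (l < m)%N -> rmem s' 12 l 4 = 1 / hinge_slope /\ rmem s' 12 l 5 = radius]].
Proof.
move=> sm [[c0 _ c3 _ c5] [_ _ _ _ c11] _]; set N0 := rmem s in c0 c3 c5 c11 *.
pose J i (M : mem) := [/\ agree (fun a i l => [|| (a == 10) && (l == 4), (a == 11) && (l == 6) |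
         (a == 12) && (l \in [:: 4; 5])]%N) N0 M,
      forall l, (l < i)%N -> M 10 l 4 = 2 / base_price /\ M 11 l 6 = 1 / (1 + theta) &
      forall l, (l < i)%N -> M 12 l 4 = 1 / hinge_slope /\ M 12 l 5 = radius].
have [||n [s' [e l k1 [h1 h2 h3]]]] := @exec_for _ _ (ask O) 0 0 m body_init J
  (fun=> scost body_init) s sm; last first.
- by exists n, s'; split=> //; rewrite sum_nat_const card_ord in l.
- by split.
move=> i s1 im k1 si [H1 H2 H3].
pose Post (s2 : state R) := imem s2 = imem s1 /\ J i.+1 (rmem s2).
suff [n [s2 [e l [P1 P2]]]] : exists n s2, [/\ ex body_init s1 n s2, (n <= scost body_init)%N & Post s2].
  exists n, s2; split=> //; by move=> a i' j' _; rewrite P1.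
apply: straight_step => //; rewrite /body_init.
apply: run_setR => v0 t0 E0 I0 M1; rewrite /= si !H1// c3 in E0 M1.
apply: run_setR => v1 t1 E1 I1 M2; rewrite /= I0 si !M1/= !H1// c5 in E1 M2.
apply: run_setR => v2 t2 E2 I2 M3; rewrite /= I1 I0 si !M2/= !M1/= !H1// c11 in E2 M3.
apply: run_setR => v3 t3 E3 I3 M4; rewrite /= I2 I1 I0 si !M3/= !M2/= !M1/= !H1// c0 in E3 M4.
split; first by rewrite /= I3 I2 I1 I0.
split.
- move=> a i' l h; rewrite /= M4 M3 M2 M1.
  by do 4 (case: ifP => [/and3P[/eqP ? /eqP ? /eqP ?]|_]; first by subst; rewrite ?orbT in h); exact: H1.
- move=> l; rewrite /= !M4/= !M3/= !M2/= !M1/= ?andbT ?andbF ltnS; case: ltngtP => [li _|//|li _] //.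
  exact: H2.
- move=> l; rewrite /= !M4/= !M3/= !M2/= !M1/= ?andbT ?andbF ltnS; case: ltngtP => [li _|//|li _] //.
  exact: H3.
Qed.

(** Half of the base price: later rounds charge at least [base_price] per unit, and the other half
    is the margin by which [iterate_le] controls later columns through this one. *)
Definition first_opt (r : nat -> 'cV[R]_m) (j : 'I_k) : Prop := XX j (r j) /\ forall x, XX j x ->
  psi j (r j) + base_price / 2 * \sum_i r j i 0 <= psi j x + base_price / 2 * \sum_i x i 0 + dsco.

Lemma loop_sum s (j : nat) : imem s 0 0 0 = m -> imem s 1 0 1 = j ->
  exists n s', [/\ ex (For 0 0 body_sum) s n s', (n <= m * (scost body_sum + 30) + 20)%N,
    keeps 1 (imem s) (imem s') &
    agree (fun a i l => [&& a == 14, i == j & l == 0])%N (rmem s) (rmem s') /\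
    rmem s' 14 j 0 = rmem s 14 j 0 + \sum_(i < m) rmem s 13 i 0].
Proof.
move=> sm sj; set N0 := rmem s.
pose J i (M : mem) := agree (fun a i l => [&& a == 14, i == j & l == 0])%N N0 M /\
  M 14 j 0%N = N0 14 j 0%N + \sum_(l < i) N0 13 l 0%N.
have [||n [s' [e l k1 [h1 h2]]]] := @exec_for _ _ (ask O) 0 0 m body_sum J
  (fun=> scost body_sum) s sm; last first.
- by exists n, s'; split=> //; rewrite sum_nat_const card_ord in l.
- by split => //; rewrite big_ord0 addr0.
move=> i s1 im k1 si [H1 H2].
have sj1 : imem s1 1 0 1 = j by rewrite k1.
pose Post (s2 : state R) := imem s2 = imem s1 /\ J i.+1 (rmem s2).
suff [n [s2 [e l [P1 P2]]]] : exists n s2, [/\ ex body_sum s1 n s2, (n <= scost body_sum)%N & Post s2].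
  exists n, s2; split=> //; by move=> a i' j' _; rewrite P1.
apply: straight_step => //; rewrite /body_sum.
apply: run_setR => v0 t0 E0 I0 M1; rewrite /= si sj1 H2 H1// in E0 M1.
split; first by rewrite /= I0.
split; last by rewrite /= M1/= !eqxx /= E0 big_ord_recr/= addrA.
move=> a i' l h; rewrite /= M1 (negbTE h); exact: H1.
Qed.

Definition init_mem (M : mem) : Prop :=
  [/\ [/\ M 2 0%N 0%N = radius, M 2 0%N 1%N = accuracy, M 2 0%N 3 = base_price, M 2 0%N 4 = cap_price & M 2 0%N 5 = theta],
      [/\ M 2 0%N 6 = barrier_slope, M 2 0%N 7 = temperature & M 2 0%N 8 = rounds],
      forall a i l, a \in [:: 1; 3; 4; 9]%N -> M a i l = 0 &
      [/\ forall i, (i < m)%N -> [/\ M 10 i 0%N = 0 /\ M 10 i 1%N = 0, M 10 i 2 = 0, M 10 i 3 = 0 /\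
           M 10 i 4 = 2 / base_price, M 10 i 5 = 0 & M 10 i 6 = 0],
      forall i, (i < m)%N -> [/\ M 11 i 0%N = 0, M 11 i 1%N = 0,
        M 11 i 5 = 0 & M 11 i 6 = 1 / (1 + theta)] &
      forall i, (i < m)%N -> [/\ M 12 i 0%N = 0 /\ M 12 i 1%N = 0, M 12 i 2 = 0 /\ M 12 i 3 = 0,
        M 12 i 4 = 1 / hinge_slope, M 12 i 5 = radius & M 12 i 6 = 0]]].

Definition wrk (a i l : nat) : bool := [|| a == 13, a == 14, a == 15 | [&& a == 2, i == 0 & l == 10]]%N.

Lemma init_mem_agree M M' : agree wrk M M' -> init_mem M -> init_mem M'.
Proof.
move=> ag [[c0 c1 c3 c4 c5] [c6 c7 c8] z [r10 r11 r12]]; split.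
- by rewrite !ag.
- by rewrite !ag.
- move=> a i l ha; rewrite ag ?z//; by move: ha; rewrite !inE => /or4P[]/eqP->.
split; move=> i im; rewrite !ag//.
- exact: r10.
- exact: r11.
- exact: r12.
Qed.

Definition first_time : nat := (m * (scost body_sum + 30) + 100)%N.

Definition firstinv (M0 : mem) (j : nat) (M : mem) : Prop := agree wrk M0 M /\
  exists r : nat -> 'cV[R]_m, [/\ forall l : 'I_k, (l < j)%N -> first_opt r l,
    forall l : nat, M 14 l 0%N = if (l < j)%N then \sum_i r l i 0 else 0 &
    M 2 0%N 10 = \sum_(l < j) \sum_i r l i 0].

Lemma first_column_correct (M0 : mem) s (j : 'I_k) : init_mem M0 ->
  imem s 0 0 0 = m -> imem s 1 0 1 = j -> firstinv M0 j (rmem s) ->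
  exists n s', [/\ ex first_column s n s', (n <= first_time - 30 + oracle_time (O j))%N,
    keeps 1 (imem s) (imem s') & firstinv M0 j.+1 (rmem s')].
Proof.
move=> IM sm sj [ag [r [ropt R14 R2]]].
have [_ _ _ [r10 _ _]] := init_mem_agree ag IM.
have p10 (i : 'I_m) : gpar_of (row_par (rmem s) 10 i) = linpar (base_price / 2) 0.
  have [_ e2 [e3 e4] e5 e6] := r10 i (ltn_ord i).
  by rewrite /gpar_of /row_par/= e2 e3 e4 e5 e6 /linpar invf_div.
have o2 : 0 < base_price / 2 by rewrite divr_gt0// base_price_gt0.
have [//|i a|n2 [s2 [xh [e2 l2 im2 a2 [x2 Xxh opt]]]]] :=
  exec_query (L := [:: 10%N]) m0 Cn3 CnE CnE2 Cng sco sj.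
  rewrite inE => /eqP->; rewrite p10; have [[z0 z1] _ _ _ _] := r10 i (ltn_ord i).
  split => //; first exact: linpar_ok.
  rewrite /= invrK; apply: le_trans MtE; have := base_price_le1; have := cap_price_ge1; lra.
have pieceE (x : 'cV[R]_m) : XX j x ->
    \sum_(i < m) \sum_(a <- [:: 10%N]) ginv (gpar_of (row_par (rmem s) a i)) (x i 0) =
    base_price / 2 * \sum_i x i 0.
  move=> Xx; rewrite mulr_sumr; apply: eq_bigr => i _; rewrite big_cons big_nil addr0 p10.
  by rewrite ginv_linpar// subr0 (max_idPl (XX_ge0 Xx i)).
have sm2 : imem s2 0 0 0 = m by rewrite im2.
have sj2 : imem s2 1 0 1 = j by rewrite im2.
have [n3 [s3 [e3 l3 k3 [a3 P3]]]] := loop_sum sm2 sj2.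
have sj3 : imem s3 1 0 1 = j by rewrite k3.
pose s4 := State (imem s3) (upd (rmem s3) 2 0 10 (rmem s3 2 0 10 + rmem s3 14 j 0)).
have e4 : exists2 n4, ex (sets 10 (RAdd (scal 10) (cvec 14))) s3 n4 s4 & (n4 <= 20)%N.
  have := @ESetR R query (ask O) 2 (INat 0) (INat 10) (RAdd (scal 10) (cvec 14)) s3.
  by rewrite /= sj3 => h; eexists; [exact: h|].
have [n4 {}e4 l4] := e4.
exists (n2 + (n3 + n4).+1).+1, s4; split.
- exact: ESeq e2 (ESeq e3 e4).
- rewrite /first_time; move: (m * _)%N (oracle_time _) l2 l3 l4 => A B; clear; lia.
- by move=> a i l h; rewrite k3// im2.
have r4 a i l : ~~ [&& a == 2, i == 0 & l == 10]%N -> rmem s4 a i l = rmem s3 a i l.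
  by move=> h; rewrite /s4/= /upd (negbTE h).
split.
  move=> a i l h; rewrite r4 ?a3 ?a2 ?ag//; apply: contra h.
  - by move=> /andP[/eqP-> _].
  - by move=> /and3P[/eqP-> _ _].
  - by move=> h'; rewrite /wrk h' !orbT.
pose r' (l : nat) : 'cV[R]_m := if l == j :> nat then xh else r l.
have r'j : r' j = xh by rewrite /r' eqxx.
have r'l l : (l < j)%N -> r' l = r l by move=> lj; rewrite /r' ltn_eqF.
have S14 : rmem s3 14 j 0 = \sum_i xh i 0.
  by rewrite P3 a2// R14 ltnn add0r; apply: eq_bigr => i _; exact: x2.
exists r'; split.
- move=> l; rewrite ltnS leq_eqVlt => /orP[/eqP/val_inj->|lj].
    rewrite /first_opt r'j; split=> // x Xx; have := opt x Xx; rewrite !pieceE//.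
  by have := ropt l lj; rewrite /first_opt r'l.
- move=> l; rewrite r4// ltnS; have [lj|lj|->] := ltngtP l j.
  + by rewrite a3 ?a2// ?R14 ?lj ?r'l//= ltn_eqF.
  + by rewrite a3 ?a2// ?R14 ?(ltnNge l) ?(ltnW lj)//= gtn_eqF.
  + by rewrite r'j.
- rewrite /s4/= /upd/= S14 a3// a2// R2 big_ord_recr/= r'j; congr (_ + _).
  by apply: eq_bigr => l _; rewrite r'l.
Qed.

Lemma loop_width s : imem s 0 0 1 = k -> rmem s 2 0 0 = radius ->
  exists n s', [/\ ex (For 1 1 body_width) s n s', (n <= k * (scost body_width + 30) + 20)%N,
    keeps 2 (imem s) (imem s') &
    agree (fun a i l => a == 15)%N (rmem s) (rmem s') /\
    forall l, (l < k)%N ->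
      rmem s' 15 l 0 = radius * ((rmem s 14 l 0 / rmem s 2 0 10 + 1 / k%:R) / 2)].
Proof.
move=> sk c0; set N0 := rmem s in c0 *.
pose J i (M : mem) := agree (fun a i l => a == 15)%N N0 M /\
  forall l, (l < i)%N -> M 15 l 0%N = radius * ((N0 14 l 0%N / N0 2 0%N 10 + 1 / k%:R) / 2).
have [||n [s' [e l k1 [h1 h2]]]] := @exec_for _ _ (ask O) 1 1 k body_width J
  (fun=> scost body_width) s sk; last first.
- by exists n, s'; split=> //; rewrite sum_nat_const card_ord in l.
- by split.
move=> i s1 im k1 si [H1 H2].
have sk1 : imem s1 0 0 1 = k by rewrite k1.
pose Post (s2 : state R) := imem s2 = imem s1 /\ J i.+1 (rmem s2).
suff [n [s2 [e l [P1 P2]]]] : exists n s2, [/\ ex body_width s1 n s2, (n <= scost body_width)%N & Post s2].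
  exists n, s2; split=> //; by move=> a i' j' _; rewrite P1.
apply: straight_step => //; rewrite /body_width.
apply: run_setR => v0 t0 E0 I0 M1; rewrite /= si sk1 !H1// c0 in E0 M1.
split; first by rewrite /= I0.
split.
- move=> a i' l h; rewrite /= M1 (negbTE h); exact: H1.
- move=> l; rewrite /= M1/= andbT ltnS; case: ltngtP => [li _|//|li _]; last by rewrite li.
  exact: H2.
Qed.

Lemma loop_average s (j N : nat) : imem s 0 0 0 = m -> imem s 1 0 1 = j -> imem s 1 0 2 = N ->
  exists n s', [/\ ex (For 0 0 body_average) s n s', (n <= m * (scost body_average + 30) + 20)%N,
    keeps 1 (imem s) (imem s') &
    agree (fun a i l => (a == 1) && (l == j))%N (rmem s) (rmem s') /\
    forall l, (l < m)%N -> rmem s' 1 l j = rmem s 1 l j / N%:R].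
Proof.
move=> sm sj sN; set N0 := rmem s.
pose J i (M : mem) := agree (fun a i l => (a == 1) && (l == j))%N N0 M /\
  forall l, M 1%N l j = if (l < i)%N then N0 1%N l j / N%:R else N0 1%N l j.
have [||n [s' [e l k1 [h1 h2]]]] := @exec_for _ _ (ask O) 0 0 m body_average J
  (fun=> scost body_average) s sm; last first.
- exists n, s'; split=> //; first by rewrite sum_nat_const card_ord in l.
  by split=> // l' lm; rewrite h2 lm.
- by split.
move=> i s1 im k1 si [H1 H2].
have sj1 : imem s1 1 0 1 = j by rewrite k1.
have sN1 : imem s1 1 0 2 = N by rewrite k1.
pose Post (s2 : state R) := imem s2 = imem s1 /\ J i.+1 (rmem s2).
suff [n [s2 [e l [P1 P2]]]] : exists n s2, [/\ ex body_average s1 n s2, (n <= scost body_average)%N & Post s2].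
  exists n, s2; split=> //; by move=> a i' j' _; rewrite P1.
apply: straight_step => //; rewrite /body_average.
apply: run_setR => v0 t0 E0 I0 M1; rewrite /= si sj1 sN1 H2 ltnn in E0 M1.
split; first by rewrite /= I0.
split.
- move=> a i' l h; rewrite /= M1; case: ifP => [/and3P[/eqP ? /eqP ? /eqP ?]|_]; last exact: H1.
  by subst; rewrite !eqxx in h.
- move=> l; rewrite /= M1/= eqxx andbT ltnS; case: ltngtP => [li|li|li].
  + by rewrite H2 li.
  + by rewrite H2 ltnNge (ltnW li).
  + by rewrite li.
Qed.

Lemma loops_average s (N : nat) : imem s 0 0 0 = m -> imem s 0 0 1 = k -> imem s 1 0 2 = N ->
  exists n s', [/\ ex (For 1 1 (For 0 0 body_average)) s n s',
    (n <= k * (m * (scost body_average + 30) + 20 + 30) + 20)%N,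
    keeps 2 (imem s) (imem s') &
    forall l j, (l < m)%N -> (j < k)%N -> rmem s' 1 l j = rmem s 1 l j / N%:R].
Proof.
move=> sm sk sN; set N0 := rmem s.
pose J j (M : mem) := forall l j', (l < m)%N ->
  M 1%N l j' = if (j' < j)%N then N0 1%N l j' / N%:R else N0 1%N l j'.
have [||n [s' [e l k1 h2]]] := @exec_for _ _ (ask O) 1 1 k (For 0 0 body_average) J
  (fun=> m * (scost body_average + 30) + 20)%N s sk; last first.
- exists n, s'; split=> //; first by rewrite sum_nat_const card_ord in l.
  by move=> l' j lm jk; rewrite h2// jk.
- by [].
move=> j s1 jk k1 sj H.
have sm1 : imem s1 0 0 0 = m by rewrite k1.
have sN1 : imem s1 1 0 2 = N by rewrite k1.
have [n [s2 [e l kk [ag P]]]] := loop_average sm1 sj sN1.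
exists n, s2; split=> // l' j' lm; rewrite ltnS; have [ne|ne|->] := ltngtP j' j.
- by rewrite ag ?H ?ne//= ltn_eqF.
- by rewrite ag ?H ?(ltnNge j') ?(ltnW ne)//= gtn_eqF.
- by rewrite P// H// ltnn.
Qed.

(** The least [t] at which [guard] fails. *)
Definition niter : nat := (Num.trunc (rounds / accuracy)).+1.

Definition total_time : nat :=
  (scost prelude + (m * (scost body_init + 30) + 20)
   + (\sum_(j < k) (first_time + oracle_time (O j)) + 20) + (k * (scost body_width + 30) + 20)
   + (niter * (iteration_time O + (bcost guard + 20)) + (bcost guard).+1)
   + (k * (m * (scost body_average + 30) + 20 + 30) + 20) + 5)%N.

Definition rwidth (r : nat -> 'cV[R]_m) (j : 'I_k) : R :=
  radius * (((\sum_i r j i 0) / (\sum_(l < k) \sum_i r l i 0) + 1 / k%:R) / 2).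

Lemma rwidth_gt0 (r : nat -> 'cV[R]_m) j : (forall l : 'I_k, XX l (r l)) -> 0 < rwidth r j.
Proof.
move=> rX; have s0 (l : 'I_k) : 0 <= \sum_i r l i 0.
  by rewrite sumr_ge0// => i _; exact: XX_ge0 (rX l) i.
rewrite mulr_gt0 ?radius_gt0// divr_gt0// ltr_wpDl ?divr_gt0 ?ltr0n//.
by rewrite divr_ge0 ?s0// sumr_ge0.
Qed.

(** The interface to the analysis: beyond this point the program is seen only through the
    near-optimality of [r] and [X], the average in its output and [total_time]. *)
Lemma regression_correct : exists n s' (r : nat -> 'cV[R]_m) (X : nat -> 'M[R]_(m, k)),
  [/\ ex regression_code (alg_input m k rho eps delta) n s', (n <= total_time)%N,
    forall j, first_opt r j,
    [/\ X 0%N = 0, forall t, (t < niter)%N -> colprod XX (X t.+1) &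
      forall t j x, (t < niter)%N -> XX j x ->
        psi j (col j (X t.+1)) + \sum_i colcost radius temperature base_price cap_price hinge_slope (fun j => hcost (rwidth r j) barrier_slope theta)
          (fun j => hpow (rwidth r j) theta) X t.+1 j i (X t.+1 i j)
        <= psi j x + \sum_i colcost radius temperature base_price cap_price hinge_slope (fun j => hcost (rwidth r j) barrier_slope theta)
          (fun j => hpow (rwidth r j) theta) X t.+1 j i (x i 0) + dsco] &
    alg_output m k s' = niter%:R^-1 *: \sum_(t < niter) X t.+1].
Proof.
have [n1 [s1 [e1 l1 i1 P1]]] := prelude_correct.
have sm1 : imem s1 0 0 0 = m by rewrite i1.
have [n2 [s2 [e2 l2 k2 [a2 I10 I12]]]] := init_correct sm1 P1.
have IM : init_mem (rmem s2).
  have [[c0 c1 c3 c4 c5] [c6 c7 c8 c10 c11] z] := P1.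
  have z2 a i l : (2 < a)%N || (a == 1%N) -> ~~ [|| (a == 10) && (l == 4), (a == 11) && (l == 6) |
         (a == 12) && (l \in [:: 4; 5])]%N -> rmem s2 a i l = 0.
    by move=> h h'; rewrite a2// z.
  split; [by rewrite !a2|by rewrite !a2| |].
    by move=> a i l; rewrite !inE => /or4P[]/eqP->; rewrite z2.
  split=> i im; have [q1 q2] := I10 i im; have [q3 q4] := I12 i im.
  - by rewrite q1 !z2.
  - by rewrite q2 !z2.
  - by rewrite q3 q4 !z2.
have sk2 : imem s2 0 0 1 = k by rewrite k2// i1.
have sm2 : imem s2 0 0 0 = m by rewrite k2.
pose T l := (first_time - 30 + if insub l is Some j then oracle_time (O j) else 0)%N.
have [||n3 [s3 [e3 l3 k3 [a3 [r [ropt R14 R2]]]]]] :=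
  exec_for (ask := ask O) (c := 1) (body := first_column) (I := firstinv (rmem s2)) (T := T) sk2.
- move=> j s4 jk k4 j4 J4.
  have sm4 : imem s4 0 0 0 = m by rewrite k4.
  have [n [s5 [e l kk JJ]]] := @first_column_correct (rmem s2) s4 (Ordinal jk) IM sm4 j4 J4.
  by exists n, s5; split=> //; apply: leq_trans l _; rewrite /T insubT.
- split=> //; exists (fun=> 0); split => //.
    move=> l /=; rewrite a2//; have [_ _ z] := P1; exact: z.
  by rewrite big_ord0 a2//; have [_ []] := P1.
have rX (l : 'I_k) : XX l (r l) by have [] := ropt l (ltn_ord l).
have IM3 := init_mem_agree a3 IM.
have sk3 : imem s3 0 0 1 = k by rewrite k3.
have sm3 : imem s3 0 0 0 = m by rewrite k3.
have c3 : rmem s3 2 0 0 = radius by have [[]] := IM3.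
have [n4 [s4 [e4 l4 k4 [a4 W]]]] := loop_width sk3 c3.
have IM4 : init_mem (rmem s4).
  by apply: init_mem_agree IM3 => a i l h; apply: a4; apply: contra h => /eqP->.
set M0 := rmem s4 in a4 W IM4.
have wE (l : 'I_k) : M0 15%N l 0%N = rwidth r l.
  by rewrite W// R14 R2 ltn_ord /rwidth.
have wn0 l : (l < k)%N -> 0 < M0 15%N l 0%N.
  by move=> lk; rewrite (wE (Ordinal lk)) rwidth_gt0.
have MS : setup m radius temperature base_price cap_price hinge_slope theta barrier_slope M0.
  have [[c0 c1 c3' c4 c5] [c6 c7 c8] z [r10 r11 r12]] := IM4.
  by split => // i im; have [h1 h2 [h3 _] h5 h6] := r10 i im; split.
have [[_ c1 _ _ _] [_ _ c8] z _] := IM4.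
have sm4 : imem s4 0 0 0 = m by rewrite k4.
have sk4 : imem s4 0 0 1 = k by rewrite k4.
have t4 : imem s4 1 0 2 = 0%N by rewrite k4// k3// k2// i1.
have om_Mt : base_price <= cap_price by apply: le_trans base_price_le1 cap_price_ge1.
have [||//||n5 [s5 [e5 l5 k5 t5 [ag5 [X [[X0 Xin Xopt] [H1 _ _ _]]]]]]] :=
  @exec_count R query (ask O) 2 niter guard iteration_code
    (maininv XX psi dsco radius temperature base_price cap_price hinge_slope theta barrier_slope M0) (fun=> iteration_time O) s4.
- move=> t s5 k5 t5 [ag5 _] tN.
  rewrite /guard /= t5 !ag5// c1 c8 -ler_pdivlMr ?accuracy_gt0//.
  rewrite /niter ltnS; have K0 : 0 <= rounds / accuracy by rewrite divr_ge0// ltW// accuracy_gt0.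
  by rewrite truncn_ge_nat.
- move=> t s5 tN k5 t5 J5.
  have sm5 : imem s5 0 0 0 = m by rewrite k5.
  have sk5 : imem s5 0 0 1 = k by rewrite k5.
  exact: (iteration_step m0 Cn3 CnE CnE2 Cng sco XX_ge0 radius_gt0 base_price_gt0 om_Mt hinge_slope_gt0 th0 th1
    barrier_slope_gt0 barrier_slope_le1 MtE etaE MhE wn0 MS sm5 sk5 t5 J5).
- split=> //; exists (fun=> 0); split; first by split.
  split.
  + by move=> i j; rewrite big_ord0 -/M0 z.
  + by move=> i; rewrite -/M0 z// /load big_ord_recr big_ord0 /= rowsum0// addr0.
  + move=> i; rewrite -/M0 z// rowsum0// sub0r (_ : hhsum _ _ _ _ = 0) ?oppr0//.
    rewrite /hhsum big1// => j _; rewrite mxE /hhj /hpow mul0r addr0 powR1 subrr mulr0//.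
  + by move=> i j; rewrite -/M0 z// /price big_ord0.
have sm5 : imem s5 0 0 0 = m by rewrite k5.
have sk5 : imem s5 0 0 1 = k by rewrite k5.
have [n6 [s6 [e6 l6 k6 D]]] := loops_average sm5 sk5 t5.
exists (n1 + (n2 + (n3 + (n4 + (n5 + n6).+1).+1).+1).+1).+1, s6, r, X; split.
- exact: ESeq e1 (ESeq e2 (ESeq e3 (ESeq e4 (ESeq e5 e6)))).
- have ET : (\sum_(i < k) (T i + 30) <= \sum_(j < k) (first_time + oracle_time (O j)))%N.
    apply: leq_sum => j _; rewrite /T valK /first_time.
    by move: (m * _)%N (oracle_time _) => A B; clear; lia.
  move: l1 l2 (leq_trans l3 (leq_add ET (leqnn 20))) l4 l5 l6; rewrite sum_nat_const card_ord /total_time.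
  set ta := scost prelude; set tb := (m * (scost body_init + 30))%N.
  set tc := (\sum_(j < k) _)%N; set td := (k * (scost body_width + 30))%N.
  set te := (k * (m * (scost body_average + 30) + 20 + 30))%N.
  set tf := (niter * (iteration_time O + (bcost guard + 20)))%N; set tg := bcost guard.
  by move: ta tb tc td te tf tg; clear => *; lia.
- by move=> j; exact: ropt.
- split; [exact: X0|exact: Xin|move=> t j x tN Xx].
  have -> : (fun j => hcost (rwidth r j) barrier_slope theta) = hj theta barrier_slope M0.
    by apply/funext => l; rewrite /hj wE.
  have -> : (fun j => hpow (rwidth r j) theta) = hhj theta M0.
    by apply/funext => l; rewrite /hhj wE.
  exact: Xopt.
- apply/matrixP => i j; rewrite !mxE D// H1 summxE mulrC; done.
Qed.

End Correct.
End Program.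

(** * Comparator and range of the iterates *)

Section Comparator.
Variables (R : realType) (m k N : nat).
Variables (XX : 'I_k -> set 'cV[R]_m) (psi : 'I_k -> 'cV[R]_m -> R).
Variables (rho C om Mt Mh PP dsco B nb : R) (h hh : 'I_k -> R -> R).
Variables (Y : 'M[R]_(m, k)) (r : 'I_k -> 'cV[R]_m) (X : nat -> 'M[R]_(m, k)).

Hypotheses (m0 : (0 < m)%N) (k0 : (0 < k)%N) (rho0 : 0 < rho) (om0 : 0 < om) (omM : om <= Mt).
Hypotheses (Mh0 : 0 < Mh) (PP0 : 0 < PP) (dsco0 : 0 <= dsco).
Hypothesis XX_ge0 : forall j x, XX j x -> forall i, 0 <= x i 0.
Hypothesis psi_bound : forall Z, colprod XX Z -> `|psisum psi Z| <= B.
Hypothesis Y_in : colprod XX Y.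
Hypothesis Y_row : forall i, \sum_j Y i j <= nb.
Hypothesis nb_le : nb <= 2 / 3 * rho.
Hypothesis r_in : forall j, XX j (r j).
Hypothesis r_opt : forall j x, XX j x ->
  psi j (r j) + om / 2 * \sum_i r j i 0 <= psi j x + om / 2 * \sum_i x i 0 + dsco.

Definition colsum j : R := \sum_i r j i 0.
Definition mass : R := \sum_j colsum j.
(** The share of the mass gives [rho * colsum j <= 2 * mass * width j]; the share [1 / k] keeps
    every width at least [rho / (2 k)], also when [mass] is 0 and the quotient is 0 by
    convention. *)
Definition width j : R := rho * ((colsum j / mass + 1 / k%:R) / 2).

Lemma colsum_ge0 j : 0 <= colsum j.
Proof. by rewrite sumr_ge0// => i _; exact: XX_ge0 (r_in j) i. Qed.

Lemma mass_ge0 : 0 <= mass.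
Proof. by rewrite sumr_ge0// => j _; exact: colsum_ge0. Qed.

Let kr0 : 0 < k%:R :> R. Proof. by rewrite ltr0n. Qed.

Lemma width_gt0 j : 0 < width j.
Proof.
rewrite mulr_gt0// divr_gt0// ltr_wpDl ?divr_gt0//.
by rewrite divr_ge0 ?colsum_ge0// mass_ge0.
Qed.

Lemma width_ge j : rho / (2 * k%:R) <= width j.
Proof.
have : 0 <= colsum j / mass by rewrite divr_ge0 ?colsum_ge0// mass_ge0.
move=> h0; rewrite ler_wpM2l ?(ltW rho0)// invfM mulrC ler_wpM2r ?invr_ge0// -[leLHS]mul1r; lra.
Qed.

Lemma sum_width : \sum_j width j <= rho.
Proof.
rewrite /width -mulr_sumr -[leRHS]mulr1; apply: ler_wpM2l; first exact: ltW.
rewrite -mulr_suml big_split/= -mulr_suml -/mass sumr_const card_ord -(mulr_natr (1 / k%:R) k) div1r mulVf ?gt_eqF//.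
have [->|M0] := eqVneq mass 0; first by rewrite mul0r add0r; lra.
by rewrite mulfV//; lra.
Qed.

Lemma colsum_le_mass j : colsum j <= mass.
Proof. by rewrite /mass (bigD1 j)//= lerDl sumr_ge0// => l _; exact: colsum_ge0. Qed.

Lemma colsum_width j : rho * colsum j <= 2 * mass * width j.
Proof.
have [M0|M0] := eqVneq mass 0.
  have -> : colsum j = 0.
    by apply/eqP; rewrite eq_le colsum_ge0 -M0 colsum_le_mass.
  by rewrite M0 !mulr0 mul0r.
have Mp : 0 < mass by rewrite lt_neqAle eq_sym M0 mass_ge0.
have -> : 2 * mass * width j = rho * colsum j + rho * mass / k%:R.
  by rewrite /width; field; rewrite M0 gt_eqF.
by rewrite lerDl divr_ge0 ?mulr_ge0 ?mass_ge0 ?ltW.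
Qed.

Lemma in_ge0 Z i j : colprod XX Z -> 0 <= Z i j.
Proof. by move=> ZX; have := XX_ge0 (ZX j) i; rewrite mxE. Qed.

Lemma sum_col (Z : 'M[R]_(m, k)) j : \sum_i col j Z i 0 = \sum_i Z i j.
Proof. by apply: eq_bigr => i _; rewrite mxE. Qed.

Lemma Y_total : \sum_j \sum_i Y i j <= m%:R * rho.
Proof.
rewrite exchange_big/= -[X in X%:R]card_ord mulr_natl -[leRHS]sumr_const.
apply: ler_sum => i _; apply: le_trans (Y_row i) _; move: rho0 nb_le; lra.
Qed.

(** Only sums over all columns are bounded; a single [psi j] is isolated by exchanging column [j]
    inside the feasible matrix [Y]. *)
Lemma psi_gap j x y : XX j x -> XX j y -> psi j x - psi j y <= 2 * B.
Proof.
move=> Xx Xy.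
pose Z (u : 'cV[R]_m) : 'M[R]_(m, k) := \matrix_(i, l) if l == j then u i 0 else Y i l.
have colZ u l : col l (Z u) = if l == j then u else col l Y.
  apply/matrixP => i o; rewrite !mxE; case: eqP => [_|_]; first by rewrite ord1.
  by rewrite mxE.
have Zin u : XX j u -> colprod XX (Z u).
  move=> Xu l; rewrite colZ; case: eqP => [->//|_]; exact: Y_in.
have E u : psisum psi (Z u) = psi j u + \sum_(l | l != j) psi l (col l Y).
  rewrite /psisum (bigD1 j)//= colZ eqxx; congr (_ + _).
  by apply: eq_bigr => l /negbTE lj; rewrite colZ lj.
have := psi_bound (Zin x Xx); have := psi_bound (Zin y Xy); rewrite !E !ler_norml.
by move=> /andP[a1 a2] /andP[b1 b2]; lra.
Qed.

Lemma mass_bound : om / 2 * mass <= 2 * B + om / 2 * (m%:R * rho) + k%:R * dsco.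
Proof.
pose Z : 'M[R]_(m, k) := \matrix_(i, l) r l i 0.
have colZ l : col l Z = r l by apply/matrixP => i o; rewrite !mxE ord1.
have := psi_bound (_ : colprod XX Z); have := psi_bound Y_in; rewrite !ler_norml => /andP[_ hY] hZ.
have /andP[hZ' _] : - B <= psisum psi Z <= B by apply: hZ => l; rewrite colZ.
have : \sum_j (psi j (r j) + om / 2 * colsum j) <=
    \sum_j (psi j (col j Y) + om / 2 * (\sum_i Y i j) + dsco).
  apply: ler_sum => j _; have := r_opt (Y_in j).
  by rewrite sum_col.
rewrite !big_split/= -!mulr_sumr sumr_const card_ord -(mulr_natl dsco k) -/mass.
have -> : \sum_j psi j (r j) = psisum psi Z by apply: eq_bigr => j _; rewrite colZ.
rewrite -/(psisum psi Y).
have : om / 2 * (\sum_j \sum_i Y i j) <= om / 2 * (m%:R * rho).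
  by rewrite ler_wpM2l ?Y_total// divr_ge0// ltW.
lra.
Qed.

Hypothesis mass_PP : 2 * mass <= PP * rho.

Definition heavy j := PP * width j < \sum_i Y i j.

(* A column of the target that is much larger than the width is exchanged for the cheap
   column [r j]. *)
Definition target : 'M[R]_(m, k) := \matrix_(i, j) if heavy j then r j i 0 else Y i j.

Lemma col_target j : col j target = if heavy j then r j else col j Y.
Proof. by apply/matrixP => i o; rewrite !mxE; case: ifP; rewrite ?ord1// mxE. Qed.

Lemma target_in : colprod XX target.
Proof. by move=> j; rewrite col_target; case: ifP. Qed.

Lemma r_le i j : r j i 0 <= colsum j.
Proof.
by rewrite /colsum (bigD1 i)//= lerDl sumr_ge0// => l _; exact: XX_ge0 (r_in j) l.
Qed.

Lemma colsum_le j : colsum j <= PP * width j.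
Proof.
rewrite -(ler_pM2l rho0); apply: le_trans (colsum_width j) _.
rewrite [leRHS]mulrA [rho * PP]mulrC; apply: ler_wpM2r => //; exact/ltW/width_gt0.
Qed.

Lemma target_le i j : target i j <= PP * width j.
Proof.
rewrite mxE; case: ifP => hj; first exact: le_trans (r_le i j) (colsum_le j).
move/negbT: hj; rewrite -leNgt; apply: le_trans.
by rewrite (bigD1 i)//= lerDl sumr_ge0// => l _; exact: in_ge0 Y_in.
Qed.

(** A replaced column has [PP * width j < \sum_l Y l j], and its new entries are at most
    [2 * mass * width j / rho]; they are charged to the old column. All columns of [Y] together have
    mass at most [m * rho]. *)
Lemma target_row i : \sum_j target i j <= nb + 2 * mass * m%:R / PP.
Proof.
have : \sum_j target i j <= \sum_j (Y i j + 2 * mass / (rho * PP) * \sum_l Y l j).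
  apply: ler_sum => j _; rewrite mxE.
  have s0 : 0 <= \sum_l Y l j by rewrite sumr_ge0// => l _; exact: in_ge0 Y_in.
  have c0 : 0 <= 2 * mass / (rho * PP).
    by rewrite divr_ge0 ?mulr_ge0 ?mass_ge0 ?ltW.
  have Yij : 0 <= Y i j by exact: in_ge0 Y_in.
  case: ifP => hj; last by rewrite lerDl mulr_ge0.
  apply: le_trans (_ : 2 * mass / (rho * PP) * (\sum_l Y l j) <= _); last by rewrite lerDr.
  apply: le_trans (r_le i j) _; rewrite mulrAC ler_pdivlMr ?mulr_gt0// mulrA [_ * rho]mulrC.
  apply: le_trans (_ : 2 * mass * width j * PP <= _).
    by apply: ler_wpM2r; [exact: ltW|exact: colsum_width].
  rewrite -mulrA; apply: ler_wpM2l; first by rewrite mulr_ge0 ?mass_ge0.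
  by rewrite mulrC ltW.
rewrite big_split/= -mulr_sumr => /le_trans; apply; apply: lerD; first exact: Y_row.
have -> : 2 * mass * m%:R / PP = 2 * mass / (rho * PP) * (m%:R * rho).
  by field; rewrite !gt_eqF.
by apply: ler_wpM2l; [rewrite divr_ge0 ?mulr_ge0 ?mass_ge0 ?ltW|exact: Y_total].
Qed.

Lemma psi_target : psisum psi target <= psisum psi Y + om / 2 * (m%:R * rho) + k%:R * dsco.
Proof.
have : psisum psi target <= \sum_j (psi j (col j Y) + om / 2 * (\sum_i Y i j) + dsco).
  apply: ler_sum => j _; rewrite col_target.
  have s0 : 0 <= om / 2 * \sum_i Y i j.
    by rewrite mulr_ge0 ?divr_ge0 ?(ltW om0)// sumr_ge0// => l _; exact: in_ge0 Y_in.
  case: ifP => _; last by move: dsco0 s0; lra.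
  have := r_opt (Y_in j); rewrite sum_col.
  have : 0 <= om / 2 * \sum_i r j i 0 by rewrite mulr_ge0 ?colsum_ge0// divr_ge0// ltW.
  lra.
rewrite !big_split/= -!mulr_sumr sumr_const card_ord -(mulr_natl dsco k) -/(psisum psi Y) => /le_trans; apply.
by rewrite lerD2r lerD2l ler_wpM2l ?Y_total// divr_ge0// ltW.
Qed.

Hypothesis target_rho : nb + 2 * mass * m%:R / PP <= rho.
Hypothesis h_ge0 : forall j z, 0 <= z -> 0 <= h j z.
Hypothesis h_quarter : forall j z, 0 <= z -> z <= PP * width j -> h j z <= z / 4.
Hypothesis X_0 : X 0%N = 0.
Hypothesis X_in : forall t, (t < N)%N -> colprod XX (X t.+1).
Hypothesis X_opt : forall t j x, (t < N)%N -> XX j x ->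
  psi j (col j (X t.+1)) + \sum_i colcost rho C om Mt Mh h hh X t.+1 j i (X t.+1 i j)
  <= psi j x + \sum_i colcost rho C om Mt Mh h hh X t.+1 j i (x i 0) + dsco.

Lemma price_bounds t i j : (t < N)%N ->
  om <= price rho C om Mt hh X t.+1 i j / t.+1%:R <= 1 + Mt.
Proof.
move=> tN; have t0 : 0 < t.+1%:R :> R by rewrite ltr0n.
have tb s : (s < t.+1)%N -> om <= tau rho om Mt X s.+1 i j <= Mt.
  move=> st; have e0 l : 0 <= entry X s.+1 i l.
    rewrite /entry; case: insubP => // l' _ _.
    by apply: in_ge0; apply: X_in; exact: leq_ltn_trans tN.
  by have [] := @tau_bounds _ om Mt rho _ (tau_seq rho om Mt (entry X s.+1 i))
    om0 omM rho0 e0 erefl (fun=> erefl) j.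
have w0 s : 0 < weight C hh X s i by exact: softmax_gt0.
have w1 s : weight C hh X s i <= 1.
  have <- := softmax_sum1 C m0 (pred_load hh X s).
  rewrite (bigD1 i)//= lerDl sumr_ge0// => l _; exact/ltW/softmax_gt0.
have cst (a : R) : t.+1%:R * a = \sum_(s < t.+1) a.
  by rewrite sumr_const card_ord mulr_natl.
rewrite ler_pdivlMr// ler_pdivrMr// mulrC cst mulrC cst; apply/andP; split.
  apply: ler_sum => s _; have /andP[h1 _] := tb s (ltn_ord s).
  by apply: le_trans h1 _; rewrite lerDr ltW.
by apply: ler_sum => s _; have /andP[_ h1] := tb s (ltn_ord s); rewrite lerD.
Qed.

Lemma colcost_le t i j z : (t < N)%N -> 0 <= z -> z <= PP * width j ->
  colcost rho C om Mt Mh h hh X t.+1 j i z <= (2 + Mt) * z + Mh * hinge rho z.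
Proof.
move=> tN z0 zP; rewrite lerD2r; have /andP[_ p1] := price_bounds i j tN.
have w0 : 0 < weight C hh X t.+1 i by exact: softmax_gt0.
have w1 : weight C hh X t.+1 i <= 1.
  have <- := softmax_sum1 C m0 (pred_load hh X t.+1).
  rewrite (bigD1 i)//= lerDl sumr_ge0// => l _; exact/ltW/softmax_gt0.
have h0 := h_ge0 j z0; have h4 := h_quarter z0 zP.
have wt : weight C hh X t.+1 i / t.+1%:R <= 1.
  by rewrite ler_pdivrMr ?ltr0n// mul1r (le_trans w1)// ler1n.
have := ler_wpM2r z0 p1; have := ler_wpM2r h0 wt; move: (_ / _ * h j z) (_ / _ * z) => a b.
by move: z0 h4; lra.
Qed.

Lemma colcost_ge t i j z : (t < N)%N -> 0 <= z ->
  om * z + Mh * hinge rho z <= colcost rho C om Mt Mh h hh X t.+1 j i z.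
Proof.
move=> tN z0; rewrite lerD2r; have /andP[p1 _] := price_bounds i j tN.
have w0 : 0 < weight C hh X t.+1 i by exact: softmax_gt0.
have h0 := h_ge0 j z0.
have := ler_wpM2r z0 p1.
have : 0 <= weight C hh X t.+1 i / t.+1%:R * h j z by rewrite mulr_ge0// divr_ge0// ltW.
by move: (_ / _ * h j z) (_ / _ * z) => a b; lra.
Qed.

Hypothesis Mh_big : 2 * B + (2 + Mt) * (m%:R * rho) + dsco <= Mh * rho.

(** The entries of [target] are at most [rho] and pay no hinge, whereas an entry of the iterate
    above [2 * rho] would pay more than [Mh * rho] by itself. *)
Lemma iterate_le2 t i j : (t < N)%N -> X t.+1 i j <= 2 * rho.
Proof.
move=> tN; have x0 l : 0 <= X t.+1 l j by apply: in_ge0; exact: X_in.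
have opt := X_opt tN (target_in j).
have gap := psi_gap (target_in j) (X_in tN j).
have T0 l : 0 <= target l j by apply: in_ge0; exact: target_in.
have Trow l : target l j <= rho.
  apply: le_trans target_rho; apply: le_trans (target_row l).
  by rewrite (bigD1 j)//= lerDl sumr_ge0// => o _; apply: in_ge0; exact: target_in.
have up : \sum_l colcost rho C om Mt Mh h hh X t.+1 j l (col j target l 0) <= (2 + Mt) * (m%:R * rho).
  have -> : (2 + Mt) * (m%:R * rho) = \sum_(l < m) (2 + Mt) * rho.
    by rewrite sumr_const card_ord -(mulr_natl _ m); ring.
  apply: ler_sum => l _; have -> : col j target l 0 = target l j by rewrite mxE.
  apply: le_trans (colcost_le l tN (T0 l) (target_le l j)) _.
  have -> : hinge rho (target l j) = 0 by apply/max_idPr; rewrite subr_le0.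
  rewrite mulr0 addr0 ler_wpM2l//; move: om0 omM; lra.
have lo : Mh * (X t.+1 i j - rho) <= \sum_l colcost rho C om Mt Mh h hh X t.+1 j l (X t.+1 l j).
  have c0 l : 0 <= colcost rho C om Mt Mh h hh X t.+1 j l (X t.+1 l j).
    apply: le_trans (colcost_ge l j tN (x0 l)).
    by rewrite addr_ge0 ?mulr_ge0 ?hinge_ge0// ltW.
  rewrite (bigD1 i)//= -[leLHS]addr0; apply: lerD; last by rewrite sumr_ge0.
  apply: le_trans (colcost_ge i j tN (x0 i)).
  have : X t.+1 i j - rho <= hinge rho (X t.+1 i j) by rewrite /hinge le_max lexx.
  move/(ler_wpM2l (ltW Mh0)); have := mulr_ge0 (ltW om0) (x0 i); lra.
have : Mh * (X t.+1 i j - rho) <= Mh * rho by move: Mh_big; lra.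
by rewrite (ler_pM2l Mh0); lra.
Qed.

Hypothesis PP_big : 2 * mass * (2 + Mt + Mh) / rho + 4 * (k%:R * dsco) / rho <= om / 2 * PP.

(** Two optimality inequalities are added: [r j] against the iterate in the first query, and the
    iterate against [r j] in the later round. The values of [psi] cancel, and the iterate is still
    charged [om - om / 2] per unit. *)
Lemma iterate_le t i j : (t < N)%N -> X t.+1 i j <= PP * width j.
Proof.
move=> tN; have x0 l : 0 <= X t.+1 l j by apply: in_ge0; exact: X_in.
have opt := X_opt tN (r_in j); have opt2 := r_opt (X_in tN j).
have w0 := width_gt0 j.
have up : \sum_l colcost rho C om Mt Mh h hh X t.+1 j l (r j l 0) <= (2 + Mt + Mh) * colsum j.
  rewrite /colsum mulr_sumr; apply: ler_sum => l _.
  have r0 : 0 <= r j l 0 by exact: XX_ge0 (r_in j) l.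
  apply: le_trans (colcost_le l tN r0 (le_trans (r_le l j) (colsum_le j))) _.
  have : hinge rho (r j l 0) <= r j l 0.
    by rewrite /hinge ge_max r0 andbT; move: rho0; lra.
  move/(ler_wpM2l (ltW Mh0)); lra.
have lo : om * \sum_l X t.+1 l j <= \sum_l colcost rho C om Mt Mh h hh X t.+1 j l (X t.+1 l j).
  rewrite mulr_sumr; apply: ler_sum => l _; apply: le_trans (colcost_ge l j tN (x0 l)).
  by rewrite lerDl mulr_ge0 ?hinge_ge0// ltW.
rewrite sum_col in opt2.
have s : om / 2 * \sum_l X t.+1 l j <= (2 + Mt + Mh) * colsum j + 2 * dsco.
  have : 0 <= om / 2 * \sum_i r j i 0 by rewrite mulr_ge0 ?colsum_ge0// divr_ge0// ltW.
  lra.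
have xi : X t.+1 i j <= \sum_l X t.+1 l j by rewrite (bigD1 i)//= lerDl sumr_ge0.
have o2 : 0 < om / 2 by rewrite divr_gt0.
rewrite -(ler_pM2l o2); apply: le_trans (ler_wpM2l (ltW o2) xi) _; apply: le_trans s _.
rewrite mulrA; apply: le_trans (ler_wpM2r (ltW w0) PP_big); rewrite [leRHS]mulrDl; apply: lerD.
  have -> : 2 * mass * (2 + Mt + Mh) / rho * width j = (2 + Mt + Mh) * ((2 * mass * width j) / rho).
    by ring.
  apply: ler_wpM2l; first by move: om0 omM Mh0; lra.
  by rewrite ler_pdivlMr// mulrC colsum_width.
have := ler_wpM2l (_ : 0 <= 4 * (k%:R * dsco) / rho) (width_ge j).
have -> : 4 * (k%:R * dsco) / rho * (rho / (2 * k%:R)) = 2 * dsco by field; rewrite !gt_eqF.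
by apply; rewrite divr_ge0 ?mulr_ge0// ltW.
Qed.

End Comparator.

(** * Guarantee for the average *)

Section Convexity.
Variables (R : realType) (m : nat) (A : set 'cV[R]_m) (f : 'cV[R]_m -> R).
Hypotheses (Aconv : convex_set A) (fconv : convex_function A f).

Lemma convex_comb (t : R) x y : 0 <= t -> t <= 1 -> A x -> A y ->
  A (t *: x + (1 - t) *: y) /\ f (t *: x + (1 - t) *: y) <= t * f x + (1 - t) * f y.
Proof.
move=> t0 t1 Ax Ay; have xA : x \in A by rewrite inE. have yA : y \in A by rewrite inE.
split; first by have := Aconv (Itv01 t0 t1) xA yA; rewrite inE.
exact: (fconv (Itv01 t0 t1) xA yA).
Qed.

Lemma convex_mid x y : A x -> A y ->
  A (2^-1 *: (x + y)) /\ f (2^-1 *: (x + y)) <= (f x + f y) / 2.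
Proof.
move=> Ax Ay; have [|||//|h1 h2] := @convex_comb 2^-1 x y; rewrite //; try lra.
have e : 1 - 2^-1 = 2^-1 :> R by lra.
by rewrite e -scalerDr in h1 h2; split=> //; lra.
Qed.

Lemma convex_average (N : nat) (x : nat -> 'cV[R]_m) : (0 < N)%N -> (forall t, (t < N)%N -> A (x t)) ->
  A (N%:R^-1 *: \sum_(t < N) x t) /\
  f (N%:R^-1 *: \sum_(t < N) x t) <= N%:R^-1 * \sum_(t < N) f (x t).
Proof.
case: N => // N _; elim: N => [|N IH] Ax.
  by rewrite !big_ord1 invr1 scale1r mul1r; split=> //; exact: Ax.
have [|h1 h2] := IH; first by move=> t tN; apply: Ax; exact: ltnW.
set a : R := N.+1%:R in h1 h2 *; set b : R := N.+2%:R.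
have ba : b = a + 1 by rewrite /a /b natr1.
have a0 : 0 < a by rewrite ltr0n.
have b0 : 0 < b by rewrite ltr0n.
have ab0 : 0 <= a / b by rewrite divr_ge0// ltW.
have ab1 : a / b <= 1 by rewrite ler_pdivrMr//; lra.
have [g1 g2] := convex_comb ab0 ab1 h1 (Ax _ (ltnSn _)).
have e : 1 - a / b = b^-1 by have -> : a = b - 1 by [lra]; field; rewrite gt_eqF.
have eS (V : lmodType R) (y : nat -> V) : (a / b) *: (a^-1 *: \sum_(t < N.+1) y t) + b^-1 *: y N.+1
    = b^-1 *: \sum_(t < N.+2) y t.
  rewrite [in RHS]big_ord_recr/= scalerDr scalerA; congr (_ *: _ + _).
  by field; rewrite !gt_eqF.
rewrite e (eS _ x) in g1 g2; split=> //; apply: le_trans g2 _.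
have := eS R^o (fun t => f (x t)); rewrite /GRing.scale/= => <-.
by rewrite lerD2r; apply: ler_wpM2l => //; rewrite divr_ge0// ltW.
Qed.

End Convexity.

(** Error budget per round, in units of [e * rho]: one quarter for temperature and starting terms,
    and at most 11/2 sixteenths for the others. *)
Lemma guarantee_arith (R : realType) (N rho e m om d n ov pY pT CL Gr er zz kd : R) :
  N * pT <= N * (pY + om / 2 * (m * rho) + kd) -> zz <= N * (e / 16 * rho) ->
  N * ov <= N * (e / 16 * rho) ->
  N * rho * (m * om) <= N * rho * (e / 16) -> N * rho * d <= N * rho * (e / 16) ->
  N * rho * (3 * N * d) <= N * rho * (e / 16) ->
  N * kd <= N * (d * rho) -> er <= 3 * N * (N * d) * rho ->
  CL + Gr / 4 + rho / 4 <= N * (e * rho / 4) -> 0 <= N * rho * e ->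
  N * (pT + (n + ov) + m * (rho * om)) + CL + Gr / 4 + rho / 4 + er + zz
  <= (pY + n + e * rho) * N.
Proof. move=> *; lra. Qed.

Section Guarantee.
Variables (R : realType) (m k N : nat).
Variables (XX : 'I_k -> set 'cV[R]_m) (psi : 'I_k -> 'cV[R]_m -> R).
Variables (rho C om Mt Mh PP th eta dsco B b d D e : R).
Variables (Y : 'M[R]_(m, k)) (r : 'I_k -> 'cV[R]_m) (X : nat -> 'M[R]_(m, k)).
Let wd := width rho r.
Let h j := hcost (wd j) eta th.
Let hh j := hpow (wd j) th.
Let Gm := overload om Mt.

Hypotheses (m0 : (0 < m)%N) (k0 : (0 < k)%N) (N0 : (0 < N)%N) (rho0 : 0 < rho) (C0 : 0 < C)
  (om0 : 0 < om) (omM : om <= Mt) (Mh0 : 0 < Mh) (PP0 : 0 < PP) (dsco0 : 0 <= dsco) (B0 : 0 <= B).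
Hypotheses (th0 : 0 < th) (th1 : th <= 1) (eta0 : 0 < eta) (eta34 : eta <= 3 / 4).
Hypothesis PP_th : (1 + PP) `^ th <= 3.
Hypotheses (XX_conv : forall j, convex_set (XX j)) (psi_conv : forall j, convex_function (XX j) (psi j)).
Hypothesis XX_ge0 : forall j x, XX j x -> forall i, 0 <= x i 0.
Hypothesis psi_bound : forall Z, colprod XX Z -> `|psisum psi Z| <= B.
Hypotheses (Y_in : colprod XX Y) (Y_norm : 3 / 2 * norm1oo Y <= rho).
Hypothesis r_opt : forall j, XX j (r j) /\ forall x, XX j x ->
  psi j (r j) + om / 2 * \sum_i r j i 0 <= psi j x + om / 2 * \sum_i x i 0 + dsco.
Hypothesis X_0 : X 0%N = 0.
Hypothesis X_in : forall t, (t < N)%N -> colprod XX (X t.+1).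
Hypothesis X_opt : forall t j x, (t < N)%N -> XX j x ->
  psi j (col j (X t.+1)) + \sum_i colcost rho C om Mt Mh h hh X t.+1 j i (X t.+1 i j)
  <= psi j x + \sum_i colcost rho C om Mt Mh h hh X t.+1 j i (x i 0) + dsco.

Hypotheses (b0 : 0 <= b) (d0 : 0 <= d) (e0 : 0 < e) (e1 : e <= 1).
Hypotheses (Bb : B <= b * rho) (dd : k%:R * dsco <= d * rho).
Hypothesis q1 : 4 * b / om + m%:R + 2 * d / om <= D.
Hypotheses (q2 : 2 * D <= PP) (q2' : 2 * D * m%:R / PP <= e / 16).
Hypothesis q3 : 2 * b + (2 + Mt) * m%:R + d <= Mh.
Hypothesis q4 : 2 * D * (2 + Mt + Mh) + 4 * d <= om / 2 * PP.
Hypothesis q5 : N%:R * (2 * b + 1 + 5 * (m%:R * om)) + 1 + 3 * N%:R * (N%:R * d) < 3 * Mt.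
Hypothesis q6 : m%:R * om <= e / 16.
Hypothesis q7 : eta * Gm <= e / 2.
Hypotheses (q8 : 40 * (Gm * rho) <= C) (q8' : 16 * (20 ^+ 3 / th * (rho * (1 + 12 * Gm))) <= C).
Hypothesis q9 : C * ln m%:R + Gm * rho / 4 + rho / 4 <= N%:R * (e * rho / 4).
Hypotheses (q10 : d <= e / 16) (q10' : 3 * N%:R * d <= e / 16).

Let r_in j : XX j (r j). Proof. by have [] := r_opt j. Qed.
Let r_opt' j x : XX j x ->
  psi j (r j) + om / 2 * \sum_i r j i 0 <= psi j x + om / 2 * \sum_i x i 0 + dsco.
Proof. by have [_] := r_opt j; apply. Qed.

Lemma norm1oo_row i : \sum_j Y i j <= norm1oo Y.
Proof.
apply: le_trans (_ : \sum_j `|Y i j| <= _); first by apply: ler_sum => j _; exact: ler_norm.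
by rewrite /norm1oo; exact: (le_bigmax_cond _ (fun i => \sum_j `|Y i j|)).
Qed.

Let nb_le : norm1oo Y <= 2 / 3 * rho. Proof. by move: Y_norm; lra. Qed.

(** [q1] is [mass_bound] divided by [om / 2] and expressed in units of [rho]. *)
Lemma mass_le : mass r <= D * rho.
Proof.
have o2 : 0 < om / 2 by rewrite divr_gt0.
rewrite -(ler_pM2l o2).
apply: le_trans (mass_bound rho0 om0 psi_bound Y_in norm1oo_row nb_le r_in r_opt') _.
have h1 : om / 2 * ((4 * b / om + m%:R + 2 * d / om) * rho) <= om / 2 * (D * rho).
  by apply: ler_wpM2l; [exact: ltW|apply: ler_wpM2r; [exact: ltW|exact: q1]].
apply: le_trans h1.
have -> : om / 2 * ((4 * b / om + m%:R + 2 * d / om) * rho) =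
    2 * (b * rho) + om / 2 * (m%:R * rho) + d * rho by field; rewrite gt_eqF.
by move: Bb dd; lra.
Qed.

Let mass0 : 0 <= mass r. Proof. exact: (mass_ge0 XX_ge0 r_in). Qed.

Let mass_PP : 2 * mass r <= PP * rho.
Proof.
apply: le_trans (_ : 2 * D * rho <= _); first by have := mass_le; lra.
by apply: ler_wpM2r; [exact: ltW|].
Qed.

Lemma mass_over : 2 * mass r * m%:R / PP <= e / 16 * rho.
Proof.
apply: le_trans (_ : 2 * D * m%:R / PP * rho <= _); last by rewrite ler_wpM2r// ltW.
have -> : 2 * D * m%:R / PP * rho = 2 * (D * rho) * m%:R / PP by ring.
apply: ler_wpM2r; first by rewrite invr_ge0 ltW.
by apply: ler_wpM2r => //; rewrite ler_wpM2l// mass_le.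
Qed.

Let target_rho : norm1oo Y + 2 * mass r * m%:R / PP <= rho.
Proof. have := mass_over; have := ler_wpM2r (ltW rho0) e1; move: nb_le rho0; lra. Qed.

Let wd0 j : 0 < wd j. Proof. exact: (width_gt0 k0 rho0 XX_ge0 r_in j). Qed.
Let eta1 : eta <= 1. Proof. by move: eta34; lra. Qed.
Let PP_ge0 : 0 <= PP. Proof. exact: ltW. Qed.

Let h_quarter j z : 0 <= z -> z <= PP * wd j -> h j z <= z / 4.
Proof. exact: (hcost_quarter (wd0 j) eta0 eta1 th0 th1 PP_ge0 PP_th). Qed.

Let h_ge0 j z : 0 <= z -> 0 <= h j z.
Proof. by move=> _; exact: (hcost_ge0 (wd0 j) eta0 eta1 th0 th1 PP_ge0). Qed.

Let dsco_le : dsco <= d * rho.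
Proof. by apply: le_trans dd; rewrite ler_peMl// ler1n. Qed.

Let Mh_big : 2 * B + (2 + Mt) * (m%:R * rho) + dsco <= Mh * rho.
Proof. have := ler_wpM2r (ltW rho0) q3; move: Bb dsco_le; lra. Qed.

Let PP_big : 2 * mass r * (2 + Mt + Mh) / rho + 4 * (k%:R * dsco) / rho <= om / 2 * PP.
Proof.
apply: le_trans q4; apply: lerD.
  rewrite ler_pdivrMr//.
  have M2 : 0 <= 2 + Mt + Mh by move: om0 omM Mh0; lra.
  by have := ler_wpM2r M2 mass_le; lra.
by rewrite ler_pdivrMr//; move: dd; lra.
Qed.

Let G0 : 0 <= Gm. Proof. exact: (@overload_ge0 R om Mt om0 omM). Qed.

Let errd : sco_error k N dsco <= 3 * N%:R * (N%:R * d) * rho.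
Proof.
rewrite /sco_error -mulrA; have -> : 3 * N%:R * (N%:R * d) * rho = 3 * N%:R * (N%:R * (d * rho)) by ring.
rewrite mulrA; apply: ler_wpM2l; first by rewrite mulr_ge0.
by apply: ler_wpM2l.
Qed.

Lemma average_bound (Z : 'M[R]_(m, k)) : Z = N%:R^-1 *: \sum_(t < N) X t.+1 ->
  colprod XX Z /\ psisum psi Z + norm1oo Z <= psisum psi Y + norm1oo Y + e * rho.
Proof.
move=> ZE.
have Nr : 0 < N%:R :> R by rewrite ltr0n.
have colZ j : col j Z = N%:R^-1 *: \sum_(t < N) col j (X t.+1).
  by rewrite ZE; apply/matrixP => i o; rewrite !mxE !summxE; congr (_ * _);
    apply: eq_bigr => t _; rewrite mxE.
have av j := convex_average (@XX_conv j) (@psi_conv j) N0 (fun t tN => X_in tN j).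
have ZX : colprod XX Z by move=> j; rewrite colZ; have [] := av j.
split=> //.
have psiZ : psisum psi Z <= N%:R^-1 * \sum_(t < N) psisum psi (X t.+1).
  rewrite /psisum exchange_big/= mulr_sumr; apply: ler_sum => j _.
  by rewrite colZ; have [] := av j.
have Mt_big : N%:R * (2 * B + rho + 5 * m%:R * (om * rho)) + rho + sco_error k N dsco < 3 * rho * Mt.
  have q := q5; rewrite -(ltr_pM2r rho0) in q.
  have := ler_wpM2l (ltW Nr) Bb; have := errd.
  have -> : 3 * rho * Mt = 3 * Mt * rho by ring.
  move=> a1 a2; apply: le_lt_trans q; lra.
have wsum : \sum_j wd j <= rho by exact: sum_width.
have K0 : 0 < 20 ^+ 3 / th by rewrite divr_gt0// exprn_gt0.
have X_le t i j (tN : (t < N)%N) : X t.+1 i j <= PP * wd j :=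
  iterate_le m0 k0 rho0 om0 omM Mh0 dsco0 XX_ge0 r_in r_opt' mass_PP h_ge0 h_quarter X_in X_opt
    PP_big i j tN.
have X_le2 t i j (tN : (t < N)%N) : X t.+1 i j <= 2 * rho :=
  iterate_le2 m0 k0 rho0 om0 omM Mh0 PP0 XX_ge0 psi_bound Y_in norm1oo_row nb_le r_in mass_PP
    target_rho h_ge0 h_quarter X_in X_opt Mh_big i j tN.
pose T := target rho PP Y r.
have Trow i : \sum_j T i j <= norm1oo Y + 2 * mass r * m%:R / PP :=
  target_row k0 rho0 PP0 XX_ge0 Y_in norm1oo_row nb_le r_in i.
have reg := @regret R m k N XX psi rho C om Mt Mh PP (20 ^+ 3 / th) eta dsco B wd h hh X
  m0 rho0 C0 om0 omM (ltW Mh0) K0 (ltW eta0) dsco0 B0 wd0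
  (fun j x y xX yX => proj1 (convex_mid (@XX_conv j) (@psi_conv j) xX yX))
  (fun j x y xX yX => proj2 (convex_mid (@XX_conv j) (@psi_conv j) xX yX))
  XX_ge0 psi_bound X_0 X_in X_opt X_le X_le2
  (fun j => hcost0 (wd0 j) eta0 eta1 th0 th1 PP_ge0) h_ge0
  (fun j a b => @hcost_mid R (wd j) eta th PP (wd0 j) eta0 eta1 th0 th1 PP_ge0 PP_th a b)
  (fun j a b => @hcost_lip R (wd j) eta th PP (wd0 j) eta0 eta1 th0 th1 PP_ge0 PP_th a b)
  (fun j a => @hpow_close R (wd j) eta th PP (wd0 j) eta0 eta1 th0 th1 PP_ge0 PP_th a)
  T (target_in rho PP Y_in r_in) (fun i => le_trans (Trow i) target_rho)
  (fun i j => target_le k0 rho0 XX_ge0 Y_in r_in mass_PP i j)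
  Mt_big wsum eta34 q8 q8' _ Trow.
have psiT : psisum psi T <= psisum psi Y + om / 2 * (m%:R * rho) + k%:R * dsco :=
  psi_target PP rho0 om0 dsco0 XX_ge0 Y_in norm1oo_row nb_le r_in r_opt'.
(* [C >= 40 * (Gm * rho)] makes the squared error of [hh] linear in [rho], and [eta * Gm <= e / 2]
   makes it small. *)
have zb : 5 * zbar rho om Mt eta ^+ 2 / C <= e / 16 * rho.
  rewrite ler_pdivrMr//; apply: le_trans (_ : e / 16 * rho * (40 * (Gm * rho)) <= _); last first.
    by apply: ler_wpM2l => //; rewrite mulr_ge0 ?divr_ge0 ?ltW.
  rewrite /zbar -/Gm.
  have -> : 5 * (eta * (Gm * rho)) ^+ 2 = 5 * (Gm * rho ^+ 2) * (eta * (eta * Gm)) by ring.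
  have -> : e / 16 * rho * (40 * (Gm * rho)) = 5 * (Gm * rho ^+ 2) * (e / 2) by field.
  apply: ler_wpM2l; first by rewrite mulr_ge0// mulr_ge0// sqr_ge0.
  apply: le_trans q7; rewrite ler_piMl// mulr_ge0//; exact: ltW.
have key i : N%:R^-1 * \sum_(t < N) psisum psi (X t.+1) + N%:R^-1 * load X N i
    <= psisum psi Y + norm1oo Y + e * rho.
  rewrite -mulrDr mulrC ler_pdivrMr//; apply: le_trans (reg i) _.
  have t1 := ler_wpM2l (ltW Nr) psiT; have t2 := ler_wpM2l (ltW Nr) zb.
  have t3 := ler_wpM2l (ltW Nr) mass_over.
  have nr : 0 <= N%:R * rho by rewrite mulr_ge0// ltW.
  have t4 := ler_wpM2l nr q6; have t5 := ler_wpM2l nr q10; have t6 := ler_wpM2l nr q10'.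
  have t7 := ler_wpM2l (ltW Nr) dd; have t8 := errd; have t9 := q9; rewrite -/Gm.
  have t10 : N%:R * (5 * zbar rho om Mt eta ^+ 2) / C <= N%:R * (e / 16 * rho).
    by apply: le_trans t2; rewrite -[leLHS]mulrA.
  have t11 : 0 <= N%:R * rho * e by rewrite mulr_ge0// ltW.
  exact: guarantee_arith t1 t10 t3 t4 t5 t6 t7 t8 t9 t11.
have ZE' i j : Z i j = N%:R^-1 * \sum_(t < N) X t.+1 i j by rewrite ZE !mxE summxE.
have Z0 i j : 0 <= Z i j by have := XX_ge0 (ZX j) i; rewrite mxE.
have rowZ i : \sum_j `|Z i j| = N%:R^-1 * load X N i.
  have -> : load X N i = \sum_(t < N) rowsum X t.+1 i.
    by rewrite /load big_ord_recl/= rowsum0// add0r.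
  rewrite /rowsum exchange_big/= mulr_sumr; apply: eq_bigr => j _.
  by rewrite ger0_norm// ZE'.
have rZ i : psisum psi Z + \sum_j `|Z i j| <= psisum psi Y + norm1oo Y + e * rho.
  by apply: le_trans (key i); rewrite rowZ lerD2r.
rewrite -lerBrDl; apply: bigmax_le => [|i _]; last by rewrite lerBrDl.
(* The maximum in [norm1oo] starts from 0, so the bound has to be shown nonnegative too; any row
   serves for this. *)
have i0 := Ordinal m0; have := rZ i0; have : 0 <= \sum_j `|Z i0 j| by rewrite sumr_ge0.
lra.
Qed.

End Guarantee.

(** * Constants *)

Section Powers.
Variables (R : realType) (z e mr N : R) (p eN eo et eh eP ee a : nat).
Hypotheses (z2 : 2 <= z) (mz : mr <= z) (m0 : 0 <= mr) (e1 : e <= 1) (ep : (z ^+ p)^-1 <= e).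
Hypotheses (N0 : 0 <= N) (NE : N <= z ^+ eN).
Hypotheses (eoE : eo = (p + 6)%N) (etE : et = (eN + 2 * p + 4)%N) (ehE : eh = (et + 2 * p + 5)%N)
  (ePE : eP = (eh + 3 * p + 2 * eo + 12)%N) (eeE : ee = (p + 5 + et + eo)%N)
  (aE : a = (2 * eN + p + eo + 10)%N).

Local Ltac nlia := clear -eoE etE ehE ePE eeE aE; lia.

Let z0 : 0 < z. Proof. by apply: lt_le_trans z2. Qed.
Let z1 : 1 <= z. Proof. by apply: le_trans z2; rewrite ler1n. Qed.
Let zp n : 0 < z ^+ n. Proof. exact: exprn_gt0. Qed.
Let zp1 n : 1 <= z ^+ n. Proof. exact: exprn_ege1. Qed.

Lemma pow_le n l : (n <= l)%N -> z ^+ n <= z ^+ l. Proof. by move=> nl; apply: ler_weXn2l. Qed.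

Lemma pow2_le s : 2 ^+ s <= z ^+ s. Proof. by apply: lerXn2r; rewrite ?nnegrE ?(ltW z0). Qed.

(** Because [z >= 2], a numerical factor costs a fixed number of exponents. *)
Lemma num_pow_le (c : R) s n l : c <= 2 ^+ s -> (n + s <= l)%N -> c * z ^+ n <= z ^+ l.
Proof.
move=> cs nsl; apply: le_trans (pow_le nsl); rewrite addnC exprD.
by apply: ler_wpM2r; [exact/ltW|apply: le_trans (pow2_le s)].
Qed.

Lemma pow_eP n : (n < eP)%N -> z ^+ n <= z ^+ eP - 1.
Proof.
move=> nP; apply: le_trans (_ : 2 * z ^+ n - 1 <= _).
  by have := zp1 n; lra.
by rewrite lerD2r; apply: (@num_pow_le _ 1); rewrite ?expr1// addn1.
Qed.

Let e0 : 0 < e. Proof. by apply: lt_le_trans ep; rewrite invr_gt0. Qed.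

Lemma le_e (x : R) s : x * 2 ^+ s * z ^+ p <= 1 -> x <= e / 2 ^+ s.
Proof.
move=> h; rewrite ler_pdivlMr ?exprn_gt0//; apply: le_trans ep.
by rewrite -[leRHS]mul1r ler_pdivlMr.
Qed.

Lemma pow_q1 : 4 * z ^+ (2 * p) / (z ^+ eo)^-1 + mr + 2 * (z ^+ a)^-1 / (z ^+ eo)^-1
  <= z ^+ (2 * p + eo + 3).
Proof.
rewrite !invrK -mulrA -exprD.
have h1 : z <= z ^+ (2 * p + eo) by rewrite -[leLHS]expr1; apply: pow_le; nlia.
have h2 : 2 * (z ^+ a)^-1 * z ^+ eo <= 2 * 1.
  rewrite -mulrA; apply: ler_wpM2l => //; rewrite mulrC ler_pdivrMr// mul1r.
  by apply: pow_le; nlia.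
have h3 := zp1 (2 * p + eo).
have h4 : 8 * z ^+ (2 * p + eo) <= z ^+ (2 * p + eo + 3).
  by apply: (@num_pow_le _ 3) => //; lra.
by move: mz h1 h2 h3 h4; lra.
Qed.

Lemma pow_q2 : 2 * z ^+ (2 * p + eo + 3) <= z ^+ eP - 1.
Proof.
apply: le_trans (_ : z ^+ (2 * p + eo + 4) <= _); last by apply: pow_eP; nlia.
by apply: (@num_pow_le _ 1); rewrite ?expr1//; nlia.
Qed.

Let PP0 : 0 < z ^+ eP - 1.
Proof. by apply: lt_le_trans pow_q2; rewrite mulr_gt0. Qed.

Lemma e16 (x : R) : x * 16 * z ^+ p <= 1 -> x <= e / 16.
Proof. by move=> h; have -> : 16 = 2 ^+ 4 :> R by [lra]; apply: le_e; move: h; lra. Qed.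

Lemma pow_q2' : 2 * z ^+ (2 * p + eo + 3) * mr / (z ^+ eP - 1) <= e / 16.
Proof.
apply: e16; rewrite -!mulrA mulrCA mulrC; rewrite mulrC.
rewrite [_^-1 * _]mulrC !mulrA ler_pdivrMr// mul1r.
apply: le_trans (pow_eP (_ : (3 * p + eo + 9 < eP)%N)); last by nlia.
have -> : z ^+ (3 * p + eo + 9) = z ^+ (2 * p + eo + 3) * z * z ^+ 5 * z ^+ p.
  by rewrite -exprSr -!exprD; congr (_ ^+ _); nlia.
have h5 : 32 <= z ^+ 5 by apply: le_trans (pow2_le 5); lra.
apply: ler_wpM2r; first exact: ltW.
have : z ^+ (2 * p + eo + 3) * mr * 32 <= z ^+ (2 * p + eo + 3) * z * z ^+ 5.
  apply: ler_pM => //; first by rewrite mulr_ge0// ltW.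
  by apply: ler_wpM2l => //; exact: ltW.
lra.
Qed.

Lemma pow_q3 : 2 * z ^+ (2 * p) + (2 + z ^+ et) * mr + (z ^+ a)^-1 <= z ^+ eh.
Proof.
have h1 : (z ^+ a)^-1 <= 1 by rewrite invf_le1.
have h2 : (2 + z ^+ et) * mr <= (3 * z ^+ et) * z.
  by apply: ler_pM => //; have := zp1 et; lra.
have h3 : z ^+ (2 * p) <= z ^+ (et + 2 * p + 1) by apply: pow_le; nlia.
have h4 : z ^+ et * z <= z ^+ (et + 2 * p + 1) by rewrite -exprSr; apply: pow_le; nlia.
have h5 : 8 * z ^+ (et + 2 * p + 1) <= z ^+ eh by apply: (@num_pow_le _ 3); [lra|nlia].
have := zp1 (et + 2 * p + 1); lra.
Qed.

Lemma pow_q4 : 2 * z ^+ (2 * p + eo + 3) * (2 + z ^+ et + z ^+ eh) + 4 * (z ^+ a)^-1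
  <= (z ^+ eo)^-1 / 2 * (z ^+ eP - 1).
Proof.
have h1 : (z ^+ a)^-1 <= 1 by rewrite invf_le1.
have h2 : z ^+ et <= z ^+ eh by apply: pow_le; nlia.
have h3 := zp1 eh; have h4 := zp1 (2 * p + eo + 3).
have h5 : z ^+ (2 * p + eo + 3) * (2 + z ^+ et + z ^+ eh) <= z ^+ (2 * p + eo + 3) * (4 * z ^+ eh).
  by apply: ler_wpM2l; [exact: ltW|lra].
have h6 : 1 <= z ^+ (2 * p + eo + 3) * z ^+ eh by rewrite -exprD.
have h7 : 16 * (z ^+ (2 * p + eo + 3) * z ^+ eh) <= z ^+ (2 * p + eo + eh + 7).
  by rewrite -exprD; apply: (@num_pow_le _ 4); [lra|nlia].
apply: le_trans (_ : z ^+ (2 * p + eo + eh + 7) <= _); first by lra.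
rewrite mulrAC ler_pdivlMr// ler_pdivlMl//.
apply: le_trans (pow_eP (_ : (2 * p + 2 * eo + eh + 8 < eP)%N)); last by nlia.
have -> : z ^+ (2 * p + 2 * eo + eh + 8) = z ^+ eo * z ^+ (2 * p + eo + eh + 7) * z.
  by rewrite -exprD -exprSr; congr (_ ^+ _); nlia.
by rewrite mulrA; apply: ler_wpM2l => //; rewrite mulr_ge0// ltW.
Qed.

Lemma pow_q6 : mr * (z ^+ eo)^-1 <= e / 16.
Proof.
apply: e16.
have -> : z ^+ eo = z * z ^+ 4 * z ^+ p * z.
  by rewrite -exprS -exprD -exprSr; congr (_ ^+ _); nlia.
have h5 : 16 <= z ^+ 4 by apply: le_trans (pow2_le 4); lra.
rewrite !(mulrAC _ _^-1) ler_pdivrMr ?mulr_gt0// mul1r.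
have h6 : mr * 16 * z ^+ p <= z * z ^+ 4 * z ^+ p.
  by apply: ler_wpM2r; [exact: ltW|apply: ler_pM].
have h7 : z * z ^+ 4 * z ^+ p * 1 <= z * z ^+ 4 * z ^+ p * z.
  by apply: ler_wpM2l => //; rewrite !mulr_ge0// ltW.
lra.
Qed.

Let om1 : mr * (z ^+ eo)^-1 <= 1. Proof. by have := pow_q6; move: e1; lra. Qed.
Let om0 : 0 <= mr * (z ^+ eo)^-1. Proof. by rewrite divr_ge0// ltW. Qed.

Lemma pow_Nd : N * (N * (z ^+ a)^-1) <= 1.
Proof.
rewrite mulrA ler_pdivrMr// mul1r; apply: le_trans (_ : z ^+ eN * z ^+ eN <= _).
  by apply: ler_pM.
by rewrite -exprD; apply: pow_le; nlia.
Qed.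

Lemma pow_q5 : N * (2 * z ^+ (2 * p) + 1 + 5 * (mr * (z ^+ eo)^-1)) + 1 + 3 * N * (N * (z ^+ a)^-1)
  < 3 * z ^+ et.
Proof.
have h1 : N * (2 * z ^+ (2 * p) + 1 + 5 * (mr * (z ^+ eo)^-1)) <= z ^+ eN * (8 * z ^+ (2 * p)).
  apply: ler_pM => //; last by have := zp1 (2 * p); move: om1; lra.
  by have := zp1 (2 * p); move: om0; lra.
have h2 : z ^+ eN * (8 * z ^+ (2 * p)) <= z ^+ (eN + 2 * p + 3).
  by rewrite mulrCA -exprD; apply: (@num_pow_le _ 3); [lra|nlia].
have h3 : 2 * z ^+ (eN + 2 * p + 3) <= z ^+ et by apply: (@num_pow_le _ 1); [rewrite expr1|nlia].
have h4 : 8 <= z ^+ (eN + 2 * p + 3).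
  by apply: le_trans (pow_le (_ : (3 <= _)%N)); [apply: le_trans (pow2_le 3); lra|nlia].
have := pow_Nd; lra.
Qed.

Lemma pow_q10 : (z ^+ a)^-1 <= e / 16.
Proof.
apply: e16; rewrite -mulrA mulrC ler_pdivrMr// mul1r.
by apply: (@num_pow_le _ 4); [lra|nlia].
Qed.

Lemma pow_q10' : 3 * N * (z ^+ a)^-1 <= e / 16.
Proof.
apply: e16; rewrite !(mulrAC _ _^-1) ler_pdivrMr// mul1r.
apply: le_trans (_ : 3 * z ^+ eN * 16 * z ^+ p <= _).
  by apply: ler_wpM2r; [exact: ltW|apply: ler_wpM2r => //; apply: ler_wpM2l].
have -> : 3 * z ^+ eN * 16 * z ^+ p = 48 * z ^+ (eN + p) by rewrite exprD; ring.
by apply: (@num_pow_le _ 6); [lra|nlia].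
Qed.

Lemma pow_q7 (G l : R) : 0 <= l -> l <= z -> G <= 6 * ((et + eo)%:R * l) -> (z ^+ ee)^-1 * G <= e / 2.
Proof.
move=> l0 lz hG; have -> : e / 2 = e / 2 ^+ 1 by rewrite expr1.
apply: le_e; rewrite expr1.
have h1 : (et + eo)%:R <= z ^+ (et + eo).
  apply: le_trans (pow2_le _); rewrite -natrX ler_nat; exact/ltnW/ltn_expl.
have h2 : (et + eo)%:R * l <= z ^+ (et + eo) * z by apply: ler_pM.
have h3 : G <= 6 * (z ^+ (et + eo) * z) by lra.
rewrite -!mulrA ler_pdivrMl// mulr1.
apply: le_trans (_ : 6 * (z ^+ (et + eo) * z) * (2 * z ^+ p) <= _).
  by apply: ler_wpM2r; [rewrite mulr_ge0// ltW|].
have -> : 6 * (z ^+ (et + eo) * z) * (2 * z ^+ p) = 12 * z ^+ (et + eo + 1 + p).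
  by rewrite !exprD expr1; ring.
by apply: (@num_pow_le _ 4); [lra|nlia].
Qed.

Lemma pow_eta : (z ^+ ee)^-1 <= 3 / 4.
Proof.
have : 2 <= z ^+ ee by rewrite -[leLHS]expr1; apply: le_trans (pow2_le 1) _; apply: pow_le; nlia.
move=> h; apply: le_trans (_ : 2^-1 <= _); last by lra.
by rewrite lef_pV2 ?posrE.
Qed.

End Powers.

(* Exponents of [z = m + 1]: [base_price = z^-xo], [cap_price = z^xt], [hinge_slope = z^xh],
   [barrier_slope = z^-xe], entries are at most [z^xP - 1] times the width of their column, and
   there are at most [z^xN] rounds.  [xL] breaks the circle between the number of rounds and the
   cap of the prices: it only has to satisfy [cK p <= 2 ^ xL p]. *)
Definition xL (p : nat) : nat := (60 + 10 * p)%N.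
Definition xN (p : nat) : nat := (xL p + p + 4)%N.
Definition xo (p : nat) : nat := (p + 6)%N.
Definition xt (p : nat) : nat := (xN p + 2 * p + 4)%N.
Definition xh (p : nat) : nat := (xt p + 2 * p + 5)%N.
Definition xP (p : nat) : nat := (xh p + 3 * p + 2 * xo p + 12)%N.
Definition xe (p : nat) : nat := (p + 5 + xt p + xo p)%N.
Definition xa (p : nat) : nat := (2 * xN p + p + xo p + 10)%N.
Definition xE (p : nat) : nat := (xe p + xh p + xt p + 1)%N.
Definition cC (p : nat) : nat := (2 ^ 17 * (xP p * (4 + 72 * (xt p + xo p))))%N.
Definition cK (p : nat) : nat := (4 * (cC p + 24 * (xt p + xo p) + 16))%N.

(** All exponents are affine in [p], hence at most a constant times [2 ^ p]. [cC] contains two such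
    factors, which gives [2 ^ 40 * 4 ^ p], below [2 ^ xL p]. *)
Lemma cK_le p : (cK p <= 2 ^ xL p)%N.
Proof.
set u := (2 ^ p)%N.
have u1 : (0 < u)%N by rewrite expn_gt0.
have pu : (p <= u)%N by apply/ltnW/ltn_expl.
have h1 : (xP p <= 2 ^ 7 * u)%N.
  by rewrite /xP /xh /xt /xN /xL /xo (_ : 2 ^ 7 = 128)%N//; move: u u1 pu => u; lia.
have h2 : (4 + 72 * (xt p + xo p) <= 2 ^ 13 * u)%N.
  by rewrite /xt /xN /xL /xo (_ : 2 ^ 13 = 2 ^ 6 * 2 ^ 7)%N// (_ : 2 ^ 7 = 128)%N// (_ : 2 ^ 6 = 64)%N//;
    clear h1; move: u u1 pu => u; lia.
have h3 : (cC p <= 2 ^ 37 * (u * u))%N.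
  apply: (@leq_trans (2 ^ 17 * ((2 ^ 7 * u) * (2 ^ 13 * u)))).
    by rewrite /cC leq_mul2l; apply/orP; right; exact: leq_mul.
  have -> : (2 ^ 37 = 2 ^ 17 * (2 ^ 7 * 2 ^ 13))%N by rewrite -!expnD; congr expn.
  rewrite [(2 ^ 7 * u * _)%N]mulnACA -[leqRHS]mulnA; exact: leqnn.
have h4 : (24 * (xt p + xo p) + 16 <= 2 ^ 37 * (u * u))%N.
  have x1 : (0 < xt p + xo p)%N by rewrite /xo !addnS.
  apply: (@leq_trans (2 ^ 13 * u)).
    by move: h2 x1; move: (2 ^ 13 * u)%N (xt p + xo p)%N; clear => v w; lia.
  by apply: leq_mul; [rewrite leq_exp2l|rewrite -[leqLHS]muln1 leq_mul2l u1 orbT].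
apply: (@leq_trans (2 ^ 2 * (2 ^ 38 * (u * u)))).
  rewrite /cK (_ : 2 ^ 2 = 4)%N// leq_mul2l/=.
  by rewrite (expnS 2 37) -mulnA mul2n -addnn -addnA; apply: leq_add.
rewrite /u -!expnD leq_exp2l// /xL; lia.
Qed.

(** * Logarithms and subpolynomial growth *)

Section LogFacts.
Variable R : realType.

(** Four quarter steps of the quadratic bound: [(21 / 16) ^ 4 < 3]. *)
Lemma expR1_le3 : expR (1 : R) <= 3.
Proof.
have h : expR (1 / 4 : R) <= 1 + 1 / 4 + (1 / 4) ^+ 2.
  by apply: expR_le_quadratic; rewrite ger0_norm//; lra.
have -> : (1 : R) = 4%:R * (1 / 4) by field.
rewrite expRM_natl.
apply: le_trans (_ : (1 + 1 / 4 + (1 / 4) ^+ 2) ^+ 4 <= _); last by lra.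
by apply: lerXn2r; rewrite ?nnegrE ?expR_ge0// !addr_ge0// ?exprn_ge0.
Qed.

Lemma logsize_ge (m : nat) : (0 < m)%N -> 1 / 4 <= logsize R m.
Proof.
move=> m0; rewrite /logsize -(@expRK R (1 / 4)) ler_ln ?posrE ?expR_gt0 ?ltr0n//.
apply: (@le_trans _ _ 2); last by rewrite ler_nat ltnS.
have := @expR_le_quadratic R (1 / 4); rewrite ger0_norm; last by lra.
by move=> /(_ (lexx _)); lra.
Qed.

Lemma logsize_le (m : nat) : logsize R m <= m.+1%:R.
Proof.
rewrite /logsize; have z0 : 0 < m.+1%:R :> R by rewrite ltr0n.
have := expR_ge1Dx (ln m.+1%:R : R); rewrite lnK ?posrE//; lra.
Qed.

Lemma expR_logsize (n m : nat) : expR (n%:R * logsize R m) = m.+1%:R ^+ n.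
Proof. by rewrite expRM_natl /logsize lnK ?posrE ?ltr0n. Qed.

Lemma expRN_logsize (n m : nat) : expR (- (n%:R * logsize R m)) = (m.+1%:R ^+ n)^-1.
Proof. by rewrite expRN expR_logsize. Qed.

(** From [ln x <= x ^ s / s] with [s = eta / 8] and [m + 1 <= m ^ 2], the logarithm is at most a
    constant times [m ^ (eta / 4)]. Its cube uses three quarters of the exponent, and the last
    quarter absorbs the constants once [m] is large. *)
Lemma subpoly_log3 (c a b : nat) :
  subpoly (fun m => c%:R * (a%:R * (logsize R m * (logsize R m * logsize R m)) + b%:R) : R).
Proof.
move=> eta eta0; set s := eta / 8; have s0 : 0 < s by rewrite divr_gt0.
set A : R := c%:R * (a%:R * (s^-1 * (s^-1 * s^-1)) + b%:R).
have si0 : 0 <= s^-1 by rewrite invr_ge0 ltW.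
have A0 : 0 <= A by rewrite /A mulr_ge0// addr_ge0// !mulr_ge0.
exists (maxn 2 (Num.trunc (A `^ (4 / eta))).+1) => m; rewrite geq_max => /andP[m2 mA].
have m1 : 1 <= m%:R :> R by rewrite ler1n ltnW.
have mp : 0 < m%:R :> R by lra.
set x : R := m.+1%:R; have x0 : 0 < x by rewrite ltr0n.
have x1 : 1 <= x by rewrite ler1n.
have lx : logsize R m <= s^-1 * x `^ s.
  rewrite mulrC ler_pdivlMr// mulrC /logsize -ln_powR.
  have y0 : 0 < x `^ s by rewrite powR_gt0.
  by have := expR_ge1Dx (ln (x `^ s)); rewrite lnK ?posrE//; lra.
have l0 : 0 <= logsize R m by rewrite /logsize ln_ge0.
have xm : x <= m%:R `^ 2 by rewrite powR_mulrn// /x -natrX ler_nat; clear -m2; nia.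
have ys : x `^ s <= m%:R `^ (2 * s).
  by rewrite powRrM; apply: ge0_ler_powR; rewrite ?nnegrE// ltW.
set y := m%:R `^ (2 * s) in ys.
have y1 : 1 <= y by rewrite -(powRr0 m%:R); apply: ler_powR => //; rewrite mulr_ge0// ltW.
have ly : logsize R m <= s^-1 * y by apply: le_trans lx _; apply: ler_wpM2l.
have l3 : logsize R m * (logsize R m * logsize R m) <= (s^-1 * (s^-1 * s^-1)) * (y * (y * y)).
  have -> : s^-1 * (s^-1 * s^-1) * (y * (y * y)) = s^-1 * y * ((s^-1 * y) * (s^-1 * y)) by ring.
  by apply: ler_pM => //; [rewrite mulr_ge0|apply: ler_pM].
have y31 : 1 <= y * (y * y) by rewrite mulr_ege1// mulr_ege1.
have fA : c%:R * (a%:R * (logsize R m * (logsize R m * logsize R m)) + b%:R) <= A * (y * (y * y)).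
  rewrite /A -mulrA; apply: ler_wpM2l => //; rewrite mulrDl; apply: lerD.
    by rewrite -mulrA; apply: ler_wpM2l.
  by rewrite ler_peMr.
apply: le_trans fA _.
have Am : A <= m%:R `^ (2 * s).
  have AE : A = (A `^ (4 / eta)) `^ (eta / 4).
    by rewrite -powRrM (_ : 4 / eta * (eta / 4) = 1) ?powRr1//; field; rewrite gt_eqF.
  rewrite AE (_ : 2 * s = eta / 4); last by rewrite /s; field.
  apply: ge0_ler_powR; rewrite ?nnegrE ?powR_ge0// ?divr_ge0 ?ltW//.
  by move: mA; rewrite truncn_lt_nat ?powR_ge0// => /ltW.
have -> : m%:R `^ eta = y * (y * (y * y)) :> R.
  rewrite /y -!powRD ?(gt_eqF mp) ?implybT//; congr (_ `^ _); by rewrite /s; field.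
by apply: ler_wpM2r => //; lra.
Qed.

End LogFacts.

(** * Running time *)

Section Time.
Variables (ao at_ ah aP ae aC aK : nat).

Definition time_const : nat :=
  (scost (prelude ao at_ ah aP ae aC aK) + (scost body_init + 50) + (scost body_sum + 151)
   + (scost body_width + 50) + (scost body_exp + scost body_norm + scost body_pieces
   + scost body_update + bcost guard + 318) + bcost guard + 1 + (scost body_average + 100) + 5)%N.

(** As [m] and [k] are positive, each of [1], [m], [k], [k * m] and the total oracle time is at most
    the final sum, so every summand is a constant times it. *)
Lemma total_time_le (R : realType) (m k : nat) (eps : R) (O : 'I_k -> oracle R m) :
  (0 < m)%N -> (0 < k)%N ->
  (total_time ao at_ ah aP ae aC aK eps O <=
   time_const * (1 + niter aK m eps) * \sum_(j < k) (oracle_time (O j) + m))%N.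
Proof.
move=> m0 k0; rewrite /total_time /time_const /iteration_time /column_time /first_time.
move: (niter aK m eps) (scost (prelude _ _ _ _ _ _ _)) (scost body_init) (scost body_sum)
  (scost body_width) (scost body_exp) (scost body_norm) (scost body_pieces) (scost body_update)
  (bcost guard) (scost body_average) => N cp ci cs cw ce cn cq cu cg ca.
rewrite !big_split/= !sum_nat_const !card_ord.
move: (\sum_(j < k) oracle_time (O j))%N => T; clear O.
set S := (T + k * m)%N.
have kS : (k <= S)%N by rewrite /S (leq_trans _ (leq_addl _ _))// leq_pmulr.
have mS : (m <= S)%N by rewrite /S (leq_trans _ (leq_addl _ _))// leq_pmull.
have kmS : (k * m <= S)%N by rewrite /S leq_addl.
have TS : (T <= S)%N by rewrite /S leq_addr.
have S1 : (1 <= S)%N by exact: leq_trans k0 kS.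
have cS c : (c <= c * S)%N by rewrite leq_pmulr.
have mc c : (m * c <= c * S)%N by rewrite mulnC leq_mul2l mS orbT.
have kc c : (k * c <= c * S)%N by rewrite mulnC leq_mul2l kS orbT.
have kmc c : (k * (m * c) <= c * S)%N by rewrite mulnA mulnC leq_mul2l kmS orbT.
clearbody S.
have t1 := cS cp.
have t2 : (m * (ci + 30) + 20 <= (ci + 50) * S)%N by move: (mc (ci + 30)%N) (cS 20%N); lia.
have t3 : (k * (m * (cs + 30) + 100) + T + 20 <= (cs + 151) * S)%N.
  by move: (kmc (cs + 30)%N) (kc 100%N) (cS 20%N); lia.
have t4 : (k * (cw + 30) + 20 <= (cw + 50) * S)%N by move: (kc (cw + 30)%N) (cS 20%N); lia.
have t5 : (m * (ce + 30) + m * (cn + 30) + 100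
    + (k * (m * (cq + 30)) + k * 20 + (k * (m * (cu + 30)) + k * 20) + k * 37 + T) + (cg + 20)
    <= (ce + cn + cq + cu + cg + 318) * S)%N.
  move: (mc (ce + 30)%N) (mc (cn + 30)%N) (kmc (cq + 30)%N) (kmc (cu + 30)%N) (kc 77%N) (cS 100%N)
    (cS (cg + 20)%N); lia.
have t6 := cS (cg + 1)%N.
have t7 : (k * (m * (ca + 30) + 20 + 30) + 20 <= (ca + 100) * S)%N.
  by move: (kmc (ca + 30)%N) (kc 50%N) (cS 20%N); lia.
have t8 := cS 5%N.
have t5' := leq_mul (leqnn N) t5.
set K := (X in (_ <= X * (1 + N) * S)%N).
have K5 : (ce + cn + cq + cu + cg + 318 <= K)%N by rewrite /K; lia.
apply: (@leq_trans (K * S + N * ((ce + cn + cq + cu + cg + 318) * S))); last first.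
  have gen (K' W : nat) : (W <= K' -> K' * S + N * (W * S) <= K' * (1 + N) * S)%N.
    move=> WK; rewrite mulnDr muln1 mulnDl leq_add2l mulnA [(K' * N)%N]mulnC.
    by rewrite leq_mul2r leq_mul2l WK !orbT.
  exact: gen.
move: t5'; set X5 := (N * ((ce + cn + cq + cu + cg + 318) * S))%N.
set Y5 := (N * _)%N => t5'; rewrite /K.
clearbody X5 Y5; move: t1 t2 t3 t4 t6 t7 t8 t5'; clear; lia.
Qed.
End Time.

Lemma niter_bounds (R : realType) (aK m : nat) (eps : R) : 0 < eps ->
  rounds aK R m / accuracy eps <= (niter aK m eps)%:R <= rounds aK R m / accuracy eps + 1.
Proof.
move=> e0; have K0 : 0 <= rounds aK R m / accuracy eps.
  by rewrite divr_ge0 ?mulr_ge0 ?ln_ge0 ?ler1n// ltW// accuracy_gt0.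
rewrite /niter; apply/andP; split; first by rewrite ltW// truncnS_gt.
by rewrite -natr1 lerD2r -truncn_ge_nat.
Qed.

Lemma max_accuracy (R : realType) (eps : R) : 0 < eps -> Num.max 1 eps^-1 = (accuracy eps)^-1.
Proof.
move=> e0; rewrite /accuracy; have [e1|e1] := leP eps 1.
  by apply/max_idPr; rewrite invf_ge1.
by rewrite invr1; apply/max_idPl; rewrite invf_le1// ltW.
Qed.

Lemma constant_load (R : realType) (l u v T : R) : 1 / 4 <= l -> 0 <= u -> 4 <= v ->
  16 * 20 ^+ 3 <= T -> 40 * (6 * (u * l)) <= T * (v * (4 + 72 * u)) * (l * l).
Proof.
move=> l4 u0 v4 hT; have l0 : 0 <= l by lra.
have T64 : 64 <= T.
  by apply: le_trans hT; have : 20 <= 20 ^+ 3 :> R by [apply: ler_eXnr; rewrite // ler1n]; lra.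
have h1 : 64 * (4 * (72 * u)) <= T * (v * (4 + 72 * u)).
  by apply: ler_pM => //; [rewrite !mulr_ge0|apply: ler_pM => //; rewrite ?mulr_ge0//; lra].
have h2 : (1 / 4) * l <= l * l by apply: ler_wpM2r.
apply: le_trans (_ : 64 * (4 * (72 * u)) * (1 / 4 * l) <= _).
  by have := mulr_ge0 u0 l0; lra.
by apply: ler_pM => //; rewrite !mulr_ge0.
Qed.

Lemma constant_scale (R : realType) (l u v T r : R) : 1 / 4 <= l -> 0 <= u -> 0 <= v -> 0 <= r ->
  16 * 20 ^+ 3 <= T ->
  16 * (20 ^+ 3 * (v * l) * (r * (1 + 12 * (6 * (u * l))))) <= T * (v * (4 + 72 * u)) * (l * l) * r.
Proof.
move=> l4 u0 v0 r0 hT; have l0 : 0 <= l by lra.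
have h1 : 1 + 12 * (6 * (u * l)) <= (4 + 72 * u) * l by lra.
have -> : 16 * (20 ^+ 3 * (v * l) * (r * (1 + 12 * (6 * (u * l))))) =
  (16 * 20 ^+ 3) * ((v * l * r) * (1 + 12 * (6 * (u * l)))) by rewrite !mulrA; congr (_ * _); ring.
have -> : T * (v * (4 + 72 * u)) * (l * l) * r = T * ((v * l * r) * ((4 + 72 * u) * l)) by ring.
have vlr : 0 <= v * l * r by rewrite !mulr_ge0.
apply: ler_pM => //; last exact: ler_wpM2l.
by rewrite mulr_ge0// addr_ge0// !mulr_ge0.
Qed.

(** The constants come from [1 <= 16 * l ^ 2] and [1 <= 64 * l ^ 3]: [24 = 3 / 2 * 16] and
    [16 = 64 / 4]. *)
Lemma constant_rounds (R : realType) (l u c r lm N e : R) : 1 / 4 <= l -> 0 <= u -> 0 <= c -> 0 <= r ->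
  lm <= l -> 4 * (c + 24 * u + 16) * (l * (l * l)) <= N * e ->
  c * (l * l) * r * lm + 6 * (u * l) * r / 4 + r / 4 <= N * (e * r / 4).
Proof.
move=> l4 u0 c0 r0 lml hN; have l0 : 0 <= l by lra.
have h0 := ler_wpM2r r0 hN.
have h1 : c * (l * l) * r * lm <= c * (l * l) * r * l by apply: ler_wpM2l => //; rewrite !mulr_ge0.
have h2 : 1 / 4 * (1 / 4) <= l * l by apply: ler_pM => //; lra.
have ur : 0 <= u * l * r by rewrite !mulr_ge0.
have h3 := ler_wpM2l ur h2.
have h4 : 1 / 4 * (1 / 4 * (1 / 4)) <= l * (l * l).
  by apply: ler_pM => //; rewrite ?mulr_ge0//; lra.
have h5 := ler_wpM2l r0 h4.
lra.
Qed.

Lemma xE_ge p : [/\ (xe p <= xE p)%N, (xh p <= xE p)%N & ((xt p).+1 <= xE p)%N].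
Proof. by rewrite /xE; move: (xe p) (xh p) (xt p) => x y z; split; lia. Qed.

Lemma error_radius (R : realType) (e eps rho delta : R) : e <= 1 -> e <= eps ->
  0 < rho -> 0 < delta -> 0 < e -> e * Num.max rho delta <= eps * rho + delta.
Proof.
move=> e1 ee rho0 delta0 e0.
have h1 : e * rho <= eps * rho by apply: ler_wpM2r => //; exact: ltW.
have h2 : e * delta <= delta by rewrite ger_pMl.
have h3 : 0 <= eps * rho by apply: mulr_ge0; [exact: le_trans (ltW e0) ee|exact: ltW].
by case: (leP rho delta) => _; lra.
Qed.

(** [e <= 1] lets the additive constants be absorbed into the division by [e]. *)
Lemma round_count (R : realType) (N e K : R) : 0 < e -> e <= 1 -> N <= K / e + 1 ->
  1 + N <= (K + 2) / e.
Proof.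
move=> e0 e1 KN; rewrite ler_pdivlMr//.
have := ler_wpM2r (ltW e0) KN; rewrite mulrDl mul1r divfK ?gt_eqF//.
lra.
Qed.

Theorem theorem5p3 (R : realType) (p : nat) :
  exists (A : algorithm) (C q : nat) (f : nat -> R),
    subpoly f /\
    forall (m k : nat) (Rad B rho eps delta dsco : R)
      (X : 'I_k -> set 'cV[R]_m) (psi : 'I_k -> 'cV[R]_m -> R)
      (O : 'I_k -> oracle R m) (Xbar : 'M[R]_(m, k)),
    (0 < m)%N -> (0 < k)%N ->
    0 < Rad <= polybd R p m ->
    0 < B <= polybd R p m ->
    (forall j, [/\ X j !=set0, convex_set (X j), compact (X j) &
       forall x, X j x -> forall i, 0 <= x i 0 <= Rad]) ->
    (forall j, convex_function (X j) (psi j)) ->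
    (forall Y, colprod X Y -> 0 <= `|psisum psi Y| <= B) ->
    colprod X Xbar ->
    0 < rho -> 3 / 2 * norm1oo Xbar <= rho ->
    (polybd R p m)^-1 < eps -> (polybd R p m)^-1 < delta ->
    0 < dsco <= (polybd R q (m * k))^-1 ->
    (forall j, is_sco C (X j) (psi j) dsco (O j)) ->
    exists (n : nat) (s : state R),
      [/\ exec (ask O) A (alg_input m k rho eps delta) n s,
          n%:R <= f m * (\sum_(j < k) (oracle_time (O j) + m)%:R *
                           Num.max 1 eps^-1),
          colprod X (alg_output m k s) &
          psisum psi (alg_output m k s) + norm1oo (alg_output m k s) <=
            psisum psi Xbar + norm1oo Xbar + eps * rho + delta].
Proof.
exists (regression_code (xo p) (xt p) (xh p) (xP p) (xe p) (cC p) (cK p)).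
(* The first sum meets all demands on [C] at once: three pieces per query and the conditions of
   [computable_ginv]. In the exponent for [dsco], [p] pays for the radius, 1 for the factor [k], and
   [xa p] is the error that remains. *)
exists (3 + 4 ^ xE p + (xE p).*2.+2 + scost gcode)%N, (p + 1 + xa p)%N.
pose tc := time_const (xo p) (xt p) (xh p) (xP p) (xe p) (cC p) (cK p).
exists (fun m => tc%:R * ((cK p)%:R * (logsize R m * (logsize R m * logsize R m)) + 2%:R)).
split; first exact: subpoly_log3.
move=> m k Rad B rho eps delta dsco X psi O Y m0 k0 _ /andP[B0 Bz] XX psi_conv psi_bound Y_in rho0
  Y_norm epsz deltaz /andP[d0 dz] sco.
set Cn := (_ + scost gcode)%N in sco.
have Cn3 : (3 <= Cn)%N by rewrite /Cn -!addnA leq_addr.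
have CnE : (4 ^ xE p <= Cn)%N by rewrite /Cn -addnA [(3 + _)%N]addnC -!addnA leq_addr.
have CnE2 : ((xE p).*2.+2 <= Cn)%N by rewrite /Cn addnAC leq_addl.
have Cng : (scost gcode <= Cn)%N by rewrite /Cn leq_addl.
clearbody Cn.
have XX_ge0 j x : X j x -> forall i, 0 <= x i 0.
  by move=> Xx i; have [_ _ _ /(_ x Xx i)/andP[]] := XX j.
have XX_conv j : convex_set (X j) by have [] := XX j.
have psiB Z : colprod X Z -> `|psisum psi Z| <= B by move=> /psi_bound/andP[].
set z : R := m.+1%:R.
have zE n : polybd R n m = z ^+ n by [].
have z2 : 2 <= z by rewrite ler_nat ltnS.
have z1 : 1 <= z by lra.
have z0 : 0 < z by lra.
have zp n : 0 < z ^+ n by exact: exprn_gt0.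
have zp1 n : 1 <= z ^+ n by exact: exprn_ege1.
have mz : m%:R <= z :> R by rewrite ler_nat.
have mr0 : 0 <= m%:R :> R by [].
rewrite !zE in epsz deltaz Bz.
have eps0 : 0 < eps by apply: lt_trans epsz; rewrite invr_gt0.
set e := accuracy eps; set r1 := radius rho delta; set l := logsize R m.
have e0 : 0 < e by exact: accuracy_gt0.
have e1 : e <= 1 by rewrite /e /accuracy ge_min lexx orbT.
have ep : (z ^+ p)^-1 <= e by rewrite /e /accuracy le_min (ltW epsz) invf_le1//=.
have r0 : 0 < r1 by exact: radius_gt0.
have rz : (z ^+ p)^-1 <= r1 by rewrite /r1 /radius le_max (ltW deltaz) orbT.
have rhor : rho <= r1 by rewrite /r1 /radius le_max lexx.
have l4 : 1 / 4 <= l := logsize_ge R m0.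
have lle : l <= z := logsize_le R m.
have l0 : 0 < l by lra.
set G := overload (base_price (xo p) R m) (cap_price (xt p) R m).
have omE : base_price (xo p) R m = (z ^+ xo p)^-1 by exact: expRN_logsize.
have MtE : cap_price (xt p) R m = z ^+ xt p by exact: expR_logsize.
have MhE : hinge_slope (xh p) R m = z ^+ xh p by exact: expR_logsize.
have etaE : barrier_slope (xe p) R m = (z ^+ xe p)^-1 by exact: expRN_logsize.
have GE : G = 6 * ((xt p + xo p)%:R * l).
  rewrite /G /overload MtE omE invrK -exprD; congr (_ * _).
  by rewrite lnXn// mulr_natl.
have xP4 : 4 <= (xP p)%:R :> R by rewrite ler_nat /xP (leq_trans _ (leq_addl _ 12)).
have thE : theta (xP p) R m = ((xP p)%:R * l)^-1 by rewrite /theta div1r.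
have Pl : 1 <= (xP p)%:R * l.
  by have := ler_pM (_ : 0 <= 4) (_ : 0 <= 1 / 4) xP4 l4; lra.
have th0 : 0 < theta (xP p) R m by rewrite thE invr_gt0; lra.
have th1 : theta (xP p) R m <= 1 by rewrite thE invf_le1//; lra.
pose u : R := (xt p + xo p)%:R.
have u0 : 0 <= u by [].
have cCE : (cC p)%:R = (2 ^ 17)%:R * ((xP p)%:R * (4 + 72 * u)) :> R.
  by rewrite /cC /u 2!natrM (natrD _ 4) natrM.
have cKE : (cK p)%:R = 4 * ((cC p)%:R + 24 * u + 16) :> R.
  by rewrite /cK /u natrM 2!natrD natrM.
(* [16 * 20 ^ 3 = 128000] and [2 ^ 17 = 131072]; this is the constant in [cC]. *)
have b17 : 16 * 20 ^+ 3 <= (2 ^ 17)%:R :> R.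
  have -> : 20 = 4 * 5 :> R by lra.
  rewrite natrX exprMn; have : 5 ^+ 3 <= 2 ^+ 7 :> R by lra.
  have -> : (2%:R : R) ^+ 17 = 16 * (4 ^+ 3 * 2 ^+ 7).
    by have -> : 16 = 2 ^+ 4 :> R by [lra]; have -> : 4 = 2 ^+ 2 :> R by [lra]; rewrite -exprM -!exprD.
  by move=> h; apply: ler_wpM2l => //; apply: ler_wpM2l => //; rewrite exprn_ge0.
have C0 : 0 <= (cC p)%:R :> R by [].
have Kc0 : 0 <= rounds (cK p) R m by rewrite /rounds !mulr_ge0// ltW.
have xEge n : (n <= xE p)%N -> z ^+ n <= polybd R (xE p) m by move=> nE; exact: ler_weXn2l.
have [xEe xEh xEt] := xE_ge p.
have MtE' : 1 + cap_price (xt p) R m <= polybd R (xE p) m.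
  rewrite MtE; apply: le_trans (xEge (xt p).+1 xEt).
  rewrite exprS; apply: le_trans (_ : 2 * z ^+ xt p <= _); first by have := zp1 (xt p); lra.
  by apply: ler_wpM2r => //; exact: ltW.
have etaE' : (barrier_slope (xe p) R m)^-1 <= polybd R (xE p) m.
  by rewrite etaE invrK; exact: xEge.
have MhE' : hinge_slope (xh p) R m <= polybd R (xE p) m.
  by rewrite MhE; exact: xEge.
have [n [s [r [W [ex nt ropt [W0 Win Wopt] out]]]]] :=
  @regression_correct (xo p) (xt p) (xh p) (xP p) (xe p) (cC p) (cK p) R m k Cn (xE p) X psi rho eps
    delta dsco O m0 k0 Cn3 CnE CnE2 Cng sco XX_ge0 rho0 eps0 th0 th1 Kc0 MtE' etaE' MhE'.
exists n, s.
have /andP[NK KN] := niter_bounds (cK p) m eps0.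
rewrite -/e in NK KN.
set N := niter (cK p) m eps in nt W0 Win Wopt out NK KN.
have KcE : rounds (cK p) R m = (cK p)%:R * (l * (l * l)) by [].
have l3 : l * (l * l) <= z ^+ 3.
  rewrite !exprS expr0 mulr1; apply: ler_pM => //; first exact: ltW.
    by rewrite mulr_ge0// ltW.
  by apply: ler_pM => //; exact: ltW.
(* In [xN = xL + p + 4], [xL] covers the constant [cK], [p] the factor [1 / e], 3 the cubed
   logarithm and 1 the rounding. *)
have Nz : N%:R <= z ^+ xN p.
  have h1 : (cK p)%:R <= z ^+ xL p.
    apply: le_trans (pow2_le z2 (xL p)); rewrite -natrX ler_nat; exact: cK_le.
  have h2 : rounds (cK p) R m / e <= z ^+ xL p * z ^+ 3 * z ^+ p.
    apply: ler_pM => //; first by rewrite invr_ge0 ltW.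
      by rewrite KcE; apply: ler_pM => //; rewrite !mulr_ge0// ltW.
    by rewrite -[leRHS]invrK lef_pV2 ?posrE ?invr_gt0.
  have h3 : z ^+ xN p = z ^+ xL p * z ^+ 3 * z ^+ p * z.
    by rewrite -!exprD -exprSr; congr (_ ^+ _); rewrite /xN; move: (xL p); clear => x; lia.
  rewrite h3; have h4 : 1 <= z ^+ xL p * z ^+ 3 * z ^+ p by rewrite -!exprD.
  apply: le_trans KN _; have := ler_wpM2l (le_trans ler01 h4) z2; move: h2 h4; lra.
have N0 : (0 < N)%N by [].
have Nr : 0 < N%:R :> R by rewrite ltr0n.
have ck0 : 0 <= (cK p)%:R :> R by [].
have eoE : xo p = (p + 6)%N by [].
have etE : xt p = (xN p + 2 * p + 4)%N by [].
have ehE : xh p = (xt p + 2 * p + 5)%N by [].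
have ePE : xP p = (xh p + 3 * p + 2 * xo p + 12)%N by [].
have eeE : xe p = (p + 5 + xt p + xo p)%N by [].
have aE : xa p = (2 * xN p + p + xo p + 10)%N by [].
(* [theta] is the reciprocal of [ln (z ^ xP)], so the power equals [exp 1]. *)
have PPE : (1 + (z ^+ xP p - 1)) `^ theta (xP p) R m <= 3.
  have -> : 1 + (z ^+ xP p - 1) = z ^+ xP p by ring.
  rewrite /powR gt_eqF// lnXn// -/l -(mulr_natl l (xP p)) thE mulVf ?gt_eqF//; first exact: expR1_le3.
  by apply: lt_le_trans Pl.
(* One factor [y = m k + 1] absorbs [k]; the others are at least [z], and [p] of them pay for
   [r1 >= z ^ (- p)]. *)
have kd : k%:R * dsco <= (z ^+ xa p)^-1 * r1.
  set y : R := (m * k).+1%:R.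
  have y0 : 0 < y by rewrite ltr0n.
  have ky : k%:R <= y :> R by rewrite ler_nat (leq_trans (leq_pmull k m0)).
  have zy : z <= y by rewrite ler_nat ltnS leq_pmulr.
  have h1 : k%:R * dsco <= (y ^+ (p + xa p))^-1.
    apply: le_trans (ler_pM _ (ltW d0) ky dz) _ => //.
    by rewrite /polybd -/y (_ : p + 1 + xa p = (p + xa p).+1)%N ?exprS ?invfM ?mulrA ?mulfV ?mul1r ?gt_eqF//
      addn1 addSn.
  apply: le_trans h1 _; apply: le_trans (_ : (z ^+ (p + xa p))^-1 <= _).
    by rewrite lef_pV2 ?posrE ?exprn_gt0//; apply: lerXn2r => //; rewrite ?nnegrE ltW.
  rewrite exprD invfM mulrC; apply: ler_wpM2l => //; by rewrite invr_ge0 ltW.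
have Bb : B <= z ^+ (2 * p) * r1.
  apply: le_trans Bz _; rewrite mul2n -addnn exprD -mulrA -[leLHS]mulr1.
  apply: ler_wpM2l; first exact: ltW.
  by have := ler_wpM2l (ltW (zp p)) rz; rewrite mulfV// gt_eqF.
have r0' := ltW r0.
have q8 : 40 * (G * r1) <= temperature (cC p) m rho delta.
  have -> : temperature (cC p) m rho delta = (cC p)%:R * (l * l) * r1 by [].
  rewrite mulrA; apply: ler_wpM2r => //; rewrite GE -/u cCE.
  exact: constant_load xP4 b17.
have q8' : 16 * (20 ^+ 3 / theta (xP p) R m * (r1 * (1 + 12 * G))) <= temperature (cC p) m rho delta.
  have -> : temperature (cC p) m rho delta = (cC p)%:R * (l * l) * r1 by [].
  rewrite GE -/u cCE thE invrK; by apply: constant_scale.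
have lm : ln m%:R <= l by rewrite /l /logsize ler_ln ?posrE ?ltr0n ?ler_nat.
have q9 : temperature (cC p) m rho delta * ln m%:R + G * r1 / 4 + r1 / 4 <= N%:R * (e * r1 / 4).
  have -> : temperature (cC p) m rho delta = (cC p)%:R * (l * l) * r1 by [].
  rewrite GE -/u; rewrite KcE cKE ler_pdivrMr// in NK; by apply: constant_rounds NK.
have CC0 : 0 < temperature (cC p) m rho delta.
  apply: lt_le_trans q8; rewrite GE !mulr_gt0// ltr0n; done.
have q2 := pow_q2 z2 eoE etE ehE ePE eeE aE.
have PP0 : 0 < z ^+ xP p - 1 by apply: lt_le_trans q2; rewrite mulr_gt0.
have eta34 : barrier_slope (xe p) R m <= 3 / 4 by rewrite etaE; exact: pow_eta z2 eoE etE ehE ePE eeE aE.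
have q1 := pow_q1 z2 mz eoE etE ehE ePE eeE aE.
have q2' := pow_q2' z2 mz mr0 ep eoE etE ehE ePE eeE aE.
have q3 := pow_q3 z2 mz mr0 eoE etE ehE ePE eeE aE.
have q4 := pow_q4 z2 eoE etE ehE ePE eeE aE.
have q5 := pow_q5 z2 mz mr0 e1 ep (ltW Nr) Nz eoE etE ehE ePE eeE aE.
have q6 := pow_q6 z2 mz mr0 ep eoE etE ehE ePE eeE aE.
have q7 : barrier_slope (xe p) R m * G <= e / 2.
  rewrite etaE; apply: (pow_q7 z2 ep eoE etE ehE ePE eeE aE (ltW l0) lle); by rewrite GE.
have q10 := pow_q10 z2 ep eoE etE ehE ePE eeE aE.
have q10' := pow_q10' z2 ep Nz eoE etE ehE ePE eeE aE.
rewrite -omE -?MtE -?MhE in q1 q3 q4 q5 q6.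
have [outX bound] := @average_bound R m k N X psi r1 (temperature (cC p) m rho delta) (base_price (xo p) R m)
  (cap_price (xt p) R m) (hinge_slope (xh p) R m) (z ^+ xP p - 1) (theta (xP p) R m) (barrier_slope (xe p) R m) dsco B
  (z ^+ (2 * p)) (z ^+ xa p)^-1 (z ^+ (2 * p + xo p + 3)) e Y (fun j => r j) W m0 k0 N0 r0 CC0
  (base_price_gt0 _ _ _) (le_trans (base_price_le1 _ _ _) (cap_price_ge1 _ _ _)) (hinge_slope_gt0 _ _ _) PP0 (ltW d0) (ltW B0) th0 th1
  (barrier_slope_gt0 _ _ _) eta34 PPE XX_conv psi_conv XX_ge0 psiB Y_in (le_trans Y_norm rhor) ropt W0 Win Wopt
  e0 e1 Bb kd q1 q2 q2' q3 q4 q5 q6 q7 q8 q8' q9 q10 q10' (alg_output m k s) out.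
split=> //; last first.
  apply: le_trans bound _; rewrite -[leRHS]addrA lerD2l.
  apply: error_radius => //; first by rewrite /e /accuracy ge_min lexx.
  by apply: lt_trans deltaz; rewrite invr_gt0.
rewrite -mulr_suml -natr_sum max_accuracy// -/e.
set S := (\sum_(j < k) _)%N.
have tS := leq_trans nt (total_time_le (xo p) (xt p) (xh p) (xP p) (xe p) (cC p) (cK p) eps O m0 k0).
apply: (@le_trans _ _ (tc * (1 + N) * S)%N%:R); first by rewrite ler_nat.
rewrite natrM [(tc * _)%:R]natrM natrD; set Sr : R := S%:R.
rewrite [leRHS]mulrA [leRHS]mulrAC; apply: ler_wpM2r => //; rewrite -mulrA; apply: ler_wpM2l => //.
by rewrite -/l -KcE; exact: round_count.
Qed.
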